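(* Any Segal space is a decomposition space.
   Context: $\mathcal S$ is the $\infty$-category of $\infty$-groupoids (spaces); pullbacks and equivalences are meant in the $\infty$-categorical sense. $\boldsymbol{\Delta}$ is the category of nonempty finite ordinals $[k]=\{0,\dots,k\}$, $k\ge 0$, and monotone maps. A simplicial space is a functor $X:\boldsymbol{\Delta}^{\mathrm{op}}\to\mathcal S$. A Segal space is a simplicial space $X$ for which the Segal maps $X_r\to X_1\times_{X_0}\cdots\times_{X_0}X_1$ ($r$ factors), induced by the maps $[1]\to[r]$, $0,1\mapsto k-1,k$, are equivalences for all $r\ge 0$ (by convention the condition is automatic for $r=0,1$). A map $g:[m]\to[n]$ in $\boldsymbol{\Delta}$ is active if $g(0)=0$ and $g(m)=n$, and $f:[m]\to[n]$ is inert if $f(i+1)=f(i)+1$ for $0\le i\le m-1$. Active and inert maps admit pushouts along each other in $\boldsymbol{\Delta}$. A decomposition space is a simplicial space sending every pushout square in $\boldsymbol{\Delta}$ of an active map along an inert map to a pullback square in $\mathcal S$. *)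

(* Defs.v *)
(** The infinity-category of spaces is modelled, as usual, by the homotopy
    coherent nerve of the simplicially enriched category of Kan complexes:
    equivalences are homotopy equivalences of Kan complexes, limits are homotopy
    limits, and a functor from an ordinary category is a homotopy coherent
    diagram.  *)
From mathcomp Require Import all_boot boolp.

Set Implicit Arguments.
Unset Strict Implicit.
Unset Printing Implicit Defensive.

(** * The category Delta *)

(* The object [n] is encoded by the natural number n. *)
Record dhom (m n : nat) := DHom {
  dfun :> 'I_m.+1 -> 'I_n.+1;
  dmono : forall i j : 'I_m.+1, i <= j -> dfun i <= dfun j }.

Lemma dhom_ext m n (f g : dhom m n) : (forall i, f i = g i) -> f = g.
Proof.
case: f g => [f hf] [g hg] /= /funext e; case: _ / e hg => hg.
by congr DHom; apply: Prop_irrelevance.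
Qed.

Definition did n : dhom n n := @DHom n n id (fun _ _ h => h).

Definition dcomp m n p (g : dhom n p) (f : dhom m n) : dhom m p :=
  @DHom m p (fun i => g (f i)) (fun i j h => dmono g (dmono f h)).

Lemma dcompA m n p q (h : dhom p q) (g : dhom n p) (f : dhom m n) :
  dcomp h (dcomp g f) = dcomp (dcomp h g) f.
Proof. by apply: dhom_ext. Qed.

Lemma dcompf1 m n (f : dhom m n) : dcomp f (did m) = f.
Proof. by apply: dhom_ext. Qed.

Lemma dcomp1f m n (f : dhom m n) : dcomp (did n) f = f.
Proof. by apply: dhom_ext. Qed.

Definition dconst m n (i : 'I_n.+1) : dhom m n :=
  @DHom m n (fun=> i) (fun _ _ _ => leqnn i).

Lemma spine_edge_bound r (i : 'I_r) (u : 'I_2) : i + u < r.+1.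
Proof.
have u1 : u <= 1 by rewrite -ltnS.
by rewrite ltnS (leq_trans _ (ltn_ord i)) // -[i.+1]addn1 leq_add2l.
Qed.

Definition spine_edge r (i : 'I_r) : dhom 1 r :=
  @DHom 1 r (fun u => Ordinal (spine_edge_bound i u))
    (fun u v h => leq_add (leqnn i) h).

Lemma spine_edge_comm n (j : 'I_n.+1) :
  dcomp (spine_edge (widen_ord (leqnSn n.+1) j)) (dconst 0 ord_max) =
  dcomp (spine_edge (lift ord0 j)) (dconst 0 ord0).
Proof.
by apply: dhom_ext => i; apply: val_inj; rewrite /= /bump addn0 addn1.
Qed.

Definition active m n (g : dhom m n) : Prop :=
  g ord0 = ord0 /\ g ord_max = ord_max.

Definition inert m n (f : dhom m n) : Prop :=
  forall i j : 'I_m.+1, j = i.+1 :> nat -> f j = (f i).+1 :> nat.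

Definition is_pushout m n m' n' (g : dhom m n) (f : dhom m m')
    (f' : dhom n n') (g' : dhom m' n') : Prop :=
  dcomp f' g = dcomp g' f /\
  forall p (a : dhom n p) (b : dhom m' p), dcomp a g = dcomp b f ->
    exists! w : dhom n' p, dcomp w f' = a /\ dcomp w g' = b.

(** * Simplicial sets and Kan complexes *)

Record sset := SSet {
  simp :> nat -> Type;
  sact : forall m n, dhom m n -> simp n -> simp m;
  sact1 : forall n (x : simp n), sact (did n) x = x;
  sactM : forall m n p (g : dhom n p) (f : dhom m n) (x : simp p),
    sact (dcomp g f) x = sact f (sact g x) }.

Record smap (A B : sset) := SMap {
  smapf :> forall n, A n -> B n;
  smapN : forall m n (f : dhom m n) (x : A n),
    smapf (sact f x) = sact f (smapf x) }.
Arguments smapf {A B} s n x.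

Lemma smap_ext A B (f g : smap A B) : (forall n x, f n x = g n x) -> f = g.
Proof.
case: f g => [f hf] [g hg] /= h.
have e : f = g by apply: functional_extensionality_dep => n; apply: funext.
by case: _ / e hg {h} => hg; congr SMap; apply: Prop_irrelevance.
Qed.

Definition sid A : smap A A := @SMap A A (fun _ x => x) (fun _ _ _ _ => erefl).

Program Definition scomp A B C (g : smap B C) (f : smap A B) : smap A C :=
  @SMap A C (fun n x => g n (f n x)) _.
Next Obligation. by rewrite !smapN. Qed.

Definition simplex (n : nat) : sset :=
  @SSet (fun m => dhom m n) (fun _ _ f x => dcomp x f)
    (fun _ x => dcompf1 x) (fun _ _ _ g f x => dcompA x g f).

Program Definition sprod (A B : sset) : sset :=
  @SSet (fun n => A n * B n)%type
    (fun _ _ f x => (sact f x.1, sact f x.2)) _ _.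
Next Obligation. by rewrite !sact1. Qed.
Next Obligation. by rewrite !sactM. Qed.

Definition in_horn n (k : 'I_n.+1) m (a : dhom m n) : Prop :=
  exists2 i, i <> k & forall u, a u <> i.

Lemma in_horn_comp n (k : 'I_n.+1) l m (a : dhom m n) (f : dhom l m) :
  in_horn k a -> in_horn k (dcomp a f).
Proof. by case=> i ik hi; exists i => //= u; apply: hi. Qed.

Program Definition horn (n : nat) (k : 'I_n.+1) : sset :=
  @SSet (fun m => {a : dhom m n | in_horn k a})
    (fun _ _ f x => exist _ (dcomp (sval x) f) (in_horn_comp f (svalP x))) _ _.
Next Obligation. by apply: eq_exist; apply: dcompf1. Qed.
Next Obligation. by apply: eq_exist; apply: dcompA. Qed.

Definition is_kan (A : sset) : Prop :=
  forall n (k : 'I_n.+2) (h : smap (horn k) A),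
    exists x : smap (simplex n.+1) A, forall m (a : horn k m),
      x m (sval a) = h m a.

Definition homotopic A B (f g : smap A B) : Prop :=
  exists h : smap (sprod A (simplex 1)) B, forall n (a : A n),
    h n (a, dconst n ord0) = f n a /\ h n (a, dconst n ord_max) = g n a.

Definition is_equivalence A B (f : smap A B) : Prop :=
  exists g : smap B A,
    homotopic (scomp g f) (sid A) /\ homotopic (scomp f g) (sid B).

Program Definition shom (K A : sset) : sset :=
  @SSet (fun n => smap (sprod (simplex n) K) A)
    (fun m n f x => @SMap (sprod (simplex m) K) A
       (fun l u => x l (dcomp f u.1, u.2)) _) _ _.
Next Obligation. by rewrite -smapN /= dcompA. Qed.
Next Obligation. by apply: smap_ext => l [u v] /=; rewrite dcomp1f. Qed.
Next Obligation. by apply: smap_ext => l [u v] /=; rewrite dcompA. Qed.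

Definition path_space (A : sset) : sset := shom (simplex 1) A.

Program Definition endpoint A (e : 'I_2) : smap (path_space A) A :=
  @SMap (path_space A) A
    (fun n p => smapf p n (did n, dconst n e)) _.
Next Obligation.
rewrite -smapN /= dcomp1f dcompf1; congr (smapf x _ (_, _)).
Qed.

(** * Homotopy limits of zigzags *)

(* A diagram consisting of objects [B i] and [D j] together with, for each j, a
   cospan  B (s j) -> D j <- B (t j).  A point of its homotopy limit consists of
   points b i of B i and, for each j, two paths in D j with the same source and
   with targets the images of b (s j) and b (t j); the common source is the
   D j-component of the point. *)
Section HoLim.
Variables (I J : Type) (s t : J -> I) (B : I -> sset) (D : J -> sset).
Variables (l : forall j, smap (B (s j)) (D j)).
Variables (r : forall j, smap (B (t j)) (D j)).

Record holim_simp (n : nat) := HoLimSimp {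
  hl_pt : forall i, B i n;
  hl_left : forall j, path_space (D j) n;
  hl_right : forall j, path_space (D j) n;
  hl_source : forall j,
    endpoint (D j) ord0 n (hl_left j) = endpoint (D j) ord0 n (hl_right j);
  hl_targetl : forall j,
    endpoint (D j) ord_max n (hl_left j) = l j n (hl_pt (s j));
  hl_targetr : forall j,
    endpoint (D j) ord_max n (hl_right j) = r j n (hl_pt (t j)) }.

Lemma holim_simp_ext n (x y : holim_simp n) :
  (forall i, hl_pt x i = hl_pt y i) ->
  (forall j, hl_left x j = hl_left y j) ->
  (forall j, hl_right x j = hl_right y j) -> x = y.
Proof.
case: x y => [b p q h1 h2 h3] [b' p' q' h1' h2' h3'] /=.
move=> hb hp hq.
have eb := functional_extensionality_dep hb.
have ep := functional_extensionality_dep hp.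
have eq := functional_extensionality_dep hq.
case: _ / eb h2' h3' {hb} => h2' h3'; case: _ / ep h1' h2' {hp} => h1' h2'.
case: _ / eq h1' h3' {hq} => h1' h3'.
by congr HoLimSimp; apply: Prop_irrelevance.
Qed.

Program Definition holim : sset :=
  @SSet holim_simp
    (fun m n f x => @HoLimSimp m (fun i => sact f (hl_pt x i))
       (fun j => sact f (hl_left x j)) (fun j => sact f (hl_right x j)) _ _ _)
    _ _.
Next Obligation.
have := congr1 (sact f) (hl_source x j); by rewrite -!smapN.
Qed.
Next Obligation.
have := congr1 (sact f) (hl_targetl x j); by rewrite -!smapN.
Qed.
Next Obligation.
have := congr1 (sact f) (hl_targetr x j); by rewrite -!smapN.
Qed.
Next Obligation.
apply: holim_simp_ext => i; first exact: sact1.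
  exact: (sact1 (s := path_space _)).
exact: (sact1 (s := path_space _)).
Qed.
Next Obligation.
apply: holim_simp_ext => i; first exact: sactM.
  exact: (sactM (s := path_space _)).
exact: (sactM (s := path_space _)).
Qed.
End HoLim.

(** * Simplicial spaces *)

(* The n-simplices of the nerve of the opposite of Delta, as functors from the
   poset {0 < ... < n}. *)
Record chain (n : nat) := Chain {
  cobj :> 'I_n.+1 -> nat;
  chom : forall i j : 'I_n.+1, i <= j -> dhom (cobj j) (cobj i);
  chom1 : forall (i : 'I_n.+1) (h : i <= i), chom h = did (cobj i);
  chomM : forall (i j k : 'I_n.+1) (hij : i <= j) (hjk : j <= k) (hik : i <= k),
    chom hik = dcomp (chom hij) (chom hjk) }.

Definition chain_act m n (f : dhom m n) (c : chain n) : chain m :=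
  @Chain m (fun i => c (f i)) (fun i j h => chom c (dmono f h))
    (fun i h => chom1 c (dmono f h))
    (fun i j k hij hjk hik =>
       chomM c (dmono f hij) (dmono f hjk) (dmono f hik)).

(* The mapping spaces of the simplicial category C[Delta^n]: the mapping space
   from i to j is the nerve of the poset, ordered by inclusion, of the subsets
   of the interval {i, ..., j} containing i and j.  It is empty if j < i. *)
Record rigid_simp n (i j : 'I_n.+1) (k : nat) := RigidSimp {
  rset :> 'I_k.+1 -> {set 'I_n.+1};
  rset_mono : forall u v : 'I_k.+1, u <= v -> rset u \subset rset v;
  rset_bnd : forall u, [/\ i \in rset u, j \in rset u
                       & forall p, p \in rset u -> i <= p <= j] }.

Lemma rigid_simp_ext n (i j : 'I_n.+1) k (c d : rigid_simp i j k) :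
  (forall u, c u = d u) -> c = d.
Proof.
case: c d => [c h1 h2] [d h1' h2'] /= /funext e.
case: _ / e h1' h2' => h1' h2'.
by congr RigidSimp; apply: Prop_irrelevance.
Qed.

Definition rigid n (i j : 'I_n.+1) : sset :=
  @SSet (rigid_simp i j)
    (fun _ _ f c => @RigidSimp _ i j _ (fun u => c (f u))
       (fun u v h => rset_mono c (dmono f h)) (fun u => rset_bnd c (f u)))
    (fun _ _ => ltac:(by apply: rigid_simp_ext))
    (fun _ _ _ _ _ _ => ltac:(by apply: rigid_simp_ext)).

Program Definition rigid1 n (i : 'I_n.+1) k : rigid i i k :=
  @RigidSimp n i i k (fun=> [set i]) (fun _ _ _ => subxx _) _.
Next Obligation. by split; rewrite ?set11 // => p /set1P ->; rewrite leqnn. Qed.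

Program Definition rigidM n (i j p : 'I_n.+1) k (d : rigid j p k)
    (c : rigid i j k) : rigid i p k :=
  @RigidSimp n i p k
    (fun u => rset c u :|: rset d u)
    (fun u v h => setUSS (rset_mono c h) (rset_mono d h)) _.
Next Obligation.
have [c1 c2 c3] := rset_bnd c u; have [d1 d2 d3] := rset_bnd d u.
split; rewrite ?inE ?c1 ?d2 ?orbT // => q; rewrite inE.
have /andP[ij _] := c3 _ c2; have /andP[_ jp] := d3 _ d1.
case/orP => [/c3|/d3] /andP[h1 h2]; apply/andP; split=> //.
  exact: leq_trans jp.
exact: leq_trans h1.
Qed.

Program Definition rigid_act m n (f : dhom m n) (i j : 'I_m.+1) k
    (c : rigid i j k) : rigid (f i) (f j) k :=
  @RigidSimp n (f i) (f j) k (fun u => f @: rset c u)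
    (fun u v h => imsetS f (rset_mono c h)) _.
Next Obligation.
have [c1 c2 c3] := rset_bnd c u; split; [exact: imset_f|exact: imset_f|].
by move=> p /imsetP[q /c3 /andP[h1 h2] ->]; rewrite !dmono.
Qed.

(* A functor from the opposite of Delta to spaces, that is, a simplicial functor
   from the rigidification of the nerve of the opposite of Delta to Kan
   complexes.  As the rigidification of a simplicial set is the colimit of the
   simplicial categories C[Delta^n] over its simplices, this amounts to a
   simplicial functor on C[Delta^n] for each n-simplex, compatibly with all
   simplicial operators. *)
Record simplicial_space := SimplicialSpace {
  sp :> nat -> sset;
  sp_kan : forall n, is_kan (sp n);
  coh : forall n (c : chain n) (i j : 'I_n.+1),
    smap (sprod (rigid i j) (sp (c i))) (sp (c j));
  coh1 : forall n (c : chain n) (i : 'I_n.+1) k (x : sp (c i) k),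
    coh c i i k (rigid1 i k, x) = x;
  cohM : forall n (c : chain n) (i j p : 'I_n.+1) k
      (d : rigid j p k) (e : rigid i j k) (x : sp (c i) k),
    coh c i p k (rigidM d e, x) = coh c j p k (d, coh c i j k (e, x));
  coh_act : forall m n (f : dhom m n) (c : chain n) (i j : 'I_m.+1) k
      (e : rigid i j k) (x : sp (c (f i)) k),
    coh (chain_act f c) i j k (e, x) =
    coh c (f i) (f j) k (rigid_act f e, x) }.

(** ** Values on morphisms, and homotopies for composites *)

Section Chains.

Definition chain1_obj (a b : nat) (i : nat) : nat :=
  if i is 0 then a else b.

Definition chain1_hom a b (f : dhom b a) (i j : nat) :
    i <= j -> dhom (chain1_obj a b j) (chain1_obj a b i) :=
  match i, j return i <= j -> dhom (chain1_obj a b j) (chain1_obj a b i) with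
  | 0, 0 => fun=> did a
  | 0, _.+1 => fun=> f
  | _.+1, 0 => fun h => False_rect _ (notF h)
  | _.+1, _.+1 => fun=> did b
  end.

Program Definition chain1 a b (f : dhom b a) : chain 1 :=
  @Chain 1 (fun i => chain1_obj a b i) (fun i j h => chain1_hom f h) _ _.
Next Obligation. by case: i h => -[]. Qed.
Next Obligation.
by case: i j k hij hjk hik => -[|i] hi [[|j] hj] [[|k] hk] //= _ _ _;
  rewrite ?dcompf1 ?dcomp1f.
Qed.

Definition chain2_obj (a b c : nat) (i : nat) : nat :=
  match i with 0 => a | 1 => b | _ => c end.

Definition chain2_hom a b c (g : dhom b a) (f : dhom c b) (i j : nat) :
    i <= j -> dhom (chain2_obj a b c j) (chain2_obj a b c i) :=
  match i, j
  return i <= j -> dhom (chain2_obj a b c j) (chain2_obj a b c i) with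
  | 0, 0 => fun=> did a
  | 0, 1 => fun=> g
  | 0, _.+2 => fun=> dcomp g f
  | 1, 0 => fun h => False_rect _ (notF h)
  | 1, 1 => fun=> did b
  | 1, _.+2 => fun=> f
  | _.+2, 0 => fun h => False_rect _ (notF h)
  | _.+2, 1 => fun h => False_rect _ (notF h)
  | _.+2, _.+2 => fun=> did c
  end.

Program Definition chain2 a b c (g : dhom b a) (f : dhom c b) : chain 2 :=
  @Chain 2 (fun i => chain2_obj a b c i) (fun i j h => chain2_hom g f h) _ _.
Next Obligation. by case: i h => -[|[]]. Qed.
Next Obligation.
by case: i j k hij hjk hik => -[|[|i]] hi [[|[|j]] hj] [[|[|k]] hk] //= _ _ _;
  rewrite ?dcompf1 ?dcomp1f.
Qed.

Lemma chain_ext n (c d : chain n) :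
  (forall i, c i = d i) ->
  (forall (i j : 'I_n.+1) (h : i <= j) (x : 'I_(c j).+1) (y : 'I_(d j).+1),
     x = y :> nat -> chom c h x = chom d h y :> nat) -> c = d.
Proof.
case: c d => [o h h1 hM] [o' h' h1' hM'] /= /funext e.
case: _ / e h' h1' hM' => h' h1' hM' eh.
have e : h = h'.
  apply: functional_extensionality_dep => i.
  apply: functional_extensionality_dep => j.
  apply: functional_extensionality_dep => hij.
  by apply: dhom_ext => x; apply/val_inj/eh.
by case: _ / e h1' hM' {eh} => h1' hM'; congr Chain; apply: Prop_irrelevance.
Qed.

Lemma chain1_eta (c : chain 1) : c = chain1 (@chom 1 c ord0 ord_max isT).
Proof.
have ord2 (i : 'I_2) : i = ord0 \/ i = ord_max.
  by case: i => -[|[|//]] h; [left|right]; apply: val_inj.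
apply: chain_ext => [i|i j]; first by case: (ord2 i) => ->.
case: (ord2 i) => ->; case: (ord2 j) => -> h x y //= xy.
- by rewrite chom1.
- rewrite (Prop_irrelevance h isT).
  by congr (nat_of_ord (chom _ _ _)); apply: val_inj.
- by rewrite chom1.
Qed.

Lemma pair_mono n (i j : 'I_n.+1) (h : i <= j) (u v : 'I_2) :
  u <= v -> (if u == ord0 then i else j) <= (if v == ord0 then i else j).
Proof.
case: (v =P ord0) => [->|_ _]; last by case: ifP.
by rewrite leqn0 => u0; rewrite -val_eqE /= u0.
Qed.

Program Definition rigid_min n (i j : 'I_n.+1) (h : i <= j) k : rigid i j k :=
  @RigidSimp n i j k (fun=> [set i; j]) (fun _ _ _ => subxx _) _.
Next Obligation.
by split; rewrite ?set21 ?set22 // => p /set2P[] ->; rewrite ?h ?leqnn.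
Qed.

Definition ord1_3 : 'I_3 := @Ordinal 3 1 isT.

(* The edge from {0, 2} to {0, 1, 2}. *)
Definition edge_set (e : 'I_2) : {set 'I_3} :=
  if e == ord0 then [set ord0; ord_max] else setT.

Lemma edge_set_mono (e e' : 'I_2) : e <= e' -> edge_set e \subset edge_set e'.
Proof.
rewrite /edge_set; case: (e' =P ord0) => [->|_ _]; last exact: subsetT.
by rewrite leqn0 => /eqP e0; have -> : e = ord0 by exact: val_inj.
Qed.

Lemma edge_set_bnd (e : 'I_2) :
  [/\ ord0 \in edge_set e, ord_max \in edge_set e
    & forall p, p \in edge_set e -> (ord0 : 'I_3) <= p <= (ord_max : 'I_3)].
Proof.
split=> [||p _]; last by rewrite /= -ltnS ltn_ord.
  by rewrite /edge_set; case: ifP; rewrite !inE.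
by rewrite /edge_set; case: ifP; rewrite !inE ?eqxx ?orbT.
Qed.

Definition rigid_edge : smap (simplex 1) (rigid (ord0 : 'I_3) ord_max) :=
  @SMap (simplex 1) (rigid (ord0 : 'I_3) ord_max)
    (fun k e => @RigidSimp 2 ord0 ord_max k (fun u => edge_set (dfun e u))
       (fun u v h => edge_set_mono (dmono e h)) (fun u => edge_set_bnd _))
    (fun _ _ _ _ => ltac:(by apply: rigid_simp_ext)).

End Chains.

Section Values.
Variable X : simplicial_space.

Lemma coh_eq n (c : chain n) (i j : 'I_n.+1) k (d e : rigid i j k)
    (x : X (c i) k) :
  (forall u, rset d u = rset e u) ->
  coh X c i j k (d, x) = coh X c i j k (e, x).
Proof. by move=> /rigid_simp_ext ->. Qed.

Program Definition sp_map m n (f : dhom m n) : smap (X n) (X m) :=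
  @SMap (X n) (X m)
    (fun k x => coh X (chain1 f) ord0 ord_max k
       (@rigid_min 1 ord0 ord_max isT k, x)) _.
Next Obligation.
rewrite -smapN.
by refine (@coh_eq 1 (chain1 f) ord0 ord_max _ _ _ (sact f0 x) _).
Qed.

Lemma coh_chain1 (c : chain 1) k (x : X (c ord0) k) :
  coh X c ord0 ord_max k (@rigid_min 1 ord0 ord_max isT k, x) =
  sp_map (@chom 1 c ord0 ord_max isT) k x.
Proof.
rewrite /sp_map /=; set c' := chain1 _.
have e : c = c' := chain1_eta c.
have tr (d : chain 1) (e1 : c = d) (p0 : c ord0 = d ord0)
    (p1 : c ord_max = d ord_max) (r : rigid (ord0 : 'I_2) ord_max k) :
  coh X d ord0 ord_max k (r, eq_rect _ (fun a => X a k) x _ p0) =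
  eq_rect _ (fun a => X a k) (coh X c ord0 ord_max k (r, x)) _ p1.
  by case: _ / e1 p0 p1 => p0 p1; rewrite (eq_irrelevance p0 erefl)
    (eq_irrelevance p1 erefl).
exact/esym/(tr c' e erefl erefl).
Qed.

Lemma coh_min n (c : chain n) (i j : 'I_n.+1) (h : i <= j) k (x : X (c i) k) :
  coh X c i j k (rigid_min h k, x) = sp_map (chom c h) k x.
Proof.
pose f : dhom 1 n := @DHom 1 n (fun u => if u == ord0 then i else j)
  (pair_mono h).
have -> : h = @dmono 1 n f ord0 ord_max isT by exact: Prop_irrelevance.
have /esym := @coh_chain1 (chain_act f c) k x; rewrite coh_act => ->.
by refine (@coh_eq n c i j k _ _ x _) => u; rewrite /= imsetU1 imset_set1.
Qed.

(* For composable f and g, the path from the value at x of X (g o f) to that of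
   X f o X g. *)
Program Definition sp_path m n p (g : dhom n p) (f : dhom m n) k (x : X p k) :
    path_space (X m) k :=
  @SMap (sprod (simplex k) (simplex 1)) (X m)
    (fun q w => coh X (chain2 g f) ord0 ord_max q
       (rigid_edge q w.2, sact (w.1 : dhom q k) x)) _.
Next Obligation. by rewrite -smapN /= sactM. Qed.

Lemma sp_path_act m n p (g : dhom n p) (f : dhom m n) k k' (q : dhom k k')
    (x : X p k') :
  sp_path g f (sact q x) = sact q (sp_path g f x).
Proof. by apply: smap_ext => i [v w] /=; rewrite sactM. Qed.

Lemma sp_path_source m n p (g : dhom n p) (f : dhom m n) k (x : X p k) :
  endpoint (X m) ord0 k (sp_path g f x) = sp_map (dcomp g f) k x.
Proof.
rewrite /= sact1.
apply: etrans (@coh_min 2 (chain2 g f) ord0 ord_max isT k x).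
by refine (@coh_eq 2 (chain2 g f) ord0 ord_max k _ _ x _).
Qed.

Lemma sp_path_target m n p (g : dhom n p) (f : dhom m n) k (x : X p k) :
  endpoint (X m) ord_max k (sp_path g f x) = sp_map f k (sp_map g k x).
Proof.
have e1 := @coh_min 2 (chain2 g f) ord0 ord1_3 isT k x.
have e2 := @coh_min 2 (chain2 g f) ord1_3 ord_max isT k (sp_map g k x).
rewrite /= sact1; apply: etrans e2; rewrite -[sp_map g k x]e1.
apply: etrans (@cohM X 2 (chain2 g f) ord0 ord1_3 ord_max k _ _ x).
refine (@coh_eq 2 (chain2 g f) ord0 ord_max k _ _ x _) => v.
by apply/setP => -[[|[|[|//]]] h]; rewrite !inE.
Qed.
(* The image under X of a cocone in Delta with vertex c over a family of spans
   a (s j) <- e j -> a (t j), seen as a map to the homotopy limit. *)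
Section Cone.
Variables (I J : Type) (s t : J -> I) (c : nat) (a : I -> nat) (e : J -> nat).
Variables (u : forall i, dhom (a i) c).
Variables (l : forall j, dhom (e j) (a (s j))).
Variables (r : forall j, dhom (e j) (a (t j))).
Hypothesis comm : forall j, dcomp (u (s j)) (l j) = dcomp (u (t j)) (r j).

Definition sp_holim : sset :=
  @holim I J s t (fun i => X (a i)) (fun j => X (e j))
    (fun j => sp_map (l j)) (fun j => sp_map (r j)).

Program Definition sp_cone : smap (X c) sp_holim :=
  @SMap (X c) sp_holim
    (fun k x => @HoLimSimp I J s t (fun i => X (a i)) (fun j => X (e j))
       (fun j => sp_map (l j)) (fun j => sp_map (r j)) k
       (fun i => sp_map (u i) k x)
       (fun j => sp_path (u (s j)) (l j) x)
       (fun j => sp_path (u (t j)) (r j) x)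
       _ (fun j => sp_path_target _ _ x) (fun j => sp_path_target _ _ x)) _.
Next Obligation.
apply: etrans (sp_path_source _ _ x) _; rewrite comm.
exact/esym/(sp_path_source _ _ x).
Qed.
Next Obligation.
apply: holim_simp_ext => i.
- exact: (smapN (sp_map (u i))).
- exact: sp_path_act.
- exact: sp_path_act.
Qed.
End Cone.

Section Square.
Variables (m n m' n' : nat) (g : dhom m n) (f : dhom m m').
Variables (f' : dhom n n') (g' : dhom m' n').

Definition square_obj (b : bool) : nat := if b then n else m'.

Definition square_leg (b : bool) : dhom (square_obj b) n' :=
  match b return dhom (square_obj b) n' with true => f' | false => g' end.

Definition sends_to_pullback (comm : dcomp f' g = dcomp g' f) : Prop :=
  is_equivalence
    (@sp_cone bool unit (fun=> true) (fun=> false) n' square_obj (fun=> m)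
       square_leg (fun=> g) (fun=> f) (fun=> comm)).
End Square.

Definition is_decomposition_space : Prop :=
  forall m n m' n' (g : dhom m n) (f : dhom m m') (f' : dhom n n')
    (g' : dhom m' n') (po : is_pushout g f f' g'),
  active g -> inert f -> sends_to_pullback (proj1 po).

(* The map X r -> X 1 x_(X 0) ... x_(X 0) X 1 for r = n + 2; for r = 0, 1 there is
   no condition. *)
Definition segal_map n :=
  @sp_cone 'I_n.+2 'I_n.+1 (widen_ord (leqnSn n.+1)) (lift ord0) n.+2
    (fun=> 1) (fun=> 0) (@spine_edge n.+2)
    (fun=> dconst 0 ord_max) (fun=> dconst 0 ord0) (@spine_edge_comm n).

Definition is_segal_space : Prop := forall n, is_equivalence (segal_map n).
End Values.

(* Main.v *)
From mathcomp Require Import all_boot boolp zify.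
From mathcomp Require classical_sets.
Require Import Defs.

Set Implicit Arguments.
Unset Strict Implicit.
Unset Printing Implicit Defensive.

(** Kan complexes have the homotopy extension property, so the homotopy classes of
    paths between maps K -> X_n form a groupoid for every simplicial set K.  These
    groupoids are the fibres of a category fibred over Delta: an arrow over u from z
    to x is a class of paths from z to the restriction of x along u, and composition
    uses the coherence homotopies of X.  In this category the points of a homotopy
    limit over a zigzag of restrictions are diagrams z_i <- w_j -> z_i', and the map
    from X_c to the homotopy limit is an equivalence if and only if, for all K, each
    diagram has a cocone over c, unique up to isomorphism; then isomorphisms of
    cocones can moreover be chosen compatibly with the cocones.

    For a Segal space the spine condition gives this property for the gluing of [p]
    and [q] along a vertex: first for q = 1, then for all q by induction.  The
    pushout of an active map g : [m] -> [n] along [m] -> [a + m + b] is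
    [a + n + b].  As g preserves endpoints, gluing [a] and [b] to [n] factors
    through gluing them to [m], and the cancellation law for pullback squares gives
    the claim. *)

(** * Monotone maps between finite ordinals *)

(** Passing to homotopy classes discards the higher homotopies, and letting [K] vary makes up for
    this: a map is an equivalence once composition with it is surjective up to homotopy and reflects
    the homotopy relation, for every source [K]. The inverse is then the lift of the identity.

    The price is that [cocones_unique] compares only the vertices of two cocones, whereas pasting
    and cancelling squares require arrows that respect the legs. [sq_is_local] restores this
    compatibility: existence and uniqueness for all [K] together give an actual equivalence, and its
    fullness gives [sq_versal]. This is why every square obtained from others is first turned into
    an equivalence before it is used again.

    After [kan_hep] the arguments use homotopy extension instead of horn filling. It can be solved
    one component at a time on a homotopy limit, so the groupoid of paths is available there as well
    as on the spaces of [X]. *)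

Definition surj m n (f : dhom m n) : Prop := forall j, exists i, f i = j.

Lemma strictly_increasing_ge n (e : 'I_n -> 'I_n) :
  (forall i j : 'I_n, i < j -> e i < e j) -> forall i : 'I_n, i <= e i.
Proof.
move=> he [i hi]; elim: i hi => // i IH hi /=.
have hi' : i < n by exact: ltnW.
exact: leq_ltn_trans (IH hi') (he (Ordinal hi') (Ordinal hi) (leqnn _)).
Qed.

(** The lower bound above, applied also to the conjugate of [e] by order reversal, bounds [e] from
    both sides. *)
Lemma strictly_increasing_id n (e : 'I_n -> 'I_n) :
  (forall i j : 'I_n, i < j -> e i < e j) -> forall i, e i = i.
Proof.
move=> he i; apply/val_inj/eqP; rewrite eqn_leq (strictly_increasing_ge he) andbT.
have rev_lt (j k : 'I_n) : j < k -> rev_ord k < rev_ord j.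
  by move=> jk; rewrite /= ltn_sub2l // (leq_ltn_trans _ (ltn_ord k)).
have hr (j k : 'I_n) : j < k -> rev_ord (e (rev_ord j)) < rev_ord (e (rev_ord k)).
  by move=> jk; apply/rev_lt/he/rev_lt.
have := strictly_increasing_ge hr (rev_ord i); rewrite rev_ordK /=.
by rewrite leq_sub2lE // ltnS.
Qed.

Lemma dmono_lt m n (f : dhom m n) i j : f i < f j -> i < j.
Proof. by rewrite !ltnNge; apply: contraNN => /(dmono f). Qed.

(** Any set-theoretic section of a monotone surjection is monotone, so its value over [f u] can be
    prescribed freely. Sections through every [u] serve to compare two degeneracy operators
    pointwise. *)
Lemma section_through m n (f : dhom m n) u : surj f ->
  exists d : dhom n m, (forall j, f (d j) = j) /\ d (f u) = u.
Proof.
move=> /choice[e he].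
pose d (j : 'I_n.+1) := if j == f u then u else e j.
have fd j : f (d j) = j by rewrite /d; case: eqP.
have hd (i j : 'I_n.+1) : i <= j -> d i <= d j.
  by rewrite leq_eqVlt => /orP[/eqP/val_inj->//|ij]; apply/ltnW/(@dmono_lt _ _ f);
    rewrite !fd.
by exists (DHom hd); split=> //=; rewrite /d eqxx.
Qed.

Lemma surj_id n (f : dhom n n) : surj f -> f = did n.
Proof.
move=> sf; have [d [fd _]] := section_through ord0 sf.
apply: dhom_ext => i /=.
suff e : d i = i by rewrite -{1}e fd.
by apply: strictly_increasing_id => j k jk; apply: (@dmono_lt _ _ f); rewrite !fd.
Qed.

Lemma miss_factor k n (f : dhom k n.+1) i : (forall u, f u <> i) ->
  exists (d : dhom n n.+1) (g : dhom k n), f = dcomp d g.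
Proof.
move=> fi.
have dm (a b : 'I_n.+1) : a <= b -> lift i a <= lift i b.
  by rewrite /= leq_bump2.
have /choice[g hg] u : exists v, f u = lift i v.
  have /unlift_some[v hv _] : i != f u by apply/eqP => /esym/fi.
  by exists v.
have gm (a b : 'I_k.+1) : a <= b -> g a <= g b.
  by move=> /(dmono f); rewrite !hg /= leq_bump2.
by exists (DHom dm), (DHom gm); apply: dhom_ext => u /=.
Qed.

Lemma not_surj k n (f : dhom k n) : ~ surj f -> exists i, forall u, f u <> i.
Proof.
move=> nf; apply: contrapT => h; apply: nf => j; apply: contrapT => hj.
by apply: h; exists j => u fu; apply: hj; exists u.
Qed.

Lemma not_surj_comp k m n (f : dhom m n) (g : dhom k m) :
  ~ surj f -> ~ surj (dcomp f g).
Proof. by move=> nf h; apply: nf => j; have [i <-] := h j; exists (g i). Qed.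

(** * Partial maps of simplicial sets *)

Section PartialMaps.
Variables T E : sset.
Implicit Type G : forall n, T n -> E n -> Prop.

Definition closed G := forall m n (f : dhom m n) (x : T n) (a : E n),
  G n x a -> G m (sact f x) (sact f a).

Definition functional G := forall n (x : T n) (a b : E n),
  G n x a -> G n x b -> a = b.

Lemma total_smap G : closed G -> functional G ->
  (forall n x, exists a, G n x a) ->
  exists F : smap T E, forall n x, G n x (F n x).
Proof.
move=> cG fG tG; pose F n x := sval (cid (tG n x)).
have hF n x : G n x (F n x) by exact: svalP (cid (tG n x)).
have nF m n (f : dhom m n) (x : T n) : F m (sact f x) = sact f (F n x).
  by apply: fG (hF _ _) _; apply: cG.
by exists (SMap nF).
Qed.

Definition add_cell G m (t : T m) (y : E m) n (x : T n) (a : E n) : Prop :=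
  G n x a \/ exists f : dhom n m, x = sact f t /\ a = sact f y.

Lemma add_cell_closed G m (t : T m) (y : E m) :
  closed G -> closed (add_cell G t y).
Proof.
move=> cG p q f x a [/(cG _ _ f)|[g [-> ->]]]; first by left.
by right; exists (dcomp g f); rewrite !sactM.
Qed.

Lemma add_cell_functional G m (t : T m) (y : E m) :
  functional G ->
  (forall n (f : dhom n m) a, G n (sact f t) a -> a = sact f y) ->
  (forall n (f g : dhom n m), sact f t = sact g t ->
     (forall a, ~ G n (sact f t) a) -> sact f y = sact g y) ->
  functional (add_cell G t y).
Proof.
move=> fG h1 h2 n x a b [ga|[f [ex ->]]] [gb|[g [ex' ->]]].
- exact: fG ga gb.
- by apply: h1; rewrite -ex'.
- by apply/esym/h1; rewrite -ex.
- case: (pselect (exists c, G n (sact f t) c)) => [[c gc]|ng].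
    by rewrite -(h1 _ _ _ gc); apply: h1; rewrite -ex' ex.
  by apply: h2; [rewrite -ex|move=> c gc; apply: ng; exists c].
Qed.
End PartialMaps.

(* A simplex [s] of least dimension outside the domain of [G] is nondegenerate
   and has its boundary in the domain. *)
Lemma minimal_simplex (T E : sset) (G : forall n, T n -> E n -> Prop) n (s : T n) :
  closed G ->
  (forall m (x : T m), m < n -> exists a, G m x a) -> (forall a, ~ G n s a) ->
  (forall k (f : dhom k n), ~ surj f -> exists a, G k (sact f s) a) /\
  (forall k (f g : dhom k n), sact f s = sact g s ->
     (forall a, ~ G k (sact f s) a) -> f = g).
Proof.
move=> cG low ns.
have bd k (f : dhom k n) : ~ surj f -> exists a, G k (sact f s) a.
  move=> /not_surj[i fi]; case: n s low ns f i fi => [|n] s low ns f i fi.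
    by case: (fi ord0); rewrite !ord1.
  have [d [g ->]] := miss_factor fi.
  have [a ga] := low n (sact d s) (ltnSn n).
  by exists (sact g a); rewrite sactM; apply: cG.
split=> // k f g fg nf.
have sf : surj f by apply: contrapT => /bd[a]; exact: nf.
(* For a section [d] of [f] through [u], restricting [s] along [g d] gives [s] again. So [g d] is
   surjective, as otherwise [s] would lie in the domain; hence it is the identity, and its value at
   [f u] is [g u]. *)
apply: dhom_ext => u; have [d [fd du]] := section_through u sf.
have fd1 : dcomp f d = did n by exact: dhom_ext.
have gd1 : dcomp g d = did n.
  apply: surj_id; apply: contrapT => /bd[a].
  by rewrite sactM -fg -sactM fd1 sact1; apply: ns.
by have := congr1 (fun h : dhom n n => h (f u)) gd1; rewrite /= du.
Qed.

Section Extension.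
Variables (T E : sset) (C G0 : forall n, T n -> E n -> Prop).
Arguments C : clear implicits.
Arguments G0 : clear implicits.
Hypotheses (cC : closed C) (cG0 : closed G0) (fG0 : functional G0).
Hypothesis G0C : forall n x a, G0 n x a -> C n x a.
Hypothesis fill : forall n (s : T n) (G : forall n, T n -> E n -> Prop),
  closed G -> functional G -> (forall n x a, G n x a -> C n x a) ->
  (forall k (f : dhom k n), ~ surj f -> exists a, G k (sact f s) a) ->
  exists2 y : E n, C n s y &
    forall k (f : dhom k n) a, ~ surj f -> G k (sact f s) a -> a = sact f y.

Let good (G : forall n, T n -> E n -> Prop) :=
  [/\ closed G, functional G & forall n x a, G n x a -> C n x a].

Lemma exists_maximal_partial_map :
  exists2 G, good G /\ (forall n x a, G0 n x a -> G n x a) &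
    forall G', good G' -> (forall n x a, G n x a -> G' n x a) ->
    forall n x a, G' n x a -> G n x a.
Proof.
pose S := {n & (T n * E n)%type}.
(* [G0] is adjoined to every candidate so that the union of the empty chain is good as well. *)
pose rel (A : classical_sets.set S) n x a := G0 n x a \/ A (existT _ n (x, a)).
pose P : classical_sets.set (classical_sets.set S) := fun A => good (rel A).
have [F FP Ftot|A [PA Amax]] := @classical_sets.Zorn_bigcup S P.
  have pair n x a m y b : rel (classical_sets.bigcup F id) n x a ->
      rel (classical_sets.bigcup F id) m y b ->
      (G0 n x a /\ G0 m y b) \/
      exists2 A, good (rel A) & rel A n x a /\ rel A m y b.
    move=> [ga|[A FA Aa]] [gb|[B FB Bb]].
    - by left.
    - by right; exists B; [exact: FP|split; [left|right]].
    - by right; exists A; [exact: FP|split; [right|left]].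
    - case: (Ftot _ _ FA FB) => AB; right.
        by exists B; [exact: FP|split; right => //; apply: AB].
      by exists A; [exact: FP|split; right => //; apply: AB].
  split=> [m n f x a [ga|[A FA Aa]]|n x a b ha hb|n x a ha].
  - by left; apply: cG0.
  - have [cA _ _] := FP _ FA; case: (cA _ _ f x a (or_intror Aa)) => h; first by left.
    by right; exists A.
  - case: (pair _ _ _ _ _ _ ha hb) => [[]|[A [_ fA _] []]]; first exact: fG0.
    exact: fA.
  - by case: (pair _ _ _ _ _ _ ha ha) => [[/G0C]|[A [_ _ AC] [/AC]]].
exists (rel A) => [|G' gG' AG' n x a Ga]; first by split=> // n x a; left.
apply: contrapT => nA; pose B : classical_sets.set S := fun s =>
  G' (projT1 s) (projT2 s).1 (projT2 s).2.
have eB : rel B = G'.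
  apply: functional_extensionality_dep => m.
  apply: funext => y; apply: funext => b; apply: propext; split; last by right.
  by case=> // g; apply: AG'; left.
apply: (Amax B); last by rewrite /P eB.
split=> [[m [y b]] As|BA]; first by apply: AG'; right.
by apply: nA; right; apply: BA.
Qed.

(** A maximal partial map is total: a missing simplex of least dimension has its boundary in the
    domain, so [fill] provides a value for it and [add_cell] a larger partial map. No enumeration of
    the cells is involved. *)
Lemma extend_along_boundaries : exists F : smap T E,
  (forall n x a, G0 n x a -> F n x = a) /\ forall n x, C n x (F n x).
Proof.
have [G [[cG fG GC] G0G] Gmax] := exists_maximal_partial_map.
have tot n : forall x : T n, exists a, G n x a.
  elim/ltn_ind: n => n IH s; apply: contrapT => ns.
  have ns' a : ~ G n s a by move=> ga; apply: ns; exists a.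
  have [bd nd] := minimal_simplex cG (fun m x lt => IH m lt x) ns'.
  have [y Cy yb] := fill cG fG GC bd.
  apply: ns; exists y; apply: (Gmax (add_cell G s y)).
  - split; first exact: add_cell_closed.
      apply: add_cell_functional => // [k f a ga|k f g fg nf].
        have [sf|] := pselect (surj f); last by move=> nf; exact: yb ga.
        have [d [fd _]] := section_through ord0 sf.
        case: (ns' (sact d a)); have := cG _ _ d _ _ ga; rewrite -sactM.
        by have -> : dcomp f d = did n by [exact: dhom_ext]; rewrite sact1.
      by rewrite (nd _ f g).
    by move=> k x a [/GC//|[f [-> ->]]]; apply: cC.
  - by move=> k x a; left.
  - by right; exists (did n); rewrite !sact1.
have [F hF] := total_smap cG fG tot; exists F; split=> n x.
  by move=> a /G0G ga; apply: fG (hF _ _) ga.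
exact: GC.
Qed.
End Extension.

(** * Prisms *)

Section Prism.
Variable n : nat.
Notation prism := (sprod (simplex n) (simplex 1)).

Lemma prism_fst_bound (j : 'I_n.+1) (u : 'I_n.+2) : u - (j < u) < n.+1.
Proof. have := ltn_ord j; have := ltn_ord u; case: (ltnP j u); lia. Qed.

Lemma prism_fst_mono (j : 'I_n.+1) (u v : 'I_n.+2) :
  u <= v -> u - (j < u) <= v - (j < v).
Proof. by case: (ltnP j u); case: (ltnP j v); lia. Qed.

Lemma prism_snd_mono (j : 'I_n.+1) (u v : 'I_n.+2) : u <= v -> (j < u) <= (j < v).
Proof. by case: (ltnP j u); case: (ltnP j v); lia. Qed.

(* The nondegenerate (n+1)-simplex (0,0) < ... < (j,0) < (j,1) < ... < (n,1). *)
Definition prism_cell (j : 'I_n.+1) : prism n.+1 :=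
  (@DHom n.+1 n (fun u => Ordinal (prism_fst_bound j u)) (@prism_fst_mono j),
   @DHom n.+1 1 (fun u => Ordinal (leq_b1 (j < u) : (j < u) < 2))
     (@prism_snd_mono j)).

Lemma prism_sum_bound k (x : prism k) (u : 'I_k.+1) :
  dfun x.1 u + dfun x.2 u < n.+2.
Proof. have := ltn_ord (dfun x.1 u); have := ltn_ord (dfun x.2 u); lia. Qed.

(** The vertex [u] of every [prism_cell] has coordinate sum [u], so this single map recovers the
    operator by which a simplex is a restriction of a cell, whichever cell it lies in. *)
Definition prism_sum k (x : prism k) : dhom k n.+1 :=
  @DHom k n.+1 (fun u => Ordinal (prism_sum_bound x u))
    (fun u v h => leq_add (dmono x.1 h) (dmono x.2 h)).

Definition in_prism_cell (j : 'I_n.+1) k (x : prism k) : Prop :=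
  forall u, if dfun x.2 u == ord0 then dfun x.1 u <= j else j <= dfun x.1 u.

Lemma prism_sum_cell (j : 'I_n.+1) k (x : prism k) :
  in_prism_cell j x -> sact (prism_sum x) (prism_cell j) = x.
Proof.
case: x => x w h; congr pair; apply: dhom_ext => u; apply: val_inj => /=;
  have := h u; have := ltn_ord (dfun w u); rewrite -val_eqE /=;
  case: (val (dfun w u)) => [|[|//]] //= _; move: (val _) => ?; case: ltnP; lia.
Qed.

Lemma prism_cell_sum (j : 'I_n.+1) k (f : dhom k n.+1) :
  prism_sum (sact f (prism_cell j)) = f.
Proof. by apply: dhom_ext => u; apply: val_inj => /=; case: ltnP; lia. Qed.

Lemma in_prism_cell_sact (j : 'I_n.+1) k (f : dhom k n.+1) :
  in_prism_cell j (sact f (prism_cell j)).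
Proof. by move=> u; rewrite -val_eqE /=; case: ltnP => /=; lia. Qed.

Variables (A : sset) (kA : is_kan A).
Implicit Type G : forall k, prism k -> A k -> Prop.

(** The union of [∂Δ^n × Δ^1] and [Δ^n × {0}]. *)
Definition prism_base k (x : prism k) : Prop :=
  ~ surj x.1 \/ forall u, dfun x.2 u = ord0.

(** The cells are attached from [j = n] downwards. In this order the face of cell [j] opposite to
    [(j,1)] is already present, in cell [j + 1] or in the base, and only the face opposite to
    [(j,0)] is free. *)
Definition prism_stage i k (x : prism k) : Prop :=
  prism_base x \/ exists2 j : 'I_n.+1, i <= j & in_prism_cell j x.

(* The horn of the cell [j] that misses the face opposite to the vertex (j,0)
   lies in the previous stage, and the remaining simplices do not. *)
Lemma prism_horn (j : 'I_n.+1) k (f : dhom k n.+1) :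
  prism_stage j.+1 (sact f (prism_cell j)) <->
  in_horn (widen_ord (leqnSn n.+1) j) f.
Proof.
split=> [st|[i ij fi]].
  apply: contrapT => nh.
  (* Outside the horn, [f] hits every vertex except possibly [(j,0)]. The vertex [(j,1)], of index
     [j + 1], excludes the bottom and the later cells; the remaining vertices make the first
     coordinate surjective. *)
  have hit (i : 'I_n.+2) : i != j :> nat -> exists u, f u = i.
    move=> ij; apply: contrapT => hi; apply: nh; exists i => [e|u fu].
      by move: ij; rewrite e /= eqxx.
    by apply: hi; exists u.
  have [|u fu] := hit (@Ordinal n.+2 j.+1 (ltn_ord j)); first by rewrite /= gtn_eqF.
  case: st => [[ns|w0]|[i ji /(_ u)]].
  - apply: ns => v; case: (ltnP v j) => vj.
      have [|x fx] := hit (widen_ord (leqnSn n.+1) v); first by rewrite /= ltn_eqF.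
      by exists x; apply: val_inj; rewrite /= fx /= ltnNge (ltnW vj) subn0.
    have [|x fx] := hit (lift ord0 v); first by rewrite /= /bump /= add1n gtn_eqF.
    by exists x; apply: val_inj; rewrite /= fx /= /bump /= add1n ltnS vj subn1.
  - by have := congr1 val (w0 u); rewrite /= fu /= ltnSn.
  - by rewrite -val_eqE /= fu /= ltnSn subn1 /= leqNgt ji.
have {}ij : i != j :> nat by apply/eqP => e; apply: ij; apply: val_inj.
have {}fi u : f u != i :> nat by apply/eqP => /val_inj; exact: fi.
(* A missed vertex [i < j] removes the first coordinate [i], and [i > j + 1] removes [i - 1].
   Missing [j + 1] puts the simplex into cell [j + 1], or into the bottom when [j = n]. *)
have [lt|gt] := ltnP i j.
  left; left => /(_ (Ordinal (ltn_trans lt (ltn_ord j))))[u /(congr1 val) /=].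
  by move: (fi u); case: (ltnP j (f u)); lia.
case: (ltnP j.+1 i) => ji.
  have hi : i.-1 < n.+1 by have := ltn_ord i; lia.
  left; left => /(_ (Ordinal hi))[u /(congr1 val) /=].
  by move: (fi u); case: (ltnP j (f u)); lia.
have {gt ji} ei : i = j.+1 :> nat by lia.
have [jn|jn] := ltnP j n.
  right; exists (@Ordinal n.+1 j.+1 jn) => //= u; rewrite -val_eqE /=.
  by move: (fi u); case: (ltnP j (f u)) => /=; lia.
left; right => u; apply: val_inj => /=.
by have := ltn_ord (f u); have := ltn_ord j; move: (fi u); case: (ltnP j (f u)); lia.
Qed.

Lemma prism_fill_cell G (j : 'I_n.+1) : closed G -> functional G ->
  (forall k x, (exists a, G k x a) <-> prism_stage j.+1 x) ->
  exists G', [/\ closed G', functional G', forall k x a, G k x a -> G' k x a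
    & forall k x, (exists a, G' k x a) <-> prism_stage j x].
Proof.
move=> cG fG dG; set c := widen_ord (leqnSn n.+1) j.
have hG k (a : horn c k) : exists b, G k (sact (sval a) (prism_cell j)) b.
  exact/dG/prism_horn/(svalP a).
pose h k a := sval (cid (hG k a)).
have hP k (a : horn c k) : G k (sact (sval a) (prism_cell j)) (h k a).
  exact: svalP (cid (hG k a)).
have hN k l (f : dhom k l) (a : horn c l) : h k (sact f a) = sact f (h l a).
  by apply: fG (hP _ _) _; rewrite /= dcompA; exact: cG (hP l a).
have [y hy] := kA (SMap hN).
exists (add_cell G (prism_cell j) (y n.+1 (did n.+1))).
have yE k (f : dhom k n.+1) : sact f (y n.+1 (did n.+1)) = y k f.
  by rewrite -smapN /= dcomp1f.
split; first exact: add_cell_closed.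
- apply: add_cell_functional => // [k f a ga|k f g fg _].
    have hf : in_horn c f by apply/prism_horn/dG; exists a.
    have e := hy _ (exist (@in_horn n.+1 c k) f hf); rewrite /= in e.
    by rewrite yE e; apply: fG ga (hP _ (exist (@in_horn n.+1 c k) f hf)).
  by congr sact; rewrite -(prism_cell_sum j f) fg prism_cell_sum.
- by move=> k x a; left.
- move=> k x; split=> [[a [ga|[f [-> _]]]]|st].
  + have /dG[b|[i ji hi]] : exists a, G k x a by exists a.
      by left.
    by right; exists i => //; exact: ltnW.
  + by right; exists j => //; exact: in_prism_cell_sact.
  + have [[b gb]|ng] := pselect (exists b, G k x b); first by exists b; left.
    case: st => [b|[i]]; first by case: ng; apply/dG; left.
    rewrite leq_eqVlt => /orP[/eqP/val_inj <-|ji] hi.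
      exists (sact (prism_sum x) (y n.+1 (did n.+1))); right.
      by exists (prism_sum x); rewrite prism_sum_cell.
    by case: ng; apply/dG; right; exists i.
Qed.

Lemma prism_extension G : closed G -> functional G ->
  (forall k x, (exists a, G k x a) <-> prism_base x) ->
  exists F : smap prism A, forall k x a, G k x a -> F k x = a.
Proof.
move=> cG fG dG.
have [G' [cG' fG' GG' dG']] : exists G', [/\ closed G', functional G',
    forall k x a, G k x a -> G' k x a
    & forall k x, (exists a, G' k x a) <-> prism_stage 0 x].
  have : forall d, d <= n.+1 -> exists G', [/\ closed G', functional G',
      forall k x a, G k x a -> G' k x a
      & forall k x, (exists a, G' k x a) <-> prism_stage (n.+1 - d) x].
    elim=> [_|d IH dn].
      exists G; split=> // k x; rewrite dG subn0; split; first by left.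
      by case=> // -[j]; rewrite leqNgt ltn_ord.
    have [G1 [cG1 fG1 GG1 dG1]] := IH (ltnW dn).
    have hj : n.+1 - d.+1 < n.+1 by lia.
    have ej : n.+1 - d = (Ordinal hj).+1 by rewrite /=; lia.
    rewrite ej in dG1.
    have [G2 [cG2 fG2 GG2 dG2]] := prism_fill_cell cG1 fG1 dG1.
    by exists G2; split=> // k x a ga; apply/GG2/GG1.
  by move=> /(_ n.+1 (leqnn _)); rewrite subnn.
have [k x|F hF] := total_smap cG' fG'; last first.
  by exists F => k x a /GG' ga; apply: fG' (hF _ _) ga.
(* A simplex lies in the cell indexed by the largest first coordinate that occurs at height 0; if
   none occurs, the empty maximum selects cell 0. *)
apply/dG'; right; pose j := \max_(u | dfun x.2 u == ord0) dfun x.1 u.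
have hj : j < n.+1 by rewrite ltnS; apply/bigmax_leqP => u _; rewrite -ltnS.
exists (Ordinal hj) => // u; case: eqP => [e|/eqP ne] /=.
  by apply: (leq_bigmax_cond (F := fun u => dfun x.1 u)); apply/eqP.
apply/bigmax_leqP => v /eqP e; apply: dmono; apply/ltnW/(@dmono_lt _ _ x.2).
by rewrite e lt0n.
Qed.
End Prism.

(** * Homotopy extension *)

(* The partial homotopy is the restriction of [h] to the simplices in [L]; the
   other values of [h] are irrelevant. *)
Definition hep (A : sset) : Prop :=
  forall (K : sset) (L : forall n, K n -> Prop) (f : smap K A)
    (h : forall n, K n -> dhom n 1 -> A n),
  (forall m n (g : dhom m n) (x : K n), L n x -> L m (sact g x)) ->
  (forall m n (g : dhom m n) (x : K n) w, L n x ->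
     h m (sact g x) (dcomp w g) = sact g (h n x w)) ->
  (forall n (x : K n), L n x -> h n x (dconst n ord0) = f n x) ->
  exists H : smap (sprod K (simplex 1)) A,
    (forall n x, H n (x, dconst n ord0) = f n x) /\
    (forall n x w, L n x -> H n (x, w) = h n x w).

Lemma dconst_comp m n p (i : 'I_p.+1) (g : dhom m n) :
  dcomp (dconst n i) g = dconst m i.
Proof. exact: dhom_ext. Qed.

Lemma path_space_eq A n (p q : path_space A n) :
  (forall m (u : dhom m n) (w : dhom m 1), p m (u, w) = q m (u, w)) -> p = q.
Proof. by move=> h; apply: smap_ext => m [u w]; exact: h. Qed.

Lemma uncurry_natural K A (F : smap K (path_space A)) m n (g : dhom m n)
    (x : K n) w :
  F m (sact g x) m (did m, dcomp w g) = sact g (F n x n (did n, w)).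
Proof.
by rewrite (smapN F) -(smapN (F n x : smap _ _)) /= dcompf1 dcomp1f.
Qed.

Definition uncurry K A (F : smap K (path_space A)) :
    smap (sprod K (simplex 1)) A :=
  @SMap (sprod K (simplex 1)) A (fun n x => F n x.1 n (did n, x.2))
    (fun m n g x => uncurry_natural F g x.1 x.2).

(** The homotopy is sought as a map from [K] to the path space whose sources are prescribed by [f].
    Extending it over one simplex with known boundary is exactly an extension from [prism_base] to
    the prism. *)
Lemma kan_hep (A : sset) : is_kan A -> hep A.
Proof.
move=> kA K L f h cL hN hf.
pose C n (x : K n) (p : path_space A n) := endpoint A ord0 n p = f n x.
pose G0 n (x : K n) (p : path_space A n) := L n x /\
  forall m (u : dhom m n) (w : dhom m 1), p m (u, w) = h m (sact u x) w.
have cC : closed C.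
  by move=> m n g x p Cp; rewrite /C (smapN (endpoint A ord0)) Cp smapN.
have cG0 : closed G0.
  move=> m n g x p [Lx hp]; split; first exact: cL.
  by move=> l u w; rewrite /= hp sactM.
have fG0 : functional G0.
  by move=> n x p q [_ hp] [_ hq]; apply: path_space_eq => m u w; rewrite hp hq.
have G0C n x p : G0 n x p -> C n x p.
  by case=> Lx hp; rewrite /C /= hp sact1; apply: hf.
have [|F [FG FC]] := extend_along_boundaries cC cG0 fG0 G0C.
  move=> n s G cG fG GC bd.
  (* On the sides the paths already chosen by [G] are used, on the bottom the map [f]. They agree
     where they meet because [G] respects [C]. *)
  pose Gp k (x : sprod (simplex n) (simplex 1) k) a :=
    (~ surj x.1 /\ exists p, G k (sact x.1 s) p /\ a = smapf p k (did k, x.2)) \/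
    ((forall u, dfun x.2 u = ord0) /\ a = f k (sact x.1 s)).
  have cGp : closed Gp.
    move=> k l g [u w] a [[nu [p [Gp' ->]]]|[w0 ->]].
      left; split; first exact: not_surj_comp.
      exists (sact g p); split; first by rewrite /= sactM; apply: cG.
      by rewrite -(smapN (p : smap _ _)) /= dcompf1 dcomp1f.
    by right; split=> [v|]; [exact: w0|rewrite /= sactM -smapN].
  have ov k u (w : dhom k 1) p : (forall v, w v = ord0) -> G k (sact u s) p ->
      smapf p k (did k, w) = f k (sact u s).
    move=> w0 /GC <-; congr (smapf p k (_, _)).
    by apply: dhom_ext => v; rewrite w0.
  have fGp : functional Gp.
    move=> k [u w] a b [[_ [p [gp ->]]]|[w0 ->]] [[_ [q [gq ->]]]|[w0' ->]] //=.
    - by rewrite (fG _ _ _ _ gp gq).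
    - exact: ov.
    - by apply/esym; exact: ov.
  have dGp k x : (exists a, Gp k x a) <-> prism_base x.
    split=> [[a [[nx _]|[x0 _]]]|[nx|x0]]; [by left|by right| |].
      have [p gp] := bd _ _ nx.
      by exists (smapf p k (did k, x.2)); left; split=> //; exists p.
    by exists (f k (sact x.1 s)); right.
  have [F hF] := prism_extension kA cGp fGp dGp.
  exists F => [|k g p ng gp].
    by rewrite /C /= (hF _ (did n, dconst n ord0) (f n s)) //; right; rewrite sact1.
  apply: path_space_eq => m u w /=; apply/esym/hF; left; split=> /=.
    exact: not_surj_comp.
  exists (sact u p); rewrite sactM; split; first exact: cG.
  by rewrite /= dcompf1.
exists (uncurry F); split=> [n x|n x w Lx] /=; first exact: FC.
have hpN m l (g : dhom m l) (y : sprod (simplex n) (simplex 1) l) :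
    h m (sact (sact g y).1 x) (sact g y).2 = sact g (h l (sact y.1 x) y.2).
  by rewrite -hN ?sactM //; apply: cL.
rewrite (FG _ _ (@SMap (sprod (simplex n) (simplex 1)) A
   (fun m y => h m (sact y.1 x) y.2) hpN)) /= ?sact1 //.
Qed.

(** * Squares of homotopies *)

Notation path K A := (smap (sprod K (simplex 1)) A).

Definition ins K (e : 'I_2) : smap K (sprod K (simplex 1)) :=
  @SMap K (sprod K (simplex 1)) (fun n x => (x, dconst n e))
    (fun m n g x => congr1 (pair (sact g x)) (esym (dconst_comp e g))).

Definition src K A (p : path K A) : smap K A := scomp p (ins K ord0).
Definition tgt K A (p : path K A) : smap K A := scomp p (ins K ord_max).

Definition cst K A (x : smap K A) : path K A :=
  @SMap (sprod K (simplex 1)) A (fun n y => x n y.1)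
    (fun m n g y => smapN x g y.1).

Definition pull K K' A (phi : smap K' K) (p : path K A) : path K' A :=
  @SMap (sprod K' (simplex 1)) A (fun n y => p n (phi n y.1, y.2))
    (fun m n g y => etrans (congr1 (fun z => p m (z, _)) (smapN phi g y.1))
                       (smapN p g (phi n y.1, y.2))).

(* A square with bottom [p], top [q], left side [r] and right side [s]. *)
Definition Sq K A (p q r s : path K A) : Prop :=
  exists H : path (sprod K (simplex 1)) A,
    [/\ src H = p, tgt H = q, pull (ins K ord0) H = r & pull (ins K ord_max) H = s].

Lemma path_eq K A (p q : path K A) : (forall n x w, p n (x, w) = q n (x, w)) -> p = q.
Proof. by move=> h; apply: smap_ext => n [x w]; exact: h. Qed.

Lemma src_cst K A (x : smap K A) : src (cst x) = x.
Proof. exact: smap_ext. Qed.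

Lemma tgt_cst K A (x : smap K A) : tgt (cst x) = x.
Proof. exact: smap_ext. Qed.

Lemma Sq_corners K A (p q r s : path K A) : Sq p q r s ->
  [/\ src r = src p, src s = tgt p, src q = tgt r & tgt q = tgt s].
Proof. by case=> H [<- <- <- <-]; split; apply: smap_ext. Qed.

Lemma Sq_deg K A (p : path K A) : Sq p p (cst (src p)) (cst (tgt p)).
Proof. by exists (cst p); split; apply: path_eq. Qed.

Lemma Sq_cst K A (x : smap K A) : Sq (cst x) (cst x) (cst x) (cst x).
Proof. by have := Sq_deg (cst x); rewrite src_cst tgt_cst. Qed.

Definition transpose K A (h : path (sprod K (simplex 1)) A) :
    path (sprod K (simplex 1)) A :=
  @SMap (sprod (sprod K (simplex 1)) (simplex 1)) A
    (fun n y => h n ((y.1.1, y.2), y.1.2))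
    (fun m n g y => smapN h g ((y.1.1, y.2), y.1.2)).

Lemma src_transpose K A (h : path (sprod K (simplex 1)) A) :
  src (transpose h) = pull (ins K ord0) h.
Proof. exact: path_eq. Qed.

Lemma tgt_transpose K A (h : path (sprod K (simplex 1)) A) :
  tgt (transpose h) = pull (ins K ord_max) h.
Proof. exact: path_eq. Qed.

Lemma Sq_transpose K A (p q r s : path K A) : Sq p q r s -> Sq r s p q.
Proof. by case=> H [<- <- <- <-]; exists (transpose H); split; apply: path_eq. Qed.

Definition ord_min n (i j : 'I_n) : 'I_n := if i <= j then i else j.

Lemma ord_minE n (i j : 'I_n) : ord_min i j = minn i j :> nat.
Proof. by rewrite /ord_min; case: leqP. Qed.

Lemma dmin_mono n (v w : dhom n 1) (i j : 'I_n.+1) :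
  i <= j -> ord_min (v i) (w i) <= ord_min (v j) (w j).
Proof. by move=> ij; rewrite !ord_minE leq_min !geq_min !dmono ?orbT. Qed.

Definition dmin n (v w : dhom n 1) : dhom n 1 := DHom (@dmin_mono n v w).

(** The connection [(v, w) ↦ p (min v w)]. It gives the left unit law and folds general squares into
    triangles. *)
Lemma Sq_connection K A (p : path K A) : Sq (cst (src p)) p (cst (src p)) p.
Proof.
pose h n (y : sprod (sprod K (simplex 1)) (simplex 1) n) :=
  p n (y.1.1, dmin y.1.2 y.2).
have hN m n (g : dhom m n) y : h m (sact g y) = sact g (h n y).
  by rewrite /h -smapN; congr (p m (_, _)); apply: dhom_ext.
exists (SMap hN); split; apply: path_eq => n x w; rewrite /= /h /=;
  congr (p n (_, _)); apply: dhom_ext => u; apply: ord_inj; rewrite ord_minE /=.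
- by rewrite minn0.
- by apply/minn_idPl; rewrite -ltnS ltn_ord.
- by rewrite min0n.
- by apply/minn_idPr; rewrite -ltnS ltn_ord.
Qed.

Lemma dconst_max n (w : dhom n 1) : w ord0 = ord_max -> w = dconst n ord_max.
Proof.
move=> e; apply: dhom_ext => u; apply: val_inj; apply/eqP => /=.
by rewrite eqn_leq -ltnS ltn_ord; have := @dmono _ _ w ord0 u (leq0n _); rewrite e.
Qed.

Lemma dconst_min n (w : dhom n 1) : w ord_max = ord0 -> w = dconst n ord0.
Proof.
move=> e; apply: dhom_ext => u; apply: val_inj; apply/eqP => /=.
by rewrite -leqn0; have := @dmono _ _ w u ord_max; rewrite e; apply; rewrite -ltnS.
Qed.

Definition end_const n (w : dhom n 1) : Prop :=
  w = dconst n ord0 \/ w = dconst n ord_max.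

Lemma end_const_comp m n (g : dhom m n) w : end_const w -> end_const (dcomp w g).
Proof. by case=> ->; rewrite dconst_comp; [left|right]. Qed.

(** Homotopy extension for [K × ∂Δ^1] in [K × Δ^1]. *)
Lemma square_fill K A (p r s : path K A) : hep A ->
  src r = src p -> src s = tgt p -> exists q, Sq p q r s.
Proof.
move=> hA rp sp.
pose L n (y : sprod K (simplex 1) n) := end_const y.2.
pose h n (y : sprod K (simplex 1) n) w :=
  if dfun y.2 ord0 == ord0 then r n (y.1, w) else s n (y.1, w).
have eqs (x y : smap K A) n z : x = y -> x n z = y n z by move->.
have [|||H [H0 HL]] := hA _ L p h.
- by move=> m n g y; exact: end_const_comp.
- by move=> m n g [x v] w; rewrite /L /= => -[->|->]; rewrite /h /= -smapN.
- by move=> n [x v]; rewrite /L /= => -[->|->]; [exact: eqs rp|exact: eqs sp].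
exists (tgt H), H; split=> //; apply: path_eq => n x w //=.
- by rewrite HL //=; left.
- by rewrite HL //=; right.
Qed.

(** Five faces of a cube have a sixth: by homotopy extension for [K × ∂(Δ^1 × Δ^1)], the square [H]
    is moved along the four squares around it, and its final position is the missing face. All laws
    of the groupoid below come from this and [square_fill]. *)
Lemma cube K A (p q r s p' q' r' s' a b c d : path K A) : hep A ->
  Sq p q r s -> Sq p p' a b -> Sq q q' c d -> Sq r r' a c -> Sq s s' b d ->
  Sq p' q' r' s'.
Proof.
move=> hA [H [Hp Hq Hr Hs]] [P [P0 P1 Pa Pb]] [Q [Q0 Q1 Qc Qd]]
  [R [R0 R1 Ra Rc]] [S [S0 S1 Sb Sd]].
pose B := sprod (sprod K (simplex 1)) (simplex 1).
pose L n (y : B n) := end_const y.1.2 \/ end_const y.2.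
(* A map to [[1]] is constantly 0 if its last value is 0, and constantly 1 if its first value is 1.
   On the four edges over the corners two branches apply, and they agree there. *)
pose h n (y : B n) z :=
  if dfun y.2 ord_max == ord0 then P n (y.1, z) else
  if dfun y.2 ord0 == ord_max then Q n (y.1, z) else
  if dfun y.1.2 ord0 == ord0 then R n ((y.1.1, y.2), z)
  else S n ((y.1.1, y.2), z).
have eqp C D (x y : smap C D) n z : x = y -> x n z = y n z by move->.
have end_cases n (v : dhom n 1) : [\/ v = dconst n ord0, v = dconst n ord_max
    | (dfun v ord_max == ord0) = false /\ (dfun v ord0 == ord_max) = false].
  case: (dfun v ord_max =P ord0) => [/dconst_min|_]; first by constructor 1.
  case: (dfun v ord0 =P ord_max) => [/dconst_max|_]; first by constructor 2.
  by constructor 3.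
have hR n x (v : dhom n 1) z : h n ((x, dconst n ord0), v) z = R n ((x, v), z).
  rewrite /h /=; case: (end_cases _ v) => [->|->|[-> ->]] //=.
    exact: (eqp (sprod K (simplex 1)) _ _ _ n (x, z) (etrans Pa (esym Ra))).
  exact: (eqp (sprod K (simplex 1)) _ _ _ n (x, z) (etrans Qc (esym Rc))).
have hS n x (v : dhom n 1) z : h n ((x, dconst n ord_max), v) z = S n ((x, v), z).
  rewrite /h /=; case: (end_cases _ v) => [->|->|[-> ->]] //=.
    exact: (eqp (sprod K (simplex 1)) _ _ _ n (x, z) (etrans Pb (esym Sb))).
  exact: (eqp (sprod K (simplex 1)) _ _ _ n (x, z) (etrans Qd (esym Sd))).
have [|||F [F0 FL]] := hA _ L H h.
- by move=> m n g y [] l; [left|right]; exact: end_const_comp.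
- move=> m n g [[x w] v] z; rewrite /L /= => -[] [->|->].
  + by rewrite dconst_comp !hR -smapN.
  + by rewrite dconst_comp !hS -smapN.
  + by rewrite /h /= -smapN.
  + by rewrite /h /= -smapN.
- move=> n [[x w] v]; rewrite /L /= => -[] [->|->]; rewrite ?hR ?hS.
  + exact: (eqp (sprod K (simplex 1)) _ _ _ n (x, v) (etrans R0 (esym Hr))).
  + exact: (eqp (sprod K (simplex 1)) _ _ _ n (x, v) (etrans S0 (esym Hs))).
  + exact: (eqp (sprod K (simplex 1)) _ _ _ n (x, w) (etrans P0 (esym Hp))).
  + exact: (eqp (sprod K (simplex 1)) _ _ _ n (x, w) (etrans Q0 (esym Hq))).
exists (tgt F); split; apply: path_eq => n x w /=.
- by rewrite FL; [rewrite -P1|right; left].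
- by rewrite FL; [rewrite -Q1|right; right].
- by rewrite FL; [rewrite hR -R1|left; left].
- by rewrite FL; [rewrite hS -S1|left; right].
Qed.

(** * The groupoid of homotopies between maps into a fibrant object *)

Definition heq K A (p q : path K A) : Prop :=
  Sq p q (cst (src p)) (cst (tgt p)).

Lemma heq_ends K A (p q : path K A) : heq p q -> src q = src p /\ tgt q = tgt p.
Proof. by move=> /Sq_corners[_ _ -> ->]; rewrite !tgt_cst. Qed.

Lemma heq_refl K A (p : path K A) : heq p p.
Proof. exact: Sq_deg. Qed.

(** A class is the predicate of its members, so equality of classes is plain equality and the
    groupoid laws are equations that can be rewritten with. *)
Definition hclass K A (x y : smap K A) : Type :=
  {P : path K A -> Prop | exists p, [/\ src p = x, tgt p = y & P = heq p]}.

Definition hcls K A (x y : smap K A) (p : path K A) (hx : src p = x)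
    (hy : tgt p = y) : hclass x y :=
  exist _ (heq p) (ex_intro _ p (And3 hx hy erefl)).

Lemma mem_hcls K A (x y : smap K A) (p : path K A) (hx : src p = x)
    (hy : tgt p = y) : sval (hcls hx hy) p.
Proof. exact: heq_refl. Qed.

Lemma hclass_inhabited K A (x y : smap K A) (a : hclass x y) : exists p, sval a p.
Proof. by case: a => P [p [hx hy e]]; exists p; rewrite /= e; apply: heq_refl. Qed.

Lemma hclass_ends K A (x y : smap K A) (a : hclass x y) p :
  sval a p -> src p = x /\ tgt p = y.
Proof. by case: a => P [q [hx hy e]]; rewrite /= e => /heq_ends[-> ->]. Qed.

Section Groupoid.
Variables (K A : sset) (hA : hep A).
Implicit Types (p q r s : path K A) (x y z : smap K A).

Lemma Sq_congr p q r s p' q' r' s' : Sq p q r s ->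
  heq p p' -> heq q q' -> heq r r' -> heq s s' -> Sq p' q' r' s'.
Proof.
move=> h hp hq hr hs; have [e1 e2 e3 e4] := Sq_corners h.
apply: (cube hA h hp hq); first by rewrite -e1 e3; exact: hr.
by rewrite -e2 e4; exact: hs.
Qed.

Lemma heq_sym p q : heq p q -> heq q p.
Proof.
move=> h; have [e1 e2] := heq_ends h; rewrite /heq e1 e2.
by apply: (Sq_congr (Sq_deg p) h); rewrite ?/heq ?src_cst ?tgt_cst;
  [exact: Sq_deg|exact: Sq_cst|exact: Sq_cst].
Qed.

Lemma heq_trans p q r : heq p q -> heq q r -> heq p r.
Proof.
move=> h h'.
by apply: (Sq_congr h _ h'); rewrite ?/heq ?src_cst ?tgt_cst;
  [exact: Sq_deg|exact: Sq_cst|exact: Sq_cst].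
Qed.

Lemma hclass_heq x y (a : hclass x y) p q : sval a p -> sval a q -> heq p q.
Proof.
by case: a => P [r [hx hy e]]; rewrite /= e => h h'; exact: heq_trans (heq_sym h) h'.
Qed.

Lemma hclass_heq_mem x y (a : hclass x y) p q : sval a p -> heq p q -> sval a q.
Proof. by case: a => P [r [hx hy e]]; rewrite /= e => h h'; exact: heq_trans h h'. Qed.

Lemma hclass_eq x y (a b : hclass x y) p : sval a p -> sval b p -> a = b.
Proof.
move=> ap bp; have eq_mem q : sval a q = sval b q.
  apply: propext; split=> h.
    exact: hclass_heq_mem bp (hclass_heq ap h).
  exact: hclass_heq_mem ap (hclass_heq bp h).
case: a b ap bp eq_mem => P hP [R hR] /= _ _ /funext e.
exact: eq_exist.
Qed.

Lemma Sq_top_unique p q q' r s : Sq p q r s -> Sq p q' r s -> heq q q'.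
Proof.
move=> h h'; have [e1 e2 e3 e4] := Sq_corners h.
rewrite /heq e3 e4; apply: (cube hA (Sq_deg p) h h').
  by rewrite -e1; apply/Sq_transpose/Sq_deg.
by rewrite -e2; apply/Sq_transpose/Sq_deg.
Qed.

Lemma hcomp_exists x y z (a : hclass x y) (b : hclass y z) :
  exists c : hclass x z, forall p s e,
    sval a p -> sval b s -> sval c e -> Sq p e (cst x) s.
Proof.
have [p ap] := hclass_inhabited a; have [s bs] := hclass_inhabited b.
have [px py] := hclass_ends ap; have [sy sz] := hclass_ends bs.
have [||e he] := @square_fill K A p (cst x) s hA; rewrite ?src_cst ?px ?py //.
have [_ _ e1 e2] := Sq_corners he; rewrite tgt_cst in e1.
exists (hcls e1 (etrans e2 sz)) => p' s' e' ap' bs' /= he'.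
apply: (Sq_congr he (hclass_heq ap ap') he' _ (hclass_heq bs bs')).
exact: heq_refl.
Qed.

Definition hcomp x y z (a : hclass x y) (b : hclass y z) : hclass x z :=
  sval (cid (hcomp_exists a b)).

Lemma hcompP x y z (a : hclass x y) (b : hclass y z) p s e :
  sval a p -> sval b s -> (sval (hcomp a b) e <-> Sq p e (cst x) s).
Proof.
move=> ap bs; split; first exact: (svalP (cid (hcomp_exists a b))).
have [e' he'] := hclass_inhabited (hcomp a b).
have /Sq_top_unique h := svalP (cid (hcomp_exists a b)) _ _ _ ap bs he'.
by move=> /h; exact: hclass_heq_mem.
Qed.

Definition hid x : hclass x x := hcls (src_cst x) (tgt_cst x).

Lemma hcompA x y z t (a : hclass x y) (b : hclass y z) (c : hclass z t) :
  hcomp a (hcomp b c) = hcomp (hcomp a b) c.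
Proof.
have [p ap] := hclass_inhabited a; have [q bq] := hclass_inhabited b.
have [r cr] := hclass_inhabited c.
have [u hu] := hclass_inhabited (hcomp a b).
have [v hv] := hclass_inhabited (hcomp b c).
have [w hw] := hclass_inhabited (hcomp (hcomp a b) c).
apply: (@hclass_eq _ _ _ _ w) => //; apply/(hcompP _ ap hv).
move/(hcompP _ ap bq): hu (hu) => hu1 hu; move/(hcompP _ bq cr): hv => hv.
move/(hcompP _ hu cr): hw => hw; have [px py] := hclass_ends ap.
apply: (cube hA hu1 (Sq_deg p) hw); first by rewrite px; exact: Sq_cst.
by rewrite py.
Qed.

Lemma hcomp1r x y (a : hclass x y) : hcomp a (hid y) = a.
Proof.
have [p ap] := hclass_inhabited a; apply: (@hclass_eq _ _ _ _ p) => //.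
apply/(hcompP _ ap (mem_hcls (src_cst y) (tgt_cst y))).
by have [<- <-] := hclass_ends ap; exact: Sq_deg.
Qed.

Lemma hcomp1l x y (a : hclass x y) : hcomp (hid x) a = a.
Proof.
have [p ap] := hclass_inhabited a; apply: (@hclass_eq _ _ _ _ p) => //.
apply/(hcompP _ (mem_hcls (src_cst x) (tgt_cst x)) ap).
by have [<- _] := hclass_ends ap; exact: Sq_connection.
Qed.

Lemma hinv_exists x y (a : hclass x y) : exists b : hclass y x, hcomp a b = hid x.
Proof.
have [p ap] := hclass_inhabited a; have [px py] := hclass_ends ap.
have [||q hq] := @square_fill K A (cst x) p (cst x) hA; rewrite ?src_cst ?tgt_cst //.
have [_ _ e1 e2] := Sq_corners hq; rewrite tgt_cst in e2.
exists (hcls (etrans e1 py) e2); apply: (@hclass_eq _ _ _ _ (cst x)).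
  by apply/(hcompP _ ap (mem_hcls _ _))/Sq_transpose.
exact: mem_hcls.
Qed.

Definition hinv x y (a : hclass x y) : hclass y x := sval (cid (hinv_exists a)).

Lemma hcompV x y (a : hclass x y) : hcomp a (hinv a) = hid x.
Proof. exact: svalP (cid (hinv_exists a)). Qed.

Lemma hVcomp x y (a : hclass x y) : hcomp (hinv a) a = hid y.
Proof.
have e : hcomp (hinv a) (hcomp a (hinv a)) = hinv a by rewrite hcompV hcomp1r.
have := hcompV (hinv a); rewrite -{1}e -!hcompA => e1.
have e2 : hinv (hinv a) = a.
  by rewrite -[LHS]hcomp1l -(hcompV a) -hcompA hcompV hcomp1r.
by have := hcompV (hinv a); rewrite e2.
Qed.

Lemma hcomp_injl x y z (a : hclass x y) (b c : hclass y z) :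
  hcomp a b = hcomp a c -> b = c.
Proof.
move=> /(congr1 (hcomp (hinv a))); by rewrite !hcompA hVcomp !hcomp1l.
Qed.

Lemma hcomp_injr x y z (a b : hclass x y) (c : hclass y z) :
  hcomp a c = hcomp b c -> a = b.
Proof.
move=> /(congr1 (fun d => hcomp d (hinv c))); by rewrite -!hcompA hcompV !hcomp1r.
Qed.

Lemma hinv_unique x y (a : hclass x y) b : hcomp a b = hid x -> b = hinv a.
Proof. by move=> e; apply: (@hcomp_injl _ _ _ a); rewrite e hcompV. Qed.

Lemma hinvK x y (a : hclass x y) : hinv (hinv a) = a.
Proof. by apply/esym/hinv_unique; rewrite hVcomp. Qed.

Lemma hinv_hcomp x y z (a : hclass x y) (b : hclass y z) :
  hinv (hcomp a b) = hcomp (hinv b) (hinv a).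
Proof.
by apply/esym/hinv_unique; rewrite -hcompA (hcompA b) hcompV hcomp1l hcompV.
Qed.

Lemma hinv_square x y z w (a : hclass x y) (b : hclass y w) (c : hclass x z)
    (d : hclass z w) :
  hcomp a b = hcomp c d -> hcomp (hinv a) c = hcomp b (hinv d).
Proof.
move=> e; apply: (@hcomp_injl _ _ _ a); apply: (@hcomp_injr _ _ _ _ _ d).
by rewrite hcompA hcompV hcomp1l -e -!hcompA hVcomp hcomp1r.
Qed.

(** This turns fillings of squares into equations between composites, the form in which coherence is
    used from here on. The connections of [p] and [r] fold a square into the triangle computing a
    composite; conversely, an open box filled by [square_fill] must have its top in the class
    [d]. *)
Lemma Sq_hcomp x y z w (a : hclass x y) (b : hclass y w) (c : hclass x z)
    (d : hclass z w) p q r s :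
  sval a p -> sval b s -> sval c r -> sval d q ->
  (Sq p q r s <-> hcomp a b = hcomp c d).
Proof.
move=> ap bs cr dq.
have [e he] := hclass_inhabited (hcomp a b); have := he.
move/(hcompP _ ap bs) => he1.
have key q' : Sq p q' r s -> Sq r e (cst x) q'.
  have [px _] := hclass_ends ap; have [rx _] := hclass_ends cr.
  move=> h; have := Sq_connection p; have := Sq_connection r; rewrite px rx => hr hp.
  exact: (cube hA hp hr he1 (Sq_cst x) h).
split=> [h|eq].
  by apply: (hclass_eq he); apply/(hcompP _ cr dq)/key.
have he2 : Sq r e (cst x) q by apply/(hcompP _ cr dq); rewrite -eq.
have [px py] := hclass_ends ap; have [rx ry] := hclass_ends cr.
have [sy sw] := hclass_ends bs.
have [||q' hq'] := @square_fill K A p r s hA; rewrite ?rx ?px ?sy ?py //.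
have [_ _ e1 e2] := Sq_corners hq'; rewrite ry in e1; rewrite sw in e2.
have mq : sval (hcls e1 e2) q' by exact: mem_hcls.
suff ed : d = hcls e1 e2.
  apply: (Sq_congr hq'); try exact: heq_refl.
  by apply: hclass_heq mq _; rewrite -ed.
apply: (@hcomp_injl _ _ _ c); apply: (@hclass_eq _ _ _ _ e).
  by apply/(hcompP _ cr dq).
exact/(hcompP _ cr mq)/key.
Qed.
End Groupoid.

(** * Functoriality *)

Lemma src_scomp K A B (phi : smap A B) (p : path K A) :
  src (scomp phi p) = scomp phi (src p).
Proof. exact: smap_ext. Qed.

Lemma tgt_scomp K A B (phi : smap A B) (p : path K A) :
  tgt (scomp phi p) = scomp phi (tgt p).
Proof. exact: smap_ext. Qed.

Lemma scomp_cst K A B (phi : smap A B) (x : smap K A) :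
  scomp phi (cst x) = cst (scomp phi x).
Proof. exact: smap_ext. Qed.

Lemma Sq_scomp K A B (phi : smap A B) (p q r s : path K A) :
  Sq p q r s -> Sq (scomp phi p) (scomp phi q) (scomp phi r) (scomp phi s).
Proof. by case=> H [<- <- <- <-]; exists (scomp phi H); split; apply: smap_ext. Qed.

Lemma heq_scomp K A B (phi : smap A B) (p q : path K A) :
  heq p q -> heq (scomp phi p) (scomp phi q).
Proof. by move=> /(Sq_scomp phi); rewrite !scomp_cst -src_scomp -tgt_scomp. Qed.

Lemma hmap_exists K A B (phi : smap A B) (x y : smap K A) (a : hclass x y) :
  exists b : hclass (scomp phi x) (scomp phi y),
    forall p, sval a p -> sval b (scomp phi p).
Proof.
case: a => P [q [hx hy e]].
have ex : src (scomp phi q) = scomp phi x by rewrite src_scomp hx.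
have ey : tgt (scomp phi q) = scomp phi y by rewrite tgt_scomp hy.
by exists (hcls ex ey) => p; rewrite /= e; exact: heq_scomp.
Qed.

Definition hmap K A B (phi : smap A B) (x y : smap K A) (a : hclass x y) :
    hclass (scomp phi x) (scomp phi y) := sval (cid (hmap_exists phi a)).

Lemma mem_hmap K A B (phi : smap A B) (x y : smap K A) (a : hclass x y) p :
  sval a p -> sval (hmap phi a) (scomp phi p).
Proof. exact: svalP (cid (hmap_exists phi a)) p. Qed.

Lemma hmap_hcomp K A B (hA : hep A) (hB : hep B) (phi : smap A B)
    (x y z : smap K A) (a : hclass x y) (b : hclass y z) :
  hmap phi (hcomp hA a b) = hcomp hB (hmap phi a) (hmap phi b).
Proof.
have [p ap] := hclass_inhabited a; have [q bq] := hclass_inhabited b.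
have [r hr] := hclass_inhabited (hcomp hA a b).
apply: (hclass_eq hB (mem_hmap phi hr)).
apply/(hcompP _ _ (mem_hmap phi ap) (mem_hmap phi bq)).
by rewrite -scomp_cst; apply/Sq_scomp/(hcompP _ _ ap bq).
Qed.

Lemma hmap_hid K A B (hB : hep B) (phi : smap A B) (x : smap K A) :
  hmap phi (hid x) = hid (scomp phi x).
Proof.
apply: (@hclass_eq _ _ hB _ _ _ _ (scomp phi (cst x))).
  exact/mem_hmap/mem_hcls.
by rewrite scomp_cst; exact: mem_hcls.
Qed.

Lemma hmap_hinv K A B (hA : hep A) (hB : hep B) (phi : smap A B)
    (x y : smap K A) (a : hclass x y) :
  hmap phi (hinv hA a) = hinv hB (hmap phi a).
Proof.
by apply: hinv_unique; rewrite -(hmap_hcomp hA) hcompV (hmap_hid hB).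
Qed.

Lemma src_pull K K' A (phi : smap K' K) (p : path K A) :
  src (pull phi p) = scomp (src p) phi.
Proof. exact: smap_ext. Qed.

Lemma tgt_pull K K' A (phi : smap K' K) (p : path K A) :
  tgt (pull phi p) = scomp (tgt p) phi.
Proof. exact: smap_ext. Qed.

Lemma Sq_natural K A B (h : path A B) (p : path K A) :
  Sq (scomp (src h) p) (scomp (tgt h) p) (pull (src p) h) (pull (tgt p) h).
Proof. by exists (pull p h); split; apply: smap_ext. Qed.

(** * Maps into homotopy limits of zigzags *)

Lemma curry_natural K A (p : path K A) n (x : K n) m k (g : dhom m k)
    (y : sprod (simplex n) (simplex 1) k) :
  p m (sact (sact g y).1 x, (sact g y).2) = sact g (p k (sact y.1 x, y.2)).
Proof. by rewrite -smapN /= sactM. Qed.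

Definition curry_at K A (p : path K A) n (x : K n) : path_space A n :=
  @SMap (sprod (simplex n) (simplex 1)) A
    (fun k y => p k (sact y.1 x, y.2)) (@curry_natural K A p n x).

Lemma curry_at_sact K A (p : path K A) m n (g : dhom m n) (x : K n) :
  curry_at p (sact g x) = sact g (curry_at p x).
Proof. by apply: path_space_eq => k u w /=; rewrite sactM. Qed.

Lemma endpoint_curry_at K A (p : path K A) n (x : K n) e :
  endpoint A e n (curry_at p x) = p n (x, dconst n e).
Proof. by rewrite /= sact1. Qed.

Section HoLim.
Variables (I J : Type) (s t : J -> I) (B : I -> sset) (D : J -> sset).
Variables (l : forall j, smap (B (s j)) (D j)).
Variables (r : forall j, smap (B (t j)) (D j)).
Notation H := (holim l r).

Definition holim_pt i : smap H (B i) :=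
  @SMap H (B i) (fun n x => hl_pt x i) (fun _ _ _ _ => erefl).

Definition holim_left j : path H (D j) :=
  uncurry (@SMap H (path_space (D j)) (fun n x => hl_left x j)
             (fun _ _ _ _ => erefl)).

Definition holim_right j : path H (D j) :=
  uncurry (@SMap H (path_space (D j)) (fun n x => hl_right x j)
             (fun _ _ _ _ => erefl)).

Lemma holim_source j : src (holim_left j) = src (holim_right j).
Proof. by apply: smap_ext => n x; exact: hl_source x j. Qed.

Lemma holim_targetl j : tgt (holim_left j) = scomp (l j) (holim_pt (s j)).
Proof. by apply: smap_ext => n x; exact: hl_targetl x j. Qed.

Lemma holim_targetr j : tgt (holim_right j) = scomp (r j) (holim_pt (t j)).
Proof. by apply: smap_ext => n x; exact: hl_targetr x j. Qed.

Lemma holim_eq n (x y : H n) :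
  (forall i, holim_pt i n x = holim_pt i n y) ->
  (forall j m (g : dhom m n) w,
     holim_left j m (sact g x, w) = holim_left j m (sact g y, w)) ->
  (forall j m (g : dhom m n) w,
     holim_right j m (sact g x, w) = holim_right j m (sact g y, w)) -> x = y.
Proof.
move=> hp hl hr; apply: holim_simp_ext => [//|j|j].
  apply: path_space_eq => m u w; have := hl j m u w.
  by rewrite /= dcompf1.
apply: path_space_eq => m u w; have := hr j m u w.
by rewrite /= dcompf1.
Qed.

Lemma smap_holim_eq K (F G : smap K H) :
  (forall i, scomp (holim_pt i) F = scomp (holim_pt i) G) ->
  (forall j, pull F (holim_left j) = pull G (holim_left j)) ->
  (forall j, pull F (holim_right j) = pull G (holim_right j)) -> F = G.
Proof.
move=> hp hl hr; apply: smap_ext => n x; apply: holim_eq => [i|j m g w|j m g w].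
- exact: (congr1 (fun f : smap K (B i) => f n x) (hp i)).
- rewrite -(smapN F) -(smapN G).
  exact: (congr1 (fun f : path K (D j) => f m (sact g x, w)) (hl j)).
- rewrite -(smapN F) -(smapN G).
  exact: (congr1 (fun f : path K (D j) => f m (sact g x, w)) (hr j)).
Qed.

Section Universal.
Variables (K : sset) (b : forall i, smap K (B i)) (p q : forall j, path K (D j)).
Hypotheses (pq : forall j, src (p j) = src (q j)).
Hypotheses (pl : forall j, tgt (p j) = scomp (l j) (b (s j))).
Hypotheses (qr : forall j, tgt (q j) = scomp (r j) (b (t j))).

Let at_eq A (f g : smap K A) n (x : K n) : f = g -> f n x = g n x.
Proof. by move->. Qed.

Definition to_holim_at n (x : K n) : H n :=
  @HoLimSimp I J s t B D l r n (fun i => b i n x)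
    (fun j => curry_at (p j) x) (fun j => curry_at (q j) x)
    (fun j => etrans (endpoint_curry_at _ x _)
       (etrans (at_eq x (pq j)) (esym (endpoint_curry_at _ x _))))
    (fun j => etrans (endpoint_curry_at _ x _) (at_eq x (pl j)))
    (fun j => etrans (endpoint_curry_at _ x _) (at_eq x (qr j))).

Lemma to_holim_at_sact m n (g : dhom m n) (x : K n) :
  to_holim_at (sact g x) = sact g (to_holim_at x).
Proof.
by apply: holim_simp_ext => i /=; [exact: smapN|exact: curry_at_sact|
  exact: curry_at_sact].
Qed.

Definition to_holim : smap K H := SMap to_holim_at_sact.

Lemma to_holim_pt i : scomp (holim_pt i) to_holim = b i.
Proof. exact: smap_ext. Qed.

Lemma to_holim_left j : pull to_holim (holim_left j) = p j.
Proof. by apply: path_eq => n x w /=; rewrite sact1. Qed.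

Lemma to_holim_right j : pull to_holim (holim_right j) = q j.
Proof. by apply: path_eq => n x w /=; rewrite sact1. Qed.
End Universal.

(** The shared side [c j] is the homotopy of the [D j]-component, which is the common source of the
    two paths. Each square runs along the path first and the homotopy second; transposing it gives a
    family of paths parametrised by the homotopy. *)
Lemma holim_path K (x y : smap K H) (p : forall i, path K (B i))
    (c : forall j, path K (D j)) :
  (forall i, src (p i) = scomp (holim_pt i) x) ->
  (forall i, tgt (p i) = scomp (holim_pt i) y) ->
  (forall j, Sq (pull x (holim_left j)) (pull y (holim_left j)) (c j)
               (scomp (l j) (p (s j)))) ->
  (forall j, Sq (pull x (holim_right j)) (pull y (holim_right j)) (c j)
               (scomp (r j) (p (t j)))) ->
  exists h : path K H,
    [/\ src h = x, tgt h = y & forall i, scomp (holim_pt i) h = p i].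
Proof.
move=> px py hl hr.
pose L j := sval (cid (hl j)); pose R j := sval (cid (hr j)).
have hL j : [/\ src (L j) = pull x (holim_left j), tgt (L j) = pull y (holim_left j),
    pull (ins K ord0) (L j) = c j & pull (ins K ord_max) (L j) = scomp (l j) (p (s j))].
  exact: svalP (cid (hl j)).
have hR j : [/\ src (R j) = pull x (holim_right j), tgt (R j) = pull y (holim_right j),
    pull (ins K ord0) (R j) = c j & pull (ins K ord_max) (R j) = scomp (r j) (p (t j))].
  exact: svalP (cid (hr j)).
have e1 j : src (transpose (L j)) = src (transpose (R j)).
  by rewrite !src_transpose; case: (hL j) => _ _ -> _; case: (hR j) => _ _ -> _.
have e2 j : tgt (transpose (L j)) = scomp (l j) (p (s j)).
  by rewrite tgt_transpose; case: (hL j).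
have e3 j : tgt (transpose (R j)) = scomp (r j) (p (t j)).
  by rewrite tgt_transpose; case: (hR j).
have trans_src A (h : path (sprod K (simplex 1)) A) e :
    pull (ins K e) (transpose h) = scomp h (ins _ e) by exact: path_eq.
have pull_comp (f : path K H) e A (h : path H A) :
  pull (scomp f (ins K e)) h = pull (ins K e) (pull f h) by exact: path_eq.
exists (to_holim e1 e2 e3); split.
- apply: smap_holim_eq => [i|j|j].
  + by rewrite -src_scomp to_holim_pt px.
  + by rewrite pull_comp to_holim_left trans_src; case: (hL j).
  + by rewrite pull_comp to_holim_right trans_src; case: (hR j).
- apply: smap_holim_eq => [i|j|j].
  + by rewrite -tgt_scomp to_holim_pt py.
  + by rewrite pull_comp to_holim_left trans_src; case: (hL j).
  + by rewrite pull_comp to_holim_right trans_src; case: (hR j).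
- exact: to_holim_pt.
Qed.

Lemma holim_path_squares K (h : path K H) j : exists c,
  Sq (pull (src h) (holim_left j)) (pull (tgt h) (holim_left j)) c
     (scomp (l j) (scomp (holim_pt (s j)) h)) /\
  Sq (pull (src h) (holim_right j)) (pull (tgt h) (holim_right j)) c
     (scomp (r j) (scomp (holim_pt (t j)) h)).
Proof.
exists (src (pull h (holim_left j))); split.
  exists (transpose (pull h (holim_left j))); split; try exact: path_eq.
  transitivity (tgt (pull h (holim_left j))); first exact: path_eq.
  by rewrite tgt_pull holim_targetl; apply: smap_ext.
exists (transpose (pull h (holim_right j))); split; try exact: path_eq.
  transitivity (src (pull h (holim_right j))); first exact: path_eq.
  by rewrite !src_pull holim_source.
transitivity (tgt (pull h (holim_right j))); first exact: path_eq.
by rewrite tgt_pull holim_targetr; apply: smap_ext.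
Qed.
End HoLim.

(* [d1] prescribes the targets of the paths and, if [b] holds, [d0] prescribes
   their sources. *)
Lemma hep_path (K D : sset) (L : forall n, K n -> Prop) (f : path K D)
    (h : forall n, sprod K (simplex 1) n -> dhom n 1 -> D n)
    (b : bool) (d0 d1 : path K D) : hep D ->
  (forall m n (g : dhom m n) (x : K n), L n x -> L m (sact g x)) ->
  (forall m n (g : dhom m n) (x : K n) v w, L n x ->
     h m (sact g x, dcomp v g) (dcomp w g) = sact g (h n (x, v) w)) ->
  (forall n (x : K n) v, L n x -> h n (x, v) (dconst n ord0) = f n (x, v)) ->
  (forall n (x : K n) w, L n x -> h n (x, dconst n ord_max) w = d1 n (x, w)) ->
  src d1 = tgt f ->
  (b -> forall n (x : K n) w, L n x -> h n (x, dconst n ord0) w = d0 n (x, w)) ->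
  (b -> src d0 = src f) ->
  exists H : path (sprod K (simplex 1)) D,
  [/\ src H = f, (forall n (x : K n) v w, L n x -> H n ((x, v), w) = h n (x, v) w),
      pull (ins K ord_max) H = d1 & b -> pull (ins K ord0) H = d0].
Proof.
move=> hD cL hN hf hd1 e1 hd0 e0.
pose L' n (y : sprod K (simplex 1) n) := [\/ L n y.1, y.2 = dconst n ord_max
  | b /\ y.2 = dconst n ord0].
pose h' n (y : sprod K (simplex 1) n) w :=
  if dfun y.2 ord0 == ord_max then d1 n (y.1, w)
  else if b && (dfun y.2 ord_max == ord0) then d0 n (y.1, w) else h n y w.
have at_eq (x y : smap K D) n z : x = y -> x n z = y n z by move->.
have hL n x v w : L n x -> h' n (x, v) w = h n (x, v) w.
  rewrite /h' /= => Lx; case: eqP => [/dconst_max->|_]; first by rewrite hd1.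
  by case: andP => // -[hb /eqP/dconst_min->]; rewrite hd0.
have hmax n x w : h' n (x, dconst n ord_max) w = d1 n (x, w) by rewrite /h'.
have hmin n x w : b -> h' n (x, dconst n ord0) w = d0 n (x, w).
  by move=> hb; rewrite /h' /= hb.
have [|||H [Hf HL]] := hD _ L' f h'.
- move=> m n g [x v]; rewrite /L' /= => -[Lx|->|[hb ->]].
  + by constructor 1; exact: cL.
  + by constructor 2; exact: dconst_comp.
  + by constructor 3; split=> //; exact: dconst_comp.
- move=> m n g [x v] w; rewrite /L' /= => -[Lx|->|[hb ->]].
  + by rewrite !hL ?hN //; exact: cL.
  + by rewrite dconst_comp !hmax -smapN.
  + by rewrite dconst_comp !hmin // -smapN.
- move=> n [x v]; rewrite /L' /= => -[Lx|->|[hb ->]].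
  + by rewrite hL // hf.
  + by rewrite hmax; exact: at_eq e1.
  + by rewrite hmin //; exact: at_eq (e0 hb).
exists H; split.
- by apply: path_eq => n x w; exact: Hf.
- by move=> n x v w Lx; rewrite HL ?hL //; constructor 1.
- by apply: path_eq => n x w /=; rewrite HL ?hmax //; constructor 2.
- by move=> hb; apply: path_eq => n x w /=; rewrite HL ?hmin //; constructor 3.
Qed.

(** * Homotopy extension for homotopy limits *)

Section HoLim.
Variables (I J : Type) (s t : J -> I) (B : I -> sset) (D : J -> sset).
Variables (l : forall j, smap (B (s j)) (D j)).
Variables (r : forall j, smap (B (t j)) (D j)).
Notation H := (holim l r).

(** The problem is solved in three layers: the points, then the left paths with prescribed targets
    and free sources, then the right paths with both ends prescribed, since their sources must
    follow those of the left paths. The flag of [hep_path] separates the last two. *)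
Lemma hep_holim : (forall i, hep (B i)) -> (forall j, hep (D j)) -> hep H.
Proof.
move=> hB hD K L f h cL hN hf.
have at_eq K' A (x y : smap K' A) n z : x = y -> x n z = y n z by move->.
have /(_ _)/cid-/all_sig[b hb] i : exists b : path K (B i),
    src b = scomp (holim_pt l r i) f /\
    forall n x w, L n x -> b n (x, w) = holim_pt l r i n (h n x w).
  have [||b [b0 bL]] := hB i _ L (scomp (holim_pt l r i) f)
    (fun n x w => holim_pt l r i n (h n x w)) cL.
  - by move=> m n g x w Lx; rewrite hN // smapN.
  - by move=> n x Lx; rewrite hf.
  by exists b; split=> //; apply: smap_ext.
have /(_ _)/cid-/all_sig[p hp] j : exists p : path (sprod K (simplex 1)) (D j),
    [/\ src p = pull f (holim_left l r j),
        forall n (x : K n) v w, L n x ->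
          p n ((x, v), w) = holim_left l r j n (h n x w, v)
      & pull (ins K ord_max) p = scomp (l j) (b (s j))].
  have [b0 bL] := hb (s j).
  have [||||//|//|p [p0 pL p1 _]] := @hep_path K (D j) L (pull f (holim_left l r j))
     (fun n y w => holim_left l r j n (h n y.1 w, y.2)) false
     (pull f (holim_left l r j))
     (scomp (l j) (b (s j))) (hD j) cL.
  - by move=> m n g x v w Lx /=; rewrite hN // -smapN.
  - by move=> n x v Lx /=; rewrite hf.
  - move=> n x w Lx /=; rewrite bL //.
    exact: (at_eq _ _ _ _ n (h n x w) (holim_targetl l r j)).
  - by rewrite src_scomp b0 tgt_pull holim_targetl; apply: smap_ext.
  by exists p.
have /(_ _)/cid-/all_sig[q hq] j : exists q : path (sprod K (simplex 1)) (D j),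
    [/\ src q = pull f (holim_right l r j),
        forall n (x : K n) v w, L n x ->
          q n ((x, v), w) = holim_right l r j n (h n x w, v),
        pull (ins K ord_max) q = scomp (r j) (b (t j))
      & pull (ins K ord0) q = pull (ins K ord0) (p j)].
  have [b0 bL] := hb (t j); have [p0 pL _] := hp j.
  have [||||||q [q0 qL q1 q2]] := @hep_path K (D j) L (pull f (holim_right l r j))
     (fun n y w => holim_right l r j n (h n y.1 w, y.2))
     true (pull (ins K ord0) (p j))
     (scomp (r j) (b (t j))) (hD j) cL.
  - by move=> m n g x v w Lx /=; rewrite hN // -smapN.
  - by move=> n x v Lx /=; rewrite hf.
  - move=> n x w Lx /=; rewrite bL //.
    exact: (at_eq _ _ _ _ n (h n x w) (holim_targetr l r j)).
  - by rewrite src_scomp b0 tgt_pull holim_targetr; apply: smap_ext.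
  - move=> _ n x w Lx /=.
    rewrite pL //; exact/esym/(at_eq _ _ _ _ n (h n x w) (holim_source l r j)).
  - by rewrite src_pull p0 src_pull -holim_source => _; apply: smap_ext.
  by exists q; split=> //; exact: q2.
have e1 j : src (transpose (p j)) = src (transpose (q j)).
  by rewrite !src_transpose; case: (hq j).
have e2 j : tgt (transpose (p j)) = scomp (l j) (b (s j)).
  by rewrite tgt_transpose; case: (hp j).
have e3 j : tgt (transpose (q j)) = scomp (r j) (b (t j)).
  by rewrite tgt_transpose; case: (hq j).
exists (to_holim e1 e2 e3); split.
  suff e : src (to_holim e1 e2 e3) = f by move=> n x; rewrite -e.
  apply: smap_holim_eq => [i|j|j].
  - by rewrite -src_scomp to_holim_pt; case: (hb i).
  - transitivity (src (p j)); last by case: (hp j).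
    rewrite [RHS](_ : _ = pull (ins K ord0) (transpose (p j))); last exact: path_eq.
    by rewrite -(to_holim_left e1 e2 e3); exact: path_eq.
  - transitivity (src (q j)); last by case: (hq j).
    rewrite [RHS](_ : _ = pull (ins K ord0) (transpose (q j))); last exact: path_eq.
    by rewrite -(to_holim_right e1 e2 e3); exact: path_eq.
move=> n x w Lx; apply: holim_eq => [i|j m g v|j m g v].
- by case: (hb i) => _ <-.
- rewrite -(smapN (to_holim e1 e2 e3)) -hN //.
  have [_ pE _] := hp j; rewrite -pE; last exact: cL.
  by have := at_eq (sprod (sprod K (simplex 1)) (simplex 1)) _ _ _ m
    ((sact g x, dcomp w g), v) (to_holim_left e1 e2 e3 j).
- rewrite -(smapN (to_holim e1 e2 e3)) -hN //.
  have [_ qE _ _] := hq j; rewrite -qE; last exact: cL.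
  by have := at_eq (sprod (sprod K (simplex 1)) (simplex 1)) _ _ _ m
    ((sact g x, dcomp w g), v) (to_holim_right e1 e2 e3 j).
Qed.
End HoLim.

(** * Homotopy equivalences *)

Lemma homotopic_path A B (f g : smap A B) :
  homotopic f g <-> exists h : path A B, src h = f /\ tgt h = g.
Proof.
split=> [[h hP]|[h [<- <-]]]; last by exists h.
by exists h; split; apply: smap_ext => n x; case: (hP n x).
Qed.

Lemma scompA A B C D (h : smap C D) (g : smap B C) (f : smap A B) :
  scomp h (scomp g f) = scomp (scomp h g) f.
Proof. exact: smap_ext. Qed.

Lemma scomp1l A B (f : smap A B) : scomp (sid B) f = f.
Proof. exact: smap_ext. Qed.

Lemma scomp1r A B (f : smap A B) : scomp f (sid A) = f.
Proof. exact: smap_ext. Qed.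

Section Equivalence.
Variables (A B : sset) (hA : hep A) (hB : hep B) (f : smap A B).

(** Lifting the identity of [B] gives [g]. The homotopy from [f g] to the identity, restricted along
    [f], connects the images of [g f] and the identity of [A], so the second condition connects
    these maps themselves. The path [q] need not lie over [p], which is why homotopy classes carry
    enough information. *)
Lemma is_equivalence_criterion :
  (forall K (y : smap K B), exists (x : smap K A) (p : path K B),
     src p = scomp f x /\ tgt p = y) ->
  (forall K (x x' : smap K A) (p : path K B), src p = scomp f x ->
     tgt p = scomp f x' -> exists q : path K A, src q = x /\ tgt q = x') ->
  is_equivalence f.
Proof.
move=> hs hi; have [g [p [p0 p1]]] := hs _ (sid B).
exists g; split; apply/homotopic_path; last by exists p.
by apply: (hi _ _ _ (pull f p)); rewrite ?src_pull ?tgt_pull ?p0 ?p1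
  ?scomp1l ?scomp1r ?scompA.
Qed.

Hypothesis fE : is_equivalence f.

Lemma equivalence_surjective K (y : smap K B) :
  exists (x : smap K A) (p : path K B), src p = scomp f x /\ tgt p = y.
Proof.
have [g [_ /homotopic_path[e [e0 e1]]]] := fE.
exists (scomp g y), (pull y e).
by rewrite src_pull tgt_pull e0 e1 scomp1l scompA.
Qed.

(** Naturality of [e] conjugates the image of a class under [v u] to the class itself, which can
    therefore be recovered from its image under [u]. *)
Lemma hmap_retract_injective C D (hC : hep C) (hD : hep D) (u : smap C D)
    (v : smap D C) (e : path C C) K (x y : smap K C) (a b : hclass x y) :
  src e = scomp v u -> tgt e = sid C ->
  hmap u a = hmap u b -> a = b.
Proof.
move=> e0 e1 eab.
have ex (z : smap K C) : src (pull z e) = scomp v (scomp u z).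
  by rewrite src_pull e0 scompA.
have ey (z : smap K C) : tgt (pull z e) = z by rewrite tgt_pull e1 scomp1l.
have nat (c : hclass x y) : hcomp hC (hmap v (hmap u c)) (hcls (ex y) (ey y)) =
    hcomp hC (hcls (ex x) (ey x)) c.
  have [p cp] := hclass_inhabited c; have [px py] := hclass_ends cp.
  apply/(Sq_hcomp hC (mem_hmap v (mem_hmap u cp)) (mem_hcls _ _) (mem_hcls _ _) cp).
  by have := Sq_natural e p; rewrite e0 e1 -scompA scomp1l px py.
by apply: (@hcomp_injl _ _ hC _ _ _ (hcls (ex x) (ey x))); rewrite -!nat eab.
Qed.

(** The class [a] is the conjugate of [hmap g b], chosen so that [g f] sends it to [hmap g b]; and
    [g] is faithful on classes because of the other homotopy [d]. *)
Lemma equivalence_full K (x x' : smap K A) (b : hclass (scomp f x) (scomp f x')) :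
  exists a : hclass x x', hmap f a = b.
Proof.
have [g [/homotopic_path[e [e0 e1]] /homotopic_path[d [d0 d1]]]] := fE.
have ex (z : smap K A) : src (pull z e) = scomp g (scomp f z).
  by rewrite src_pull e0 scompA.
have ey (z : smap K A) : tgt (pull z e) = z by rewrite tgt_pull e1 scomp1l.
pose E z := hcls (ex z) (ey z).
pose a := hcomp hA (hinv hA (E x)) (hcomp hA (hmap g b) (E x')).
exists a; apply: (hmap_retract_injective hB hA d0 d1).
apply: (@hcomp_injr _ _ hA _ _ _ _ _ (E x')).
rewrite -[RHS](hcomp1l hA) -(hcompV hA (E x)) -hcompA -/a.
have [p ap] := hclass_inhabited a; have [px py] := hclass_ends ap.
apply/(Sq_hcomp hA (mem_hmap g (mem_hmap f ap)) (mem_hcls _ _) (mem_hcls _ _) ap).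
by have := Sq_natural e p; rewrite e0 e1 -scompA scomp1l px py.
Qed.
End Equivalence.

(** * Coherence of a simplicial space *)

Definition chain3_obj (a b c d : nat) (i : nat) : nat :=
  match i with 0 => a | 1 => b | 2 => c | _ => d end.

Definition chain3_hom a b c d (f : dhom b a) (g : dhom c b) (h : dhom d c)
    (i j : nat) :
    i <= j -> dhom (chain3_obj a b c d j) (chain3_obj a b c d i) :=
  match i, j
  return i <= j -> dhom (chain3_obj a b c d j) (chain3_obj a b c d i) with
  | 0, 0 => fun=> did a
  | 0, 1 => fun=> f
  | 0, 2 => fun=> dcomp f g
  | 0, _.+3 => fun=> dcomp (dcomp f g) h
  | 1, 0 => fun h => False_rect _ (notF h)
  | 1, 1 => fun=> did b
  | 1, 2 => fun=> g
  | 1, _.+3 => fun=> dcomp g h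
  | 2, 0 => fun h => False_rect _ (notF h)
  | 2, 1 => fun h => False_rect _ (notF h)
  | 2, 2 => fun=> did c
  | 2, _.+3 => fun=> h
  | _.+3, 0 => fun h => False_rect _ (notF h)
  | _.+3, 1 => fun h => False_rect _ (notF h)
  | _.+3, 2 => fun h => False_rect _ (notF h)
  | _.+3, _.+3 => fun=> did d
  end.

Program Definition chain3 a b c d (f : dhom b a) (g : dhom c b) (h : dhom d c) :
    chain 3 :=
  @Chain 3 (fun i => chain3_obj a b c d i) (fun i j le => chain3_hom f g h le) _ _.
Next Obligation. by case: i h0 => -[|[|[|]]]. Qed.
Next Obligation.
by case: i j k hij hjk hik => -[|[|[|i]]] hi [[|[|[|j]]] hj] [[|[|[|k]]] hk] //= _ _ _;
  rewrite ?dcompf1 ?dcomp1f ?dcompA.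
Qed.

Definition face3 (i j k : 'I_4) (u : 'I_3) : 'I_4 :=
  if u == ord0 then i else if u == ord_max then k else j.

Lemma face3_mono (i j k : 'I_4) (ij : i <= j) (jk : j <= k) (u v : 'I_3) :
  u <= v -> face3 i j k u <= face3 i j k v.
Proof.
rewrite /face3; case: u v => -[|[|[|//]]] ? [[|[|[|//]]] ?] //= _.
exact: leq_trans jk.
Qed.

Definition dface3 (i j k : 'I_4) (ij : i <= j) (jk : j <= k) : dhom 2 3 :=
  DHom (face3_mono ij jk).

Lemma edge_setE (e : 'I_2) : edge_set e =
  if e == ord0 then [set ord0; ord_max] else [set ord0; ord1_3; ord_max].
Proof.
rewrite /edge_set; case: ifP => // _; apply/setP => i; rewrite !inE.
by case: i => -[|[|[|//]]].
Qed.

Ltac chain_face :=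
  apply: chain_ext => [[[|[|[|//]]] ?] //|];
  move=> [[|[|[|//]]] ?] [[|[|[|//]]] ?] //= _ u v uv;
  by have -> : u = v by exact: val_inj.

Ltac rigid_face w u :=
  rewrite /= edge_setE; case: (dfun w u) => -[|[|//]] ?; rewrite -val_eqE /=;
  rewrite ?imsetU1 ?imsetU ?imset_set1;
  apply/setP => -[[|[|[|[|//]]]] ?]; by rewrite !inE -?val_eqE.

Section Coherence.
Variable X : simplicial_space.

(** Equal chains need not have convertible objects, hence the casts. For the concrete chains below
    [p] and [q] are [erefl] and the casts compute away. *)
Lemma coh_chain_eq n (c d : chain n) (e : c = d) (i j : 'I_n.+1) k
    (r : rigid i j k) (x : X (c i) k) (p : c i = d i) (q : c j = d j) :
  coh X d i j k (r, eq_rect _ (fun a => X a k) x _ p) =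
  eq_rect _ (fun a => X a k) (coh X c i j k (r, x)) _ q.
Proof.
by case: _ / e p q => p q; rewrite (eq_irrelevance p erefl)
  (eq_irrelevance q erefl).
Qed.

Definition sp_homotopy m n p (g : dhom n p) (f : dhom m n) : path (X p) (X m) :=
  uncurry (@SMap (X p) (path_space (X m)) (fun k x => sp_path g f x)
             (fun k k' q x => sp_path_act g f q x)).

Lemma sp_homotopyE m n p (g : dhom n p) (f : dhom m n) k x w :
  sp_homotopy g f k (x, w) =
  coh X (chain2 g f) ord0 ord_max k (rigid_edge k w, x).
Proof. by rewrite /= sact1. Qed.

Lemma src_sp_homotopy m n p (g : dhom n p) (f : dhom m n) :
  src (sp_homotopy g f) = sp_map X (dcomp g f).
Proof. by apply: smap_ext => k x; exact: (sp_path_source g f x). Qed.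

Lemma tgt_sp_homotopy m n p (g : dhom n p) (f : dhom m n) :
  tgt (sp_homotopy g f) = scomp (sp_map X f) (sp_map X g).
Proof. by apply: smap_ext => k x; exact: (sp_path_target g f x). Qed.

Definition chain0 a : chain 0 :=
  @Chain 0 (fun=> a) (fun _ _ _ => did a) (fun _ _ => erefl)
    (fun _ _ _ _ _ _ => esym (dcompf1 (did a))).

(** The chain of an identity map is degenerate, so compatibility with operators and [coh1] make this
    a strict equality. The same reason makes the homotopy of [sp_homotopy1] constant. *)
Lemma sp_map1 n : sp_map X (did n) = sid (X n).
Proof.
apply: smap_ext => k x.
have e : chain_act (dconst 1 (ord0 : 'I_1)) (chain0 n) = chain1 (did n).
  apply: chain_ext => [[[|[|//]] ?] //|].
  by move=> [[|[|//]] ?] [[|[|//]] ?] //= _ u v.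
have /= -> := coh_chain_eq e (@rigid_min 1 ord0 ord_max isT k) x erefl erefl.
rewrite (@coh_act X 1 0 (dconst 1 ord0) (chain0 n) ord0 ord_max k).
rewrite -[RHS](@coh1 X 0 (chain0 n) ord0 k x).
refine (@coh_eq X 0 (chain0 n) ord0 ord0 k _ _ x _) => u /=.
by rewrite imsetU1 imset_set1 setUid.
Qed.

Lemma sp_homotopy1 m n (f : dhom m n) : sp_homotopy f (did m) = cst (sp_map X f).
Proof.
apply: path_eq => k x w; rewrite sp_homotopyE.
have hm (u v : 'I_3) : u <= v ->
    (if u == ord0 then ord0 else ord_max : 'I_2) <=
    (if v == ord0 then ord0 else ord_max : 'I_2).
  by case: u v => -[|[|[|//]]] ? [[|[|[|//]]] ?].
pose s : dhom 2 1 := DHom hm.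
have e : chain_act s (chain1 f) = chain2 f (did m).
  apply: chain_ext => [[[|[|[|//]]] ?] //|].
  move=> [[|[|[|//]]] ?] [[|[|[|//]]] ?] //= _ u v uv //=.
  - by congr (nat_of_ord (f _)); apply: val_inj.
  - by congr (nat_of_ord (f _)); apply: val_inj.
have /= -> := coh_chain_eq e (rigid_edge k w) x erefl erefl.
rewrite (@coh_act X 2 1 s (chain1 f) ord0 ord_max k).
refine (@coh_eq X 1 (chain1 f) ord0 ord_max k _ _ x _) => u /=.
rewrite /edge_set; case: ifP => _; first by rewrite imsetU1 imset_set1.
apply/setP => -[[|[|//]] h]; rewrite !inE /= -?val_eqE /=; apply/imsetP.
  by exists ord0; rewrite ?inE //; apply: val_inj.
by exists ord_max; rewrite ?inE //; apply: val_inj.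
Qed.

(* A square in the mapping space of C[Delta^3] from 0 to 3: the first coordinate
   adds the vertex 2, the second one the vertex 1. *)
Definition cube_set (a b : 'I_2) : {set 'I_4} :=
  [set i : 'I_4 | [|| val i == 0, val i == 3, (val i == 2) && (a == ord_max)
                    | (val i == 1) && (b == ord_max)]].

Lemma ord2_max_mono (a a' : 'I_2) : a <= a' -> (a == ord_max) ==> (a' == ord_max).
Proof. by case: a a' => -[|[|//]] ? [[|[|//]] ?]. Qed.

Lemma cube_set_mono (a b a' b' : 'I_2) :
  a <= a' -> b <= b' -> cube_set a b \subset cube_set a' b'.
Proof.
move=> /ord2_max_mono/implyP ha /ord2_max_mono/implyP hb.
apply/subsetP => i; rewrite !inE => /or4P[->//|->|/andP[-> /ha ->]|/andP[-> /hb ->]];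
  by rewrite ?orbT.
Qed.

Lemma cube_set_bnd (a b : 'I_2) :
  [/\ ord0 \in cube_set a b, ord_max \in cube_set a b
    & forall p, p \in cube_set a b -> (ord0 : 'I_4) <= p <= (ord_max : 'I_4)].
Proof.
split=> [||p _]; rewrite ?inE ?eqxx //=; last by rewrite -ltnS ltn_ord.
Qed.

Definition rigid_square k (v w : dhom k 1) : rigid (ord0 : 'I_4) ord_max k :=
  @RigidSimp 3 ord0 ord_max k (fun u => cube_set (v u) (w u))
    (fun x y h => cube_set_mono (dmono v h) (dmono w h))
    (fun u => cube_set_bnd (v u) (w u)).

Lemma coh_face (c : chain 3) (f : dhom 2 3) a b d (g : dhom b a) (h : dhom d b)
    (e : chain_act f c = chain2 g h) (p : c (f ord0) = a) (q : c (f ord_max) = d)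
    k (r : rigid (ord0 : 'I_3) ord_max k) (x : X (c (f ord0)) k) :
  coh X (chain2 g h) ord0 ord_max k (r, eq_rect _ (fun a => X a k) x _ p) =
  eq_rect _ (fun a => X a k) (coh X c (f ord0) (f ord_max) k (rigid_act f r, x)) _ q.
Proof.
have /= := coh_chain_eq e r x p q => ->.
by rewrite (@coh_act X 2 3 f c ord0 ord_max k).
Qed.

(** The square [rigid_square] acts on the 3-chain. Two of its sides are the faces 023 and 013; on
    the other two all sets contain vertex 1, respectively 2, so [cohM] splits them into edge 01
    followed by face 123, and face 012 followed by edge 23. *)
Lemma sp_homotopy_square a b c d (f : dhom b a) (g : dhom c b) (h : dhom d c) :
  Sq (sp_homotopy (dcomp f g) h) (pull (sp_map X f) (sp_homotopy g h))
     (sp_homotopy f (dcomp g h)) (scomp (sp_map X h) (sp_homotopy f g)).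
Proof.
pose C := chain3 f g h.
pose o1 : 'I_4 := @Ordinal 4 1 isT; pose o2 : 'I_4 := @Ordinal 4 2 isT.
pose F k (y : sprod (sprod (X a) (simplex 1)) (simplex 1) k) : X d k :=
  coh X C ord0 ord_max k (rigid_square y.1.2 y.2, y.1.1).
have FN m n (q : dhom m n) y : F m (sact q y) = sact q (F n y).
  rewrite /F -smapN.
  by refine (@coh_eq X 3 C ord0 ord_max m _ _ (sact q y.1.1) _).
exists (SMap FN); split; apply: path_eq => k x w.
- rewrite sp_homotopyE /= /F /=.
  have e : chain_act (@dface3 ord0 o2 ord_max isT isT) C = chain2 (dcomp f g) h.
    chain_face.
  have /= -> := coh_face e erefl erefl (rigid_edge k w) x.
  refine (@coh_eq X 3 C ord0 ord_max k _ _ x _) => u /=.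
  rigid_face w u.
- have e : chain_act (@dface3 o1 o2 ord_max isT isT) C = chain2 g h.
    chain_face.
  transitivity (sp_homotopy g h k (sp_map X f k x, w)); last by [].
  rewrite sp_homotopyE -[sp_map X f k x](@coh_min X 3 C ord0 o1 isT k x).
  have /= -> := coh_face e erefl erefl (rigid_edge k w)
    (coh X C ord0 o1 k (@rigid_min 3 ord0 o1 isT k, x)).
  rewrite -(@cohM X 3 C ord0 o1 ord_max k).
  refine (@coh_eq X 3 C ord0 ord_max k _ _ x _) => u /=.
  rigid_face w u.
- rewrite sp_homotopyE /= /F /=.
  have e : chain_act (@dface3 ord0 o1 ord_max isT isT) C = chain2 f (dcomp g h).
    chain_face.
  have /= -> := coh_face e erefl erefl (rigid_edge k w) x.
  refine (@coh_eq X 3 C ord0 ord_max k _ _ x _) => u /=.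
  rigid_face w u.
- have e : chain_act (@dface3 ord0 o1 o2 isT isT) C = chain2 f g.
    chain_face.
  transitivity (sp_map X h k (sp_homotopy f g k (x, w))); last by [].
  rewrite -[sp_map X h k _](@coh_min X 3 C o2 ord_max isT k _) sp_homotopyE.
  have /= -> := coh_face e erefl erefl (rigid_edge k w) x.
  rewrite -(@cohM X 3 C ord0 o2 ord_max k).
  refine (@coh_eq X 3 C ord0 ord_max k _ _ x _) => u /=.
  rigid_face w u.
Qed.
End Coherence.

(** * Categories fibred in groupoids over Delta *)

(** The two lifting axioms say that every arrow is cartesian. The base map is a function on arrows
    and not an index of their type, so equations in Delta never require casts of arrows. *)
Record fibration := Fibration {
  Ob : nat -> Type;
  Hom : forall m n, Ob m -> Ob n -> Type;
  base : forall m n (x : Ob m) (y : Ob n), Hom x y -> dhom m n;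
  comp : forall l m n (x : Ob l) (y : Ob m) (z : Ob n),
    Hom y z -> Hom x y -> Hom x z;
  base_comp : forall l m n (x : Ob l) (y : Ob m) (z : Ob n)
    (g : Hom y z) (f : Hom x y), base (comp g f) = dcomp (base g) (base f);
  compA : forall k l m n (w : Ob k) (x : Ob l) (y : Ob m) (z : Ob n)
    (h : Hom y z) (g : Hom x y) (f : Hom w x),
    comp h (comp g f) = comp (comp h g) f;
  ident : forall n (x : Ob n), Hom x x;
  base_ident : forall n (x : Ob n), base (ident x) = did n;
  comp1r : forall m n (x : Ob m) (y : Ob n) (f : Hom x y), comp f (ident x) = f;
  restrict : forall m n (u : dhom m n) (x : Ob n),
    exists (y : Ob m) (f : Hom y x), base f = u;
  hom_lift : forall l m n (x : Ob l) (y : Ob m) (z : Ob n)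
    (g : Hom y z) (h : Hom x z) (v : dhom l m), base h = dcomp (base g) v ->
    exists2 f : Hom x y, base f = v & comp g f = h;
  hom_lift_unique : forall l m n (x : Ob l) (y : Ob m) (z : Ob n)
    (g : Hom y z) (f f' : Hom x y), base f = base f' ->
    comp g f = comp g f' -> f = f' }.

(* An arrow from [z] to [x] over [u] is a homotopy class from [z] to the
   restriction of [x] along [u]. *)
Section TotalCategory.
Variables (X : simplicial_space) (K : sset).

Definition sp_hep n : hep (X n) := kan_hep (@sp_kan X n).
Arguments sp_hep : clear implicits.

Local Notation "x |_ u" := (scomp (sp_map X u) x) (at level 40, u at level 1).
Local Notation "a $ b" := (hcomp (sp_hep _) a b) (at level 50, left associativity).
Local Notation inv a := (hinv (sp_hep _) a).

Lemma pull_pull K1 K2 K3 A (f : smap K2 K1) (g : smap K3 K2) (p : path K1 A) :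
  pull g (pull f p) = pull (scomp f g) p.
Proof. exact: path_eq. Qed.

Lemma Sq_pull K' K1 A (phi : smap K' K1) (p q r s : path K1 A) :
  Sq p q r s -> Sq (pull phi p) (pull phi q) (pull phi r) (pull phi s).
Proof.
case=> H [<- <- <- <-].
exists (@SMap (sprod (sprod K' (simplex 1)) (simplex 1)) A
   (fun n y => H n ((phi n y.1.1, y.1.2), y.2))
   (fun m n g y => etrans (congr1 (fun z => H m ((z, _), _)) (smapN phi g y.1.1))
      (smapN H g ((phi n y.1.1, y.1.2), y.2)))).
by split; apply: path_eq.
Qed.

Section Compositor.
Variables (m n p : nat) (u : dhom n p) (v : dhom m n) (x : smap K (X p)).

Lemma src_compositor : src (pull x (sp_homotopy X u v)) = x |_ (dcomp u v).
Proof. by rewrite src_pull src_sp_homotopy. Qed.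

Lemma tgt_compositor : tgt (pull x (sp_homotopy X u v)) = x |_ u |_ v.
Proof. by rewrite tgt_pull tgt_sp_homotopy; apply: smap_ext. Qed.

Definition compositor : hclass (x |_ (dcomp u v)) (x |_ u |_ v) :=
  hcls src_compositor tgt_compositor.
End Compositor.

Lemma compositor_natural m n p (u : dhom n p) (v : dhom m n)
    (x y : smap K (X p)) (a : hclass x y) :
  hmap (sp_map X (dcomp u v)) a $ compositor u v y =
  compositor u v x $ hmap (sp_map X v) (hmap (sp_map X u) a).
Proof.
have [h ah] := hclass_inhabited a; have [hx hy] := hclass_ends ah.
apply/(Sq_hcomp _ (mem_hmap _ ah) (mem_hcls _ _) (mem_hcls _ _)
  (mem_hmap _ (mem_hmap _ ah))).
have := Sq_natural (sp_homotopy X u v) h.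
by rewrite src_sp_homotopy tgt_sp_homotopy hx hy -scompA.
Qed.

Lemma compositor_coherent k m n p (u : dhom n p) (v : dhom m n) (w : dhom k m)
    (x : smap K (X p)) :
  compositor (dcomp u v) w x $ hmap (sp_map X w) (compositor u v x) =
  compositor u (dcomp v w) x $ compositor v w (x |_ u).
Proof.
apply/(Sq_hcomp _ (mem_hcls _ _) (mem_hmap _ (mem_hcls _ _)) (mem_hcls _ _)
  (mem_hcls _ _)).
rewrite -pull_pull; have := Sq_pull x (sp_homotopy_square X u v w).
congr Sq; exact: path_eq.
Qed.

Definition tot_hom m n (z : smap K (X m)) (x : smap K (X n)) : Type :=
  {u : dhom m n & hclass z (x |_ u)}.

Lemma tot_hom_eq m n (z : smap K (X m)) (x : smap K (X n)) (a b : tot_hom z x) h :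
  projT1 a = projT1 b -> sval (projT2 a) h -> sval (projT2 b) h -> a = b.
Proof.
case: a b => u a [v b] /= e; case: _ / e b => b ah bh.
by congr existT; exact: hclass_eq (sp_hep m) _ _ _ _ _ ah bh.
Qed.

(** The predicate underlying a class has a type that does not mention [u], so projecting to it
    removes the dependent pair. *)
Lemma tot_hom_inj m n (z : smap K (X m)) (x : smap K (X n)) u
    (a b : hclass z (x |_ u)) : existT _ u a = existT _ u b :> tot_hom z x -> a = b.
Proof.
move=> /(congr1 (fun h : tot_hom z x => sval (projT2 h))) /=.
by case: a b => P hP [Q hQ] /= e; exact: eq_exist.
Qed.

Definition tot_comp l m n (z : smap K (X l)) (y : smap K (X m)) (x : smap K (X n))
    (g : tot_hom y x) (f : tot_hom z y) : tot_hom z x :=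
  existT _ (dcomp (projT1 g) (projT1 f))
    (projT2 f $ hmap (sp_map X (projT1 f)) (projT2 g) $
     inv (compositor (projT1 g) (projT1 f) x)).

Lemma tot_compA j l m n (w : smap K (X j)) (z : smap K (X l)) (y : smap K (X m))
    (x : smap K (X n)) (h : tot_hom y x) (g : tot_hom z y) (f : tot_hom w z) :
  tot_comp h (tot_comp g f) = tot_comp (tot_comp h g) f.
Proof.
case: h g f => r c [u b] [v a]; rewrite /tot_comp /=; congr existT.
rewrite !(hmap_hcomp (sp_hep _) (sp_hep _)) -!hcompA; congr (_ $ (_ $ _)).
(* Naturality carries the image of [c] across the compositor of [u] and [v]; the two sides then
   differ by [compositor_coherent]. *)
have e := esym (compositor_natural u v c).
rewrite hcompA (hinv_square e) -hcompA (hmap_hinv _ (sp_hep _)) -!hinv_hcomp.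
by rewrite compositor_coherent.
Qed.

Definition tot_ident n (x : smap K (X n)) : tot_hom x x :=
  existT _ (did n) (hcls (src_cst x) (etrans (tgt_cst x)
    (esym (etrans (congr1 (fun f => scomp f x) (sp_map1 X n)) (scomp1l x))))).

Lemma tot_comp1r m n (z : smap K (X m)) (x : smap K (X n)) (f : tot_hom z x) :
  tot_comp f (tot_ident z) = f.
Proof.
case: f => u a; have [p ap] := hclass_inhabited a; have [pz px] := hclass_ends ap.
apply: (@tot_hom_eq _ _ _ _ _ _ p) => //=; first exact: dcompf1.
have ex : tgt p = x |_ (dcomp u (did m)) by rewrite dcompf1.
suff -> : hcls (src_cst z) (etrans (tgt_cst z)
    (esym (etrans (congr1 (fun f => scomp f z) (sp_map1 X m)) (scomp1l z)))) $
    hmap (sp_map X (did m)) a = hcls pz ex $ compositor u (did m) x.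
  by rewrite -hcompA hcompV hcomp1r; exact: mem_hcls.
apply/(Sq_hcomp _ (mem_hcls _ _) (mem_hmap _ ap) (mem_hcls _ _) (mem_hcls _ _)).
rewrite sp_map1 scomp1l sp_homotopy1 -pz.
rewrite (_ : pull x _ = cst (tgt p)); last by rewrite px; exact: path_eq.
exact/Sq_transpose/Sq_deg.
Qed.

Lemma tot_restrict m n (u : dhom m n) (x : smap K (X n)) :
  exists (y : smap K (X m)) (f : tot_hom y x), projT1 f = u.
Proof. by exists (x |_ u), (existT _ u (hid _)). Qed.

Lemma tot_lift l m n (x : smap K (X l)) (y : smap K (X m)) (z : smap K (X n))
    (g : tot_hom y z) (h : tot_hom x z) (v : dhom l m) :
  projT1 h = dcomp (projT1 g) v ->
  exists2 f : tot_hom x y, projT1 f = v & tot_comp g f = h.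
Proof.
case: g h => u a [w b] /= e; case: _ / (esym e) b => b {e}.
exists (existT _ v (b $ compositor u v z $ inv (hmap (sp_map X v) a))) => //.
rewrite /tot_comp /=; congr existT.
by rewrite -!hcompA (hcompA _ (inv _)) hVcomp hcomp1l hcompV hcomp1r.
Qed.

Lemma tot_lift_unique l m n (x : smap K (X l)) (y : smap K (X m))
    (z : smap K (X n)) (g : tot_hom y z) (f f' : tot_hom x y) :
  projT1 f = projT1 f' -> tot_comp g f = tot_comp g f' -> f = f'.
Proof.
case: f f' => v a [v' b] /= e; case: _ / e b => b /tot_hom_inj.
by move=> /hcomp_injr/hcomp_injr /= ->.
Qed.

Definition total : fibration :=
  @Fibration (fun n => smap K (X n)) tot_hom
    (fun _ _ _ _ f => projT1 f) tot_comp (fun _ _ _ _ _ _ _ _ => erefl)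
    tot_compA tot_ident (fun _ _ => erefl) tot_comp1r tot_restrict tot_lift
    tot_lift_unique.
End TotalCategory.
Arguments sp_hep : clear implicits.

(** * Cocones over zigzags *)

Section Cocones.
Variables (F : fibration) (I J : Type) (s t : J -> I) (c : nat) (a : I -> nat).
Variables (e : J -> nat) (u : forall i, dhom (a i) c).
Variables (l : forall j, dhom (e j) (a (s j))) (r : forall j, dhom (e j) (a (t j))).

Section Zigzag.
Variables (x : forall i, Ob F (a i)) (w : forall j, Ob F (e j)).
Variables (f : forall j, Hom (w j) (x (s j))) (g : forall j, Hom (w j) (x (t j))).

Definition zigzag : Prop := (forall j, base (f j) = l j) /\ forall j, base (g j) = r j.

Definition cocone (z : Ob F c) (k : forall i, Hom (x i) z) : Prop :=
  (forall i, base (k i) = u i) /\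
  forall j, comp (k (s j)) (f j) = comp (k (t j)) (g j).
End Zigzag.

Definition cocones_exist : Prop := forall x w f g, @zigzag x w f g ->
  exists z k, @cocone x w f g z k.

(** An arrow over an identity is invertible, so [h] is an isomorphism of vertices. It is not tied to
    the legs because [is_equivalence_criterion] asks only for some path. *)
Definition cocones_unique : Prop := forall x w f g, @zigzag x w f g ->
  forall z k z' k', @cocone x w f g z k -> @cocone x w f g z' k' ->
  exists h : Hom z z', base h = did c.

(* A weak universal property: [h'] need not be unique, because homotopy classes
   of paths forget the higher homotopies. *)
Definition cocones_versal : Prop := forall x w f g, @zigzag x w f g ->
  forall z k z' k', @cocone x w f g z k -> @cocone x w f g z' k' ->
  forall n (y : Ob F n) (h : Hom z' y), exists h' : Hom z y,
    base h' = base h /\ forall i, comp h' (k i) = comp h (k' i).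
End Cocones.

Lemma hinv_mem K A (hA : hep A) (x y y' : smap K A) (a : hclass x y)
    (b : hclass x y') p q : y = y' -> sval a p -> sval b p ->
  sval (hinv hA a) q -> sval (hinv hA b) q.
Proof.
by move=> e; case: _ / e b => b ap bp; rewrite (hclass_eq hA ap bp).
Qed.

Lemma hinv_mem_l K A (hA : hep A) (x x' y : smap K A) (a : hclass x y)
    (b : hclass x' y) p q : x = x' -> sval a p -> sval b p ->
  sval (hinv hA a) q -> sval (hinv hA b) q.
Proof.
by move=> e; case: _ / e b => b ap bp; rewrite (hclass_eq hA ap bp).
Qed.

(** * Cocones over a zigzag as paths into the homotopy limit *)

Section Realization.
Variables (X : simplicial_space) (I J : Type) (s t : J -> I) (c : nat).
Variables (a : I -> nat) (e : J -> nat) (u : forall i, dhom (a i) c).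
Variables (l : forall j, dhom (e j) (a (s j))) (r : forall j, dhom (e j) (a (t j))).
Hypothesis comm : forall j, dcomp (u (s j)) (l j) = dcomp (u (t j)) (r j).

Local Notation H := (sp_holim X l r).
Local Notation pt := (@holim_pt I J s t (fun i => X (a i)) (fun j => X (e j))
  (fun j => sp_map X (l j)) (fun j => sp_map X (r j))).
Local Notation left := (@holim_left I J s t (fun i => X (a i)) (fun j => X (e j))
  (fun j => sp_map X (l j)) (fun j => sp_map X (r j))).
Local Notation right := (@holim_right I J s t (fun i => X (a i)) (fun j => X (e j))
  (fun j => sp_map X (l j)) (fun j => sp_map X (r j))).
Local Notation sigma := (sp_cone X comm).

Lemma hep_sp_holim : hep H.
Proof. by apply: hep_holim => ?; exact: sp_hep. Qed.

Section Points.
Variable K : sset.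
Local Notation E := (total X K).

Lemma pt_cone i (z : smap K (X c)) :
  scomp (pt i) (scomp sigma z) = scomp (sp_map X (u i)) z.
Proof. exact: smap_ext. Qed.

Lemma left_cone j (z : smap K (X c)) :
  pull (scomp sigma z) (left j) = pull z (sp_homotopy X (u (s j)) (l j)).
Proof. exact: path_eq. Qed.

Lemma right_cone j (z : smap K (X c)) :
  pull (scomp sigma z) (right j) = pull z (sp_homotopy X (u (t j)) (r j)).
Proof. exact: path_eq. Qed.

Definition realizes (x : forall i, Ob E (a i)) (w : forall j, Ob E (e j))
    (f : forall j, Hom (w j) (x (s j))) (g : forall j, Hom (w j) (x (t j)))
    (b : smap K H) : Prop :=
  [/\ forall i, scomp (pt i) b = x i,
      forall j, sval (projT2 (f j)) (pull b (left j))
    & forall j, sval (projT2 (g j)) (pull b (right j))].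

Lemma zigzag_realized x w f g : @zigzag E _ _ s t a e l r x w f g ->
  exists b, @realizes x w f g b.
Proof.
move=> [fl gr].
have /(_ _)/cid-/all_sig[p hp] j := hclass_inhabited (projT2 (f j)).
have /(_ _)/cid-/all_sig[q hq] j := hclass_inhabited (projT2 (g j)).
have e1 j : src (p j) = src (q j).
  by have [-> _] := hclass_ends (hp j); have [-> _] := hclass_ends (hq j).
have e2 j : tgt (p j) = scomp (sp_map X (l j)) (x (s j)).
  by have [_ ->] := hclass_ends (hp j); rewrite -(fl j).
have e3 j : tgt (q j) = scomp (sp_map X (r j)) (x (t j)).
  by have [_ ->] := hclass_ends (hq j); rewrite -(gr j).
exists (@to_holim I J s t (fun i => X (a i)) (fun j => X (e j))
  (fun j => sp_map X (l j)) (fun j => sp_map X (r j)) K x p q e1 e2 e3); split=> [i|j|j].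
- exact: smap_ext.
- rewrite (_ : pull _ _ = p j) //; exact: (@to_holim_left I J s t (fun i => X (a i))).
- rewrite (_ : pull _ _ = q j) //; exact: (@to_holim_right I J s t (fun i => X (a i))).
Qed.

Lemma realization (b : smap K H) : exists x w f g,
  @zigzag E _ _ s t a e l r x w f g /\ realizes f g b.
Proof.
pose x i : Ob E (a i) := scomp (pt i) b.
pose w j : Ob E (e j) := src (pull b (left j)).
have fe j : tgt (pull b (left j)) = scomp (sp_map X (l j)) (x (s j)).
  by rewrite tgt_pull holim_targetl; apply: smap_ext.
have gs j : src (pull b (right j)) = w j.
  by rewrite /w !src_pull holim_source.
have ge j : tgt (pull b (right j)) = scomp (sp_map X (r j)) (x (t j)).
  by rewrite tgt_pull holim_targetr; apply: smap_ext.
exists x, w, (fun j => existT _ (l j) (hcls erefl (fe j))),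
  (fun j => existT _ (r j) (hcls (gs j) (ge j))).
by split; split=> // j; exact: mem_hcls.
Qed.

Lemma tot_hom_over m n (y : Ob E m) (z : Ob E n) (f : Hom y z) v :
  base f = v -> exists A, f = existT _ v A.
Proof. by case: f => v' A /= <-; exists A. Qed.

Lemma homs_over T (m n : T -> nat) (y : forall i, Ob E (m i))
    (z : forall i, Ob E (n i)) (f : forall i, Hom (y i) (z i)) v :
  (forall i, base (f i) = v i) -> exists A, f = fun i => existT _ (v i) (A i).
Proof.
move=> h; have /(_ _)/cid-/all_sig[A hA] i := tot_hom_over (h i).
by exists A; apply: functional_extensionality_dep.
Qed.

(** At [j], compatibility of the legs says that the composites [Gs j] and [Gt j] agree. A path from
    the cone of [z] to [b] needs two squares at [j] with a common side, and these exist exactly when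
    that side represents the inverse of [Gs j] and of [Gt j]. The inverses arise because arrows
    point towards [z] while the path starts there. *)
Lemma cocone_path x w f g b : @zigzag E _ _ s t a e l r x w f g ->
  realizes f g b -> forall (z : smap K (X c)) (k : forall i, @Hom E _ _ (x i) z),
  (forall i, base (k i) = u i) ->
  (forall j, comp (k (s j)) (f j) = comp (k (t j)) (g j)) <->
  exists p : path K H, [/\ src p = scomp sigma z, tgt p = b
    & forall i, sval (hinv (sp_hep X _) (projT2 (k i))) (scomp (pt i) p)].
Proof.
move=> [/homs_over[A ->] /homs_over[B ->]] [ptb leftb rightb] z k.
move=> /homs_over[kappa ->] {f g k} /=; rewrite /= in leftb rightb.
pose Gs j := hcomp (sp_hep X _) (hcomp (sp_hep X _) (A j)
   (hmap (sp_map X (l j)) (kappa (s j)))) (hinv (sp_hep X _) (compositor (u (s j)) (l j) z)).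
pose Gt j := hcomp (sp_hep X _) (hcomp (sp_hep X _) (B j)
   (hmap (sp_map X (r j)) (kappa (t j)))) (hinv (sp_hep X _) (compositor (u (t j)) (r j) z)).
(* [Gs j] and [Gt j] end at points that are equal only through [comm], so they have different types
   and are compared through a common representative. *)
have ez j : scomp (sp_map X (dcomp (u (s j)) (l j))) z =
   scomp (sp_map X (dcomp (u (t j)) (r j))) z by rewrite comm.
have sqs j p C d : sval (hinv (sp_hep X _) (kappa (s j))) p -> sval C d ->
   (Sq (pull (scomp sigma z) (left j)) (pull b (left j)) d
      (scomp (sp_map X (l j)) p) <-> C = hinv (sp_hep X _) (Gs j)).
  move=> hp hd.
  have -> : C = hinv (sp_hep X _) (Gs j) <->
      hcomp (sp_hep X _) (compositor (u (s j)) (l j) z)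
        (hmap (sp_map X (l j)) (hinv (sp_hep X _) (kappa (s j)))) =
      hcomp (sp_hep X _) C (A j).
    rewrite /Gs !hinv_hcomp !hinvK (hmap_hinv _ (sp_hep X _)) hcompA.
    split=> [->|->]; first by rewrite -!hcompA hVcomp hcomp1r.
    by rewrite -!hcompA hcompV hcomp1r.
  rewrite left_cone; apply: (Sq_hcomp _ (mem_hcls _ _) (mem_hmap _ hp) hd).
  exact: leftb.
have sqt j p C d : sval (hinv (sp_hep X _) (kappa (t j))) p -> sval C d ->
   (Sq (pull (scomp sigma z) (right j)) (pull b (right j)) d
      (scomp (sp_map X (r j)) p) <-> C = hinv (sp_hep X _) (Gt j)).
  move=> hp hd.
  have -> : C = hinv (sp_hep X _) (Gt j) <->
      hcomp (sp_hep X _) (compositor (u (t j)) (r j) z)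
        (hmap (sp_map X (r j)) (hinv (sp_hep X _) (kappa (t j)))) =
      hcomp (sp_hep X _) C (B j).
    rewrite /Gt !hinv_hcomp !hinvK (hmap_hinv _ (sp_hep X _)) hcompA.
    split=> [->|->]; first by rewrite -!hcompA hVcomp hcomp1r.
    by rewrite -!hcompA hcompV hcomp1r.
  rewrite right_cone; apply: (Sq_hcomp _ (mem_hcls _ _) (mem_hmap _ hp) hd).
  exact: rightb.
split=> [h|[p [p0 p1 hp]] j].
- have /(_ _)/cid-/all_sig[p hp] i := hclass_inhabited (hinv (sp_hep X _) (kappa i)).
  have /(_ _)/cid-/all_sig[d hd] j := hclass_inhabited (hinv (sp_hep X _) (Gs j)).
  have hd' j : sval (hinv (sp_hep X _) (Gt j)) (d j).
    have [q hq] := hclass_inhabited (Gs j).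
    apply: (hinv_mem (ez j) hq _ (hd j)).
    have eG : sval (Gs j) q = sval (Gt j) q.
      exact: (congr1 (fun h => sval (projT2 h) q) (h j)).
    by rewrite -eG.
  have [||||q [q0 q1 qp]] := @holim_path I J s t (fun i => X (a i)) (fun j => X (e j))
    (fun j => sp_map X (l j)) (fun j => sp_map X (r j)) K (scomp sigma z) b p d.
  + by move=> i; have [-> _] := hclass_ends (hp i); rewrite pt_cone.
  + by move=> i; have [_ ->] := hclass_ends (hp i); rewrite ptb.
  + by move=> j; apply/(sqs _ _ _ _ (hp _) (hd j)).
  + by move=> j; apply/(sqt _ _ _ _ (hp _) (hd' j)).
  by exists q; split=> // i; rewrite qp.
have [d [ds dt]] := holim_path_squares p j; rewrite p0 p1 in ds dt.
have [ds0 _ ds1 _] := Sq_corners ds; have [dt0 _ _ _] := Sq_corners dt.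
have ds2 : src d = scomp (sp_map X (dcomp (u (s j)) (l j))) z.
  by rewrite ds0 left_cone src_compositor.
have dt2 : src d = scomp (sp_map X (dcomp (u (t j)) (r j))) z.
  by rewrite dt0 right_cone src_compositor.
have dw : tgt d = w j.
  by have [<- _] := hclass_ends (leftb j).
have es := (sqs j _ (hcls ds2 dw) d (hp (s j)) (mem_hcls _ _)).1 ds.
have et := (sqt j _ (hcls dt2 dw) d (hp (t j)) (mem_hcls _ _)).1 dt.
have [q hq] := hclass_inhabited (Gs j).
apply: (@tot_hom_eq _ _ _ _ _ _ _ _ q) => //=.
suff : sval (Gt j) q by [].
rewrite -(hinvK (sp_hep X _) (Gt j)) -et.
apply: (hinv_mem_l (ez j) (mem_hcls ds2 dw)); first exact: mem_hcls.
by rewrite es hinvK.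
Qed.

Lemma path_cocone x w f g b z p : @zigzag E _ _ s t a e l r x w f g ->
  realizes f g b -> src p = scomp sigma z -> tgt p = b ->
  exists k : forall i, @Hom E _ _ (x i) z, cocone u f g k /\
    forall i, sval (hinv (sp_hep X _) (projT2 (k i))) (scomp (pt i) p).
Proof.
move=> zz rb p0 p1.
have ps i : src (scomp (pt i) p) = scomp (sp_map X (u i)) z.
  by rewrite src_scomp p0 pt_cone.
have pe i : tgt (scomp (pt i) p) = x i.
  by case: rb => ptb _ _; rewrite tgt_scomp p1 ptb.
pose k i : @Hom E _ _ (x i) z :=
  existT _ (u i) (hinv (sp_hep X _) (hcls (ps i) (pe i))).
have hk i : sval (hinv (sp_hep X _) (projT2 (k i))) (scomp (pt i) p).
  by rewrite /= hinvK; exact: mem_hcls.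
exists k; split=> //; split=> //.
by apply/(cocone_path zz rb) => //; exists p.
Qed.

Lemma equivalence_cocones_exist : is_equivalence sigma ->
  cocones_exist E u l r.
Proof.
move=> sE x w f g zz; have [b rb] := zigzag_realized zz.
have [z [p [p0 p1]]] := equivalence_surjective sE b.
have [k [hk _]] := path_cocone zz rb p0 p1.
by exists z, k.
Qed.

(** The paths from both cones to [b] combine to a class between the images of [z] and [z']. Fullness
    lifts it to [zeta] from [z] to [z'], compatible with the legs, and [h'] is [h] after [zeta]. *)
Lemma equivalence_cocones_versal : is_equivalence sigma ->
  cocones_versal E u l r.
Proof.
move=> sE x w f g zz z k z' k' [ku kc] [ku' kc'] n y h.
have [b rb] := zigzag_realized zz.
have [p [p0 p1 hp]] := (cocone_path zz rb ku).1 kc.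
have [p' [p0' p1' hp']] := (cocone_path zz rb ku').1 kc'.
pose P := hcomp hep_sp_holim (hcls p0 p1) (hinv hep_sp_holim (hcls p0' p1')).
have [zeta hz] := equivalence_full (sp_hep X _) hep_sp_holim sE P.
have [q zq] := hclass_inhabited zeta.
exists (existT _ (projT1 h) (hcomp (sp_hep X _) zeta (projT2 h))); split=> // i.
have : sval P (scomp sigma q) by rewrite -hz; exact: mem_hmap.
move=> Pq; have : Sq (scomp sigma q) p (cst (scomp sigma z)) p'.
  apply/(hcompP hep_sp_holim _ Pq (mem_hcls p0' p1')).
  by rewrite /P -hcompA hVcomp hcomp1r; exact: mem_hcls.
move=> /(Sq_scomp (pt i)); rewrite scomp_cst pt_cone.
have -> : scomp (pt i) (scomp sigma q) = scomp (sp_map X (u i)) q by exact: smap_ext.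
move: (hp i) (hp' i) => {hp hp'}.
case: (k i) (ku i) => v kappa /= ev; case: _ / (esym ev) kappa => kappa.
case: (k' i) (ku' i) => v' kappa' /= ev'; case: _ / (esym ev') kappa' => kappa'.
move=> hp hp' sq.
have ek : hcomp (sp_hep X _) (hmap (sp_map X (u i)) zeta) (hinv (sp_hep X _) kappa') =
    hinv (sp_hep X _) kappa.
  apply: (hclass_eq (sp_hep X _) _ hp).
  exact/(hcompP _ _ (mem_hmap _ zq) hp').
rewrite /tot_comp /=; congr existT; congr hcomp.
rewrite (hmap_hcomp _ (sp_hep X _)) hcompA; congr hcomp.
apply: (@hcomp_injr _ _ (sp_hep X _) _ _ _ _ _ (hinv (sp_hep X _) kappa')).
by rewrite -hcompA ek !hcompV.
Qed.

End Points.

Lemma cocones_equivalence :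
  (forall K, cocones_exist (total X K) u l r) ->
  (forall K, cocones_unique (total X K) u l r) -> is_equivalence sigma.
Proof.
move=> hex huniq; apply: is_equivalence_criterion => [K y|K z z' p p0 p1].
  have [x [w [f [g [zz rb]]]]] := realization y.
  have [z [k [ku kc]]] := hex K x w f g zz.
  by have [p [p0 p1 _]] := (cocone_path zz rb ku).1 kc; exists z, p.
have [x [w [f [g [zz rb]]]]] := realization (scomp sigma z').
have [k [hk _]] := path_cocone zz rb p0 p1.
(* The constant path makes [z'] a cocone over the same zigzag as [z]. *)
have [k' [hk' _]] := path_cocone zz rb (src_cst _) (tgt_cst (scomp sigma z')).
have [[v A] /= ev] := huniq K x w f g zz _ _ _ _ hk hk'.
case: _ / (esym ev) A => A; have [q /hclass_ends[q0 q1]] := hclass_inhabited A.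
by exists q; rewrite q1 sp_map1 scomp1l.
Qed.
End Realization.

(** * Squares in a fibration *)

Section Squares.
Variable F : fibration.

Lemma comp1l m n (x : Ob F m) (y : Ob F n) (f : Hom x y) : comp (ident y) f = f.
Proof.
apply: (@hom_lift_unique F _ _ _ _ _ _ (ident y)).
  by rewrite base_comp base_ident dcomp1f.
by rewrite compA comp1r.
Qed.

Lemma section_of m n (x : Ob F m) (y : Ob F n) (f : Hom x y) (v : dhom n m) :
  dcomp (base f) v = did n ->
  exists2 f' : Hom y x, base f' = v & comp f f' = ident y.
Proof. by move=> e; apply: hom_lift; rewrite base_ident. Qed.

Lemma inverse_of m n (x : Ob F m) (y : Ob F n) (f : Hom x y) (v : dhom n m) :
  dcomp (base f) v = did n -> dcomp v (base f) = did m ->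
  exists f' : Hom y x, [/\ base f' = v, comp f f' = ident y & comp f' f = ident x].
Proof.
move=> e e'; have [f' fv ff] := section_of e; exists f'; split=> //.
apply: (@hom_lift_unique F _ _ _ _ _ _ f).
  by rewrite base_comp fv e' base_ident.
by rewrite compA ff comp1l comp1r.
Qed.

Lemma comp_section_inj k m n (x : Ob F k) (y : Ob F m) (z : Ob F n) (f : Hom x y)
    (f' : Hom y x) (g h : Hom y z) :
  comp f f' = ident y -> comp g f = comp h f -> g = h.
Proof.
move=> e /(congr1 (fun i => comp i f')); by rewrite -!compA e !comp1r.
Qed.

Section Square.
Variables (m n m' n' : nat) (g : dhom m n) (f : dhom m m').
Variables (f' : dhom n n') (g' : dhom m' n').

Definition sq_exist : Prop := forall (w : Ob F m) (y : Ob F n) (x : Ob F m')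
    (a : Hom w y) (b : Hom w x), base a = g -> base b = f ->
  exists (z : Ob F n') (c : Hom y z) (d : Hom x z),
    [/\ base c = f', base d = g' & comp c a = comp d b].

Definition sq_unique : Prop := forall (w : Ob F m) (y : Ob F n) (x : Ob F m')
    (a : Hom w y) (b : Hom w x), base a = g -> base b = f ->
  forall (z : Ob F n') (c : Hom y z) (d : Hom x z)
    (z' : Ob F n') (c' : Hom y z') (d' : Hom x z'),
  base c = f' -> base d = g' -> comp c a = comp d b ->
  base c' = f' -> base d' = g' -> comp c' a = comp d' b ->
  exists h : Hom z z', base h = did n'.

Definition sq_versal : Prop := forall (w : Ob F m) (y : Ob F n) (x : Ob F m')
    (a : Hom w y) (b : Hom w x), base a = g -> base b = f ->
  forall (z : Ob F n') (c : Hom y z) (d : Hom x z)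
    (z' : Ob F n') (c' : Hom y z') (d' : Hom x z'),
  base c = f' -> base d = g' -> comp c a = comp d b ->
  base c' = f' -> base d' = g' -> comp c' a = comp d' b ->
  forall p (t : Ob F p) (h : Hom z' t), exists h' : Hom z t,
    [/\ base h' = base h, comp h' c = comp h c' & comp h' d = comp h d'].
End Square.

Lemma sq_exist_swap m n m' n' (g : dhom m n) (f : dhom m m') (f' : dhom n n')
    (g' : dhom m' n') : sq_exist g f f' g' -> sq_exist f g g' f'.
Proof.
move=> h w y x a b ag bf; have [z [c [d [cf dg e]]]] := h w x y b a bf ag.
by exists z, d, c.
Qed.

Lemma sq_unique_swap m n m' n' (g : dhom m n) (f : dhom m m') (f' : dhom n n')
    (g' : dhom m' n') : sq_unique g f f' g' -> sq_unique f g g' f'.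
Proof.
move=> h w y x a b ag bf z c d z' c' d' h1 h2 h3 h1' h2' h3'.
exact: (h w x y b a bf ag z d c z' d' c' h2 h1 (esym h3) h2' h1' (esym h3')).
Qed.

Section Iso.
Variables (m n m' n' : nat) (g : dhom m n) (f : dhom m m').
Variables (f' : dhom n n') (g' : dhom m' n') (fi : dhom m' m) (f'i : dhom n' n).
Hypotheses (comm : dcomp f' g = dcomp g' f).
Hypotheses (ffi : dcomp f fi = did m') (fif : dcomp fi f = did m).
Hypotheses (ffi' : dcomp f' f'i = did n') (fif' : dcomp f'i f' = did n).

Lemma sq_exist_iso : sq_exist g f f' g'.
Proof.
move=> w y x a b ag bf; have [z [om omf]] := restrict f'i y.
have [c cf _] : exists2 c, base c = f' & comp om c = ident y.
  by apply: hom_lift; rewrite base_ident omf.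
have [||bi [bif bbi bib]] := @inverse_of _ _ _ _ b fi; rewrite ?bf //.
exists z, c, (comp c (comp a bi)); split=> //.
  by rewrite !base_comp cf ag bif dcompA comm -dcompA ffi dcompf1.
by rewrite -!compA bib comp1r.
Qed.

Lemma sq_unique_iso : sq_unique g f f' g'.
Proof.
move=> w y x a b ag bf z c d z' c' d' cf dg e cf' dg' e'.
have [|ci cif _] := @section_of _ _ _ _ c f'i; first by rewrite cf.
by exists (comp c' ci); rewrite base_comp cf' cif.
Qed.
End Iso.

Section Compose.
Variables (m n m1 n1 m2 n2 : nat) (g : dhom m n) (f1 : dhom m m1).
Variables (f1' : dhom n n1) (g1 : dhom m1 n1) (f2 : dhom m1 m2).
Variables (f2' : dhom n1 n2) (g2 : dhom m2 n2).
Hypotheses (comm1 : dcomp f1' g = dcomp g1 f1).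
Hypotheses (comm2 : dcomp f2' g1 = dcomp g2 f2).

Lemma sq_exist_compose : sq_exist g f1 f1' g1 -> sq_exist g1 f2 f2' g2 ->
  sq_exist g (dcomp f2 f1) (dcomp f2' f1') g2.
Proof.
move=> h1 h2 w y x a b ag bf; have [x1 [phi phif]] := restrict f2 x.
have [|b1 b1f b1E] := @hom_lift F _ _ _ _ _ _ phi b f1; first by rewrite phif.
have [z1 [c1 [d1 [c1f d1g e1]]]] := h1 _ _ _ a b1 ag b1f.
have [z [c2 [d2 [c2f d2g e2]]]] := h2 _ _ _ d1 phi d1g phif.
exists z, (comp c2 c1), d2; split=> //; first by rewrite base_comp c2f c1f.
by rewrite -compA e1 compA e2 -compA b1E.
Qed.

(** To apply uniqueness to the second square, both cocones must sit over the same span from [x1].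
    Versality of the first square provides this: it replaces [om'], defined on [z1'], by an arrow
    [h] on [z1] with the right restrictions. *)
Lemma sq_unique_compose : sq_versal g f1 f1' g1 -> sq_unique g1 f2 f2' g2 ->
  sq_unique g (dcomp f2 f1) (dcomp f2' f1') g2.
Proof.
move=> h1 h2 w y x a b ag bf z c d z' c' d' cf dg e cf' dg' e'.
have [x1 [phi phif]] := restrict f2 x.
have [|b1 b1f b1E] := @hom_lift F _ _ _ _ _ _ phi b f1; first by rewrite phif.
have key (t : Ob F n2) (p : Hom y t) (q : Hom x t) :
    base p = dcomp f2' f1' -> base q = g2 -> comp p a = comp q b ->
  exists (t1 : Ob F n1) (om : Hom t1 t) (p1 : Hom y t1) (q1 : Hom x1 t1),
    [/\ base om = f2', base p1 = f1', base q1 = g1 & comp p1 a = comp q1 b1] /\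
    (comp om p1 = p /\ comp om q1 = comp q phi).
  move=> pf qg epq; have [t1 [om omf]] := restrict f2' t.
  have [|p1 p1f p1E] := @hom_lift F _ _ _ _ _ _ om p f1'; first by rewrite omf.
  have [|q1 q1f q1E] := @hom_lift F _ _ _ _ _ _ om (comp q phi) g1.
    by rewrite base_comp qg phif omf.
  exists t1, om, p1, q1; split=> //; split=> //.
  apply: (@hom_lift_unique F _ _ _ _ _ _ om).
    by rewrite !base_comp p1f q1f ag b1f.
  by rewrite !compA p1E q1E epq -compA b1E.
have [z1 [om [c1 [d1 [[omf c1f d1g e1] [oc od]]]]]] := key z c d cf dg e.
have [z1' [om' [c1' [d1' [[omf' c1f' d1g' e1'] [oc' od']]]]]] := key z' c' d' cf' dg' e'.
have [h [hb hc hd]] :=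
  h1 _ _ _ a b1 ag b1f z1 c1 d1 z1' c1' d1' c1f d1g e1 c1f' d1g' e1' _ _ om'.
apply: (h2 _ _ _ d1 phi d1g phif z om d z' h d' omf dg od _ dg').
  by rewrite hb.
by rewrite hd.
Qed.
End Compose.

Section Cancel.
Variables (e b m n m' n' : nat) (vm : dhom e m) (vb : dhom e b) (f : dhom m m').
Variables (h : dhom b m') (g : dhom m n) (f' : dhom n n') (g' : dhom m' n').
Hypotheses (comm1 : dcomp f vm = dcomp h vb) (comm2 : dcomp f' g = dcomp g' f).

(** The outer square defines the vertex and an arrow on the restriction [xb] of [x]. As [x] is
    itself a cocone over [w] and [xb], versality of the first square extends the arrows on [w] and
    [xb] to [x]. *)
Lemma sq_exist_cancel : sq_versal vm vb f h ->
  sq_exist (dcomp g vm) vb f' (dcomp g' h) -> sq_exist g f f' g'.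
Proof.
move=> h1 h2 w y x p q pg qf.
have [xb [beta betaf]] := restrict h x; have [v [nu nuf]] := restrict vm w.
have [|mu muf muE] := @hom_lift F _ _ _ _ _ _ beta (comp q nu) vb.
  by rewrite base_comp qf nuf betaf.
have [|z [c [d0 [cf d0g e0]]]] := h2 _ _ _ (comp p nu) mu _ muf.
  by rewrite base_comp pg nuf.
have [x' [del delf]] := restrict g' z.
have [|p' p'f p'E] := @hom_lift F _ _ _ _ _ _ del (comp c p) f.
  by rewrite base_comp cf pg delf.
have [|d' d'f d'E] := @hom_lift F _ _ _ _ _ _ del d0 h; first by rewrite delf.
have e1 : comp p' nu = comp d' mu.
  apply: (@hom_lift_unique F _ _ _ _ _ _ del).
    by rewrite !base_comp p'f d'f nuf muf.
  by rewrite !compA p'E d'E -compA.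
have [d [db dq dbeta]] := h1 _ _ _ nu mu nuf muf x q beta x' p' d' qf betaf
  (esym muE) p'f d'f e1 _ _ del.
exists z, c, d; split=> //; first by rewrite db.
by rewrite dq p'E.
Qed.

Lemma sq_unique_cancel :
  sq_unique (dcomp g vm) vb f' (dcomp g' h) -> sq_unique g f f' g'.
Proof.
move=> h2 w y x p q pg qf z c d z' c' d' cf dg e0 cf' dg' e0'.
have [xb [beta betaf]] := restrict h x; have [v [nu nuf]] := restrict vm w.
have [|mu muf muE] := @hom_lift F _ _ _ _ _ _ beta (comp q nu) vb.
  by rewrite base_comp qf nuf betaf.
apply: (h2 _ _ _ (comp p nu) mu _ muf z c (comp d beta) z' c' (comp d' beta)) => //.
- by rewrite base_comp pg nuf.
- by rewrite base_comp dg betaf.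
- by rewrite compA e0 -!compA muE.
- by rewrite base_comp dg' betaf.
- by rewrite compA e0' -!compA muE.
Qed.
End Cancel.

Section Transfer.
Variables (m n m' n' n2 : nat) (g : dhom m n) (f : dhom m m').
Variables (f' : dhom n n') (g' : dhom m' n') (phi : dhom n' n2) (psi : dhom n2 n').
Hypotheses (phipsi : dcomp phi psi = did n2) (psiphi : dcomp psi phi = did n').

(** An arbitrary pushout is only isomorphic to the explicit one, so the property must be carried
    along an isomorphism of vertices. *)
Lemma sq_exist_transfer : sq_exist g f f' g' ->
  sq_exist g f (dcomp phi f') (dcomp phi g').
Proof.
move=> h w y x a b ag bf; have [z [c [d [cf dg e]]]] := h _ _ _ a b ag bf.
have [z' [th thf]] := restrict psi z.
have [|c1 c1f c1E] := @hom_lift F _ _ _ _ _ _ th c (dcomp phi f').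
  by rewrite thf dcompA psiphi dcomp1f.
have [|d1 d1f d1E] := @hom_lift F _ _ _ _ _ _ th d (dcomp phi g').
  by rewrite thf dcompA psiphi dcomp1f.
exists z', c1, d1; split=> //; apply: (@hom_lift_unique F _ _ _ _ _ _ th).
  have := congr1 (@base F _ _ _ _) e; rewrite !base_comp c1f d1f cf dg -!dcompA.
  by move->.
by rewrite !compA c1E d1E.
Qed.

Lemma sq_unique_transfer : dcomp f' g = dcomp g' f -> sq_unique g f f' g' ->
  sq_unique g f (dcomp phi f') (dcomp phi g').
Proof.
move=> comm h w y x a b ag bf z c d z' c' d' cf dg e cf' dg' e'.
have key (t : Ob F n2) (p : Hom y t) (q : Hom x t) : base p = dcomp phi f' ->
    base q = dcomp phi g' -> comp p a = comp q b ->
  exists (t1 : Ob F n') (om : Hom t1 t) (p1 : Hom y t1) (q1 : Hom x t1),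
    [/\ base om = phi, base p1 = f', base q1 = g' & comp p1 a = comp q1 b].
  move=> pf qg epq; have [t1 [om omf]] := restrict phi t.
  have [|p1 p1f p1E] := @hom_lift F _ _ _ _ _ _ om p f'; first by rewrite omf.
  have [|q1 q1f q1E] := @hom_lift F _ _ _ _ _ _ om q g'; first by rewrite omf.
  exists t1, om, p1, q1; split=> //; apply: (@hom_lift_unique F _ _ _ _ _ _ om).
    by rewrite !base_comp p1f q1f ag bf.
  by rewrite !compA p1E q1E.
have [z1 [om [c1 [d1 [omf c1f d1g e1]]]]] := key z c d cf dg e.
have [z1' [om' [c1' [d1' [omf' c1f' d1g' e1']]]]] := key z' c' d' cf' dg' e'.
have [k kf] := h _ _ _ a b ag bf _ _ _ _ _ _ c1f d1g e1 c1f' d1g' e1'.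
have [|oi oif _] := @section_of _ _ _ _ om psi; first by rewrite omf.
by exists (comp om' (comp k oi)); rewrite !base_comp omf' kf oif dcomp1f.
Qed.
End Transfer.
End Squares.

(** ** Squares preserved by a simplicial space *)

Definition sq_local (X : simplicial_space) m n m' n' (g : dhom m n)
    (f : dhom m m') (f' : dhom n n') (g' : dhom m' n') : Prop :=
  forall K, [/\ sq_exist (total X K) g f f' g', sq_unique (total X K) g f f' g'
    & sq_versal (total X K) g f f' g'].

Section Local.
Variables (X : simplicial_space) (m n m' n' : nat) (g : dhom m n) (f : dhom m m').
Variables (f' : dhom n n') (g' : dhom m' n') (comm : dcomp f' g = dcomp g' f).
Hypothesis hexist : forall K, sq_exist (total X K) g f f' g'.
Hypothesis hunique : forall K, sq_unique (total X K) g f f' g'.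

Lemma sq_sends_to_pullback : sends_to_pullback X comm.
Proof.
apply: cocones_equivalence => K x w a b [al bl].
  have [z [c [d [cf dg e]]]] :=
    @hexist K (w tt) (x true) (x false) (a tt) (b tt) (al tt) (bl tt).
  exists z, (fun i => match i return @Hom (total X K) _ _ (x i) z with
                      | true => c | false => d end).
  by split; [case|case].
move=> z k z' k' [ku kc] [ku' kc'].
exact: (@hunique K (w tt) (x true) (x false) (a tt) (b tt) (al tt) (bl tt)
  z (k true) (k false) z' (k' true) (k' false) (ku true) (ku false) (kc tt)
  (ku' true) (ku' false) (kc' tt)).
Qed.

(* Existence and uniqueness of cocones for all [K] make the map to the homotopy
   limit an equivalence, and an equivalence is full on homotopy classes. *)
Lemma sq_is_local : sq_local X g f f' g'.
Proof.
move=> K; split=> // w y x a b ag bf z c d z' c' d' cf dg e cf' dg' e' p t h.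
have := equivalence_cocones_versal (K := K) sq_sends_to_pullback.
pose ob (i : bool) : Ob (total X K) (square_obj n m' i) :=
  match i return Ob (total X K) (square_obj n m' i) with true => y | false => x end.
pose arr (t0 : Ob (total X K) n') (c0 : Hom y t0) (d0 : Hom x t0) (i : bool) :
    Hom (ob i) t0 :=
  match i return Hom (ob i) t0 with true => c0 | false => d0 end.
move=> /(_ ob (fun=> w) (fun=> a) (fun=> b)) vers.
have [|||h' [h'b h'k]] := vers _ z (arr z c d) z' (arr z' c' d') _ _ p t h.
- by split.
- by split; [case|case].
- by split; [case|case].
by exists h'; split=> //; [exact: (h'k true)|exact: (h'k false)].
Qed.
End Local.

(** * Gluing along a vertex *)

Lemma dshift_mono k m n (i j : 'I_m.+1) : i <= j ->
  (inord (minn (k + i) n) : 'I_n.+1) <= (inord (minn (k + j) n) : 'I_n.+1).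
Proof.
move=> ij; rewrite !inordK ?ltnS ?geq_minr // leq_min geq_minr andbT.
by rewrite geq_min leq_add2l ij.
Qed.

(* Truncated: equal to i |-> k + i only if k + m <= n. *)
Definition dshift k m n : dhom m n := DHom (@dshift_mono k m n).

Lemma dshiftE k m n i : k + m <= n -> dshift k m n i = k + i :> nat.
Proof.
move=> h; rewrite /= inordK ?ltnS ?geq_minr //; apply/minn_idPl.
by apply: leq_trans h; rewrite leq_add2l -ltnS.
Qed.

Lemma dhom_eq m n (f g : dhom m n) : (forall i, f i = g i :> nat) -> f = g.
Proof. by move=> h; apply: dhom_ext => i; exact: ord_inj. Qed.

Lemma dcompE m n p (g : dhom n p) (f : dhom m n) i : dcomp g f i = g (f i).
Proof. by []. Qed.

Lemma dshift_comp k l m n p : k + m <= n -> l + n <= p ->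
  dcomp (dshift l n p) (dshift k m n) = dshift (l + k) m p.
Proof.
move=> h1 h2; apply: dhom_eq => i; rewrite dcompE !dshiftE ?addnA //.
by rewrite -addnA (leq_trans _ h2) // leq_add2l.
Qed.

Lemma spine_edgeE r (i : 'I_r) : spine_edge i = dshift i 1 r.
Proof. by apply: dhom_eq => u; rewrite dshiftE ?addn1. Qed.

(** The index counts the inner vertices: the simplex is [[n + 1]], so [segal_map n] corresponds to
    the index [n + 1]. *)
Definition spine_exist F n : Prop :=
  @cocones_exist F 'I_n.+1 'I_n (widen_ord (leqnSn n)) (lift ord0) n.+1 (fun=> 1)
    (fun=> 0) (@spine_edge n.+1) (fun=> dconst 0 ord_max) (fun=> dconst 0 ord0).

Definition spine_versal F n : Prop :=
  @cocones_versal F 'I_n.+1 'I_n (widen_ord (leqnSn n)) (lift ord0) n.+1 (fun=> 1)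
    (fun=> 0) (@spine_edge n.+1) (fun=> dconst 0 ord_max) (fun=> dconst 0 ord0).

(** The Segal maps start at [[2]]. For [[1]] the spine is the whole simplex, and the only leg is
    invertible. *)
Lemma spine_versal0 F : spine_versal F 0.
Proof.
move=> x w f g _ z k z' k' [ku _] [ku' _] p y h.
have e : @spine_edge 1 ord0 = did 1 by apply: dhom_eq => i.
have [||v [vf kv vk]] := @inverse_of F _ _ _ _ (k ord0) (did 1).
- by rewrite ku e dcomp1f.
- by rewrite ku e dcomp1f.
exists (comp h (comp (k' ord0) v)); split=> [|i].
  by rewrite !base_comp ku' vf e !dcompf1.
by rewrite (ord1 i) -!compA vk comp1r.
Qed.

Section Glue.
Variables (F : fibration) (n : nat).
Local Notation p := n.+1.

(* The edges of the spine of [p + 1], the first p of them taken in [x] and the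
   last one equal to [y], and the vertices where they meet. *)
Lemma spine_edges (x : Ob F p) (y : Ob F 1) : exists (E : nat -> Ob F 1)
    (a : forall i, i < p -> Hom (E i) x) (b : forall i, p <= i -> Hom (E i) y),
  (forall i h, base (a i h) = dshift i 1 p) /\ (forall i h, base (b i h) = did 1).
Proof.
have ex i : exists (E : Ob F 1) (a : i < p -> Hom E x) (b : p <= i -> Hom E y),
    (forall h, base (a h) = dshift i 1 p) /\ (forall h, base (b h) = did 1).
  case: (ltnP i p) => h.
    have [E [a ea]] := restrict (dshift i 1 p) x.
    by exists E, (fun=> a), (fun h => False_rect _ (notF h)).
  by exists y, (fun h => False_rect _ (notF h)), (fun=> ident y);
    split=> [[]|_] //; exact: base_ident.
have /(_ _)/cid-/all_sig[E exE] := ex.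
have /(_ _)/cid-/all_sig[a exa] := exE.
have /(_ _)/cid-/all_sig[b exb] := exa.
by exists E, a, b; split=> i h; case: (exb i).
Qed.

Section Vertices.
Variables (w : Ob F 0) (x : Ob F p) (y : Ob F 1) (a0 : Hom w x) (b0 : Hom w y).
Hypotheses (a0f : base a0 = dshift p 0 p) (b0f : base b0 = dshift 0 0 1).
Variables (E : nat -> Ob F 1) (a : forall i, i < p -> Hom (E i) x).
Variable (b : forall i, p <= i -> Hom (E i) y).
Hypotheses (af : forall i h, base (@a i h) = dshift i 1 p).
Hypotheses (bf : forall i h, base (@b i h) = did 1).

(** Vertices inside [x] are restrictions of [x]; at the last one the edges come from [x] and [y],
    and it is [w] itself. Quantifying over the bounds [h] and [h'] makes one of the last two
    conditions vacuous in each case. *)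
Lemma spine_vertices : exists (V : 'I_p -> Ob F 0)
    (f : forall j : 'I_p, Hom (V j) (E j)) (g : forall j : 'I_p, Hom (V j) (E j.+1)),
  [/\ forall j, base (f j) = dconst 0 ord_max,
      forall j, base (g j) = dconst 0 ord0,
      forall (j : 'I_p) h h', comp (@a j h) (f j) = comp (@a j.+1 h') (g j)
    & forall (j : 'I_p) h h', exists2 t : Hom (V j) w, base t = did 0 &
        comp (@a j h) (f j) = comp a0 t /\ comp (@b j.+1 h') (g j) = comp b0 t].
Proof.
have ex (j : 'I_p) : exists (V : Ob F 0) (f : Hom V (E j)) (g : Hom V (E j.+1)),
  [/\ base f = dconst 0 ord_max, base g = dconst 0 ord0,
      forall h h', comp (@a j h) f = comp (@a j.+1 h') g
    & forall h h', exists2 t : Hom V w, base t = did 0 &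
        comp (@a j h) f = comp a0 t /\ comp (@b j.+1 h') g = comp b0 t].
  have jp := ltn_ord j; have [h|h] : j.+1 < p \/ p <= j.+1 by case: ltnP; [left|right].
    have [V [v vf]] := restrict (dshift j.+1 0 p) x.
    have [|f ff fE] := @hom_lift F _ _ _ _ _ _ (a jp) v (dconst 0 ord_max).
      rewrite vf af; apply: dhom_eq => i.
      by rewrite dcompE !dshiftE ?addn1 ?addn0 // (ord1 i) /= addn0.
    have [|g gf gE] := @hom_lift F _ _ _ _ _ _ (a h) v (dconst 0 ord0).
      rewrite vf af; apply: dhom_eq => i.
      by rewrite dcompE !dshiftE ?addn1 ?addn0 // (ord1 i) /= !addn0.
    exists V, f, g; split=> // [h1 h2|h1 h2].
      by rewrite (bool_irrelevance h1 jp) (bool_irrelevance h2 h) fE gE.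
    by exfalso; move: (h); rewrite ltnNge h2.
  have [|f ff fE] := @hom_lift F _ _ _ _ _ _ (a jp) a0 (dconst 0 ord_max).
    rewrite a0f af; apply: dhom_eq => i.
    rewrite dcompE !dshiftE ?addn1 ?addn0 // (ord1 i) /= addn0.
    by apply/eqP; rewrite eqn_leq h.
  have [|g gf gE] := @hom_lift F _ _ _ _ _ _ (b h) b0 (dconst 0 ord0).
    by rewrite b0f bf dcomp1f; apply: dhom_eq => i; rewrite dshiftE // (ord1 i).
  exists w, f, g; split=> // [h1 h2|h1 h2].
    by exfalso; move: (h2); rewrite ltnNge h.
  exists (ident w); first exact: base_ident.
  by rewrite !comp1r (bool_irrelevance h1 jp) (bool_irrelevance h2 h) fE gE.
have /(_ _)/cid-/all_sig[V exV] := ex.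
have /(_ _)/cid-/all_sig[f exf] := exV.
have /(_ _)/cid-/all_sig[g exg] := exf.
by exists V, f, g; split=> j; case: (exg j).
Qed.
End Vertices.

(** The spine of [[p + 1]] assembled from [x] and [y] has a cocone [z]. Both [x] and the restriction
    [x'] of [z] are cocones over the first [p] edges, so versality turns the arrow from [x'] to [z]
    into the required one from [x]. *)
Lemma glue_exist : spine_exist F p -> spine_versal F n ->
  sq_exist F (dshift p 0 p) (dshift 0 0 1) (dshift 0 p p.+1) (dshift p 1 p.+1).
Proof.
move=> hex hvers w x y a0 b0 a0f b0f.
have [E [a [b [af bf]]]] := spine_edges x y.
have [V [f [g [ff gf fg jct]]]] := spine_vertices a0f b0f af bf.
have [z [k [kf0 kE]]] := hex (fun i : 'I_p.+1 => E i) V f g (conj ff gf).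
have kf (i : 'I_p.+1) : @base F 1 _ (E i) z (k i) = spine_edge i by exact: kf0.
have kEn (j : 'I_p) (h : j < p.+1) (h' : j.+1 < p.+1) :
    comp (k (Ordinal h)) (f j) = comp (k (Ordinal h')) (g j).
  rewrite (bool_irrelevance h (widen_ord_proof j (leqnSn p))).
  have -> : h' = (@lift_subproof p.+1 (@ord0 p) j : j.+1 < p.+1) by exact: bool_irrelevance.
  exact: (kE j).
have [x' [om omf]] := restrict (dshift 0 p p.+1) z.
pose wi (i : 'I_p) : 'I_p.+1 := widen_ord (leqnSn p) i.
have /(_ _)/cid2-/all_sig2[k' k'f k'E] (i : 'I_p) :
    exists2 h : Hom (E i) x', base h = spine_edge i & comp om h = k (wi i).
  apply: hom_lift; rewrite omf; transitivity (spine_edge (wi i)); first exact: (kf (wi i)).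
  by rewrite !spine_edgeE dshift_comp // addn1.
pose wj (j : 'I_n) : 'I_p := widen_ord (leqnSn n) j.
have [|||c [cf cE]] := hvers (fun i : 'I_p => E i) (fun j => V (wj j))
    (fun j => f (wj j)) (fun j => g (wj j)) _ x (fun i => a i (ltn_ord i)) x' k'
    _ _ _ z om.
- by split=> j; [exact: ff|exact: gf].
- split=> [i|j]; first by rewrite af spine_edgeE.
  exact: (fg (wj j)).
- split=> // j; apply: (@hom_lift_unique F _ _ _ _ _ _ om).
    by rewrite !base_comp !k'f ff gf; apply: dhom_eq => i; rewrite /= /bump addn0 addn1.
  rewrite !compA !k'E; refine (kEn (wj j) _ _).
have [||bi [bif bbi bib]] := @inverse_of _ _ _ _ _ (b p (leqnn p)) (did 1).
- by rewrite bf dcomp1f.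
- by rewrite bf dcomp1f.
exists z, c, (comp (k ord_max) bi); split.
- by rewrite cf omf.
- by rewrite base_comp kf bif dcompf1 spine_edgeE.
(* Since [t] lies over an identity it has a section, so the equation may be checked after composing
   with [t]. There it is the condition of [z] at the last vertex. *)
have [t tf [t1 t2]] := jct ord_max (leqnn _) (leqnn _).
have [|ti _ tti] := @section_of _ _ _ _ _ t (did 0); first by rewrite tf dcomp1f.
apply: (comp_section_inj tti); rewrite -!compA -t1 -t2.
rewrite (compA bi) bib comp1l compA.
have := cE ord_max; rewrite k'E => ce.
have -> : comp c (a ord_max (leqnn n.+1)) = k (wi ord_max).
  by rewrite -ce; congr (comp c (a _ _)); exact: bool_irrelevance.
refine (kEn ord_max _ _).
Qed.

(** A cocone over [x] and [y] restricts to one over the spine of [[p + 1]]; versality applied to the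
    identity of [z'] compares the two. *)
Lemma glue_unique : spine_versal F p ->
  sq_unique F (dshift p 0 p) (dshift 0 0 1) (dshift 0 p p.+1) (dshift p 1 p.+1).
Proof.
move=> hvers w x y a0 b0 a0f b0f z c d z' c' d' cf dg e cf' dg' e'.
have [E [a [b [af bf]]]] := spine_edges x y.
have [V [f [g [ff gf fg jct]]]] := spine_vertices a0f b0f af bf.
have key (t : Ob F p.+1) (q : Hom x t) (r : Hom y t) :
    base q = dshift 0 p p.+1 -> base r = dshift p 1 p.+1 -> comp q a0 = comp r b0 ->
  exists k : forall i : 'I_p.+1, Hom (E i) t,
    @cocone F 'I_p.+1 'I_p (widen_ord (leqnSn p)) (lift ord0) p.+1 (fun=> 1) (fun=> 0)
      (@spine_edge p.+1) (fun i : 'I_p.+1 => E i) V f g t k.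
  move=> qf rf qr.
  have /(_ _)/cid-/all_sig[k kP] (i : 'I_p.+1) : exists k : Hom (E i) t,
      [/\ base k = spine_edge i, forall h, k = comp q (a i h)
        & forall h, k = comp r (b i h)].
    have [h|h] : i < p \/ p <= i by case: ltnP; [left|right].
      exists (comp q (a i h)); split=> [|h'|h'].
      - by rewrite base_comp qf af spine_edgeE dshift_comp // addn1.
      - by rewrite (bool_irrelevance h h').
      - by exfalso; move: (h); rewrite ltnNge h'.
    exists (comp r (b i h)); split=> [|h'|h'].
    - rewrite base_comp rf bf dcompf1 spine_edgeE; suff -> : nat_of_ord i = p by [].
      by apply/eqP; rewrite eqn_leq h -ltnS ltn_ord.
    - by exfalso; move: (h'); rewrite ltnNge h.
    - by rewrite (bool_irrelevance h h').
  exists k; split=> [i|j]; first by case: (kP i).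
  have [_ kj _] := kP (widen_ord (leqnSn p) j).
  have [_ kj1 kj2] := kP (lift ord0 j).
  have [h|h] : j.+1 < p \/ p <= j.+1 by case: ltnP; [left|right].
    rewrite (kj (ltn_ord j)) (kj1 h) -!compA; congr comp; exact: fg.
  rewrite (kj (ltn_ord j)) (kj2 h) -!compA.
  have [v _ [v1 v2]] := jct j (ltn_ord j) h.
  transitivity (comp q (comp a0 v)); first by congr comp.
  by rewrite compA qr -compA; congr comp.
have [k kc] := key z c d cf dg e; have [k' kc'] := key z' c' d' cf' dg' e'.
have [h' [h'f _]] := hvers _ _ _ _ (conj ff gf) _ _ _ _ kc kc' _ _ (ident z').
by exists h'; rewrite h'f base_ident.
Qed.
End Glue.

Lemma dshift0 n : dshift 0 n n = did n.
Proof. by apply: dhom_eq => i; rewrite dshiftE. Qed.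

(** * Gluing squares for a Segal space *)

Section LocalSquares.
Variable X : simplicial_space.

Lemma sq_local_iso m n m' n' (g : dhom m n) (f : dhom m m') (f' : dhom n n')
    (g' : dhom m' n') fi f'i : dcomp f' g = dcomp g' f ->
  dcomp f fi = did m' -> dcomp fi f = did m ->
  dcomp f' f'i = did n' -> dcomp f'i f' = did n -> sq_local X g f f' g'.
Proof.
move=> comm ffi fif ffi' fif'; apply: (sq_is_local comm) => K.
  exact: (@sq_exist_iso _ _ _ _ _ _ _ _ _ fi f'i).
exact: (@sq_unique_iso _ _ _ _ _ _ _ _ _ f'i).
Qed.

Lemma sq_local_swap m n m' n' (g : dhom m n) (f : dhom m m') (f' : dhom n n')
    (g' : dhom m' n') : dcomp f' g = dcomp g' f ->
  sq_local X g f f' g' -> sq_local X f g g' f'.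
Proof.
move=> comm h; apply: (sq_is_local (esym comm)) => K; case: (h K) => h1 h2 _.
  exact: sq_exist_swap.
exact: sq_unique_swap.
Qed.

Lemma sq_local_compose m n m1 n1 m2 n2 (g : dhom m n) (f1 : dhom m m1)
    (f1' : dhom n n1) (g1 : dhom m1 n1) (f2 : dhom m1 m2) (f2' : dhom n1 n2)
    (g2 : dhom m2 n2) : dcomp f1' g = dcomp g1 f1 -> dcomp f2' g1 = dcomp g2 f2 ->
  sq_local X g f1 f1' g1 -> sq_local X g1 f2 f2' g2 ->
  sq_local X g (dcomp f2 f1) (dcomp f2' f1') g2.
Proof.
move=> c1 c2 h1 h2; apply: sq_is_local => [|K|K].
- by rewrite -dcompA c1 !dcompA c2.
- by case: (h1 K) => e1 _ _; case: (h2 K) => e2 _ _; exact: sq_exist_compose e1 e2.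
- case: (h1 K) => _ _ v1; case: (h2 K) => _ u2 _.
  exact: (sq_unique_compose c1 c2 v1 u2).
Qed.

Lemma sq_local_cancel e b m n m' n' (vm : dhom e m) (vb : dhom e b) (f : dhom m m')
    (h : dhom b m') (g : dhom m n) (f' : dhom n n') (g' : dhom m' n') :
  dcomp f vm = dcomp h vb -> dcomp f' g = dcomp g' f ->
  sq_local X vm vb f h -> sq_local X (dcomp g vm) vb f' (dcomp g' h) ->
  sq_local X g f f' g'.
Proof.
move=> c1 c2 h1 h2; apply: (sq_is_local c2) => K.
  case: (h1 K) => _ _ v1; case: (h2 K) => e2 _ _.
  exact: (sq_exist_cancel c1 c2 v1 e2).
by case: (h2 K) => _ u2 _; exact: (sq_unique_cancel c1 u2).
Qed.

Hypothesis segal : is_segal_space X.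

Lemma segal_spine_exist K n : spine_exist (total X K) n.+1.
Proof. exact: equivalence_cocones_exist (segal n). Qed.

Lemma segal_spine_versal K n : spine_versal (total X K) n.
Proof.
case: n => [|n]; first exact: spine_versal0.
exact: equivalence_cocones_versal (segal n).
Qed.

Definition glue_local p q c : Prop :=
  sq_local X (dshift p 0 p) (dshift 0 0 q) (dshift 0 p c) (dshift p q c).

Lemma glue_comm p q c : c = p + q ->
  dcomp (dshift 0 p c) (dshift p 0 p) = dcomp (dshift p q c) (dshift 0 0 q).
Proof. by move=> ->; rewrite !dshift_comp ?addn0 ?add0n ?leq_addr. Qed.

Lemma glue_local_edge p : glue_local p 1 p.+1.
Proof.
(* Gluing at the vertex of [[0]] has isomorphisms for two opposite sides and does not depend on the
   Segal condition. *)
case: p => [|n].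
  apply: sq_local_swap; first by rewrite !dshift_comp.
  apply: (@sq_local_iso _ _ _ _ _ _ _ _ (did 0) (did 1));
    by rewrite ?dshift0 ?dcompf1 ?dcomp1f ?dshift_comp.
apply: sq_is_local => [|K|K]; first by apply: glue_comm; rewrite addn1.
  by apply: glue_exist; [exact: segal_spine_exist|exact: segal_spine_versal].
by apply: glue_unique; exact: segal_spine_versal.
Qed.

Lemma glue_localP p q : glue_local p q (p + q).
Proof.
elim: q => [|q IH].
  rewrite /glue_local addn0.
  by apply: (@sq_local_iso _ _ _ _ _ _ _ _ (did 0) (did p));
    rewrite ?dshift0 ?dcompf1 ?dcomp1f.
rewrite addnS /glue_local; set c := p + q.
have -> : dshift 0 0 q.+1 = dcomp (dshift 0 q q.+1) (dshift 0 0 q).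
  by rewrite dshift_comp // add0n.
have -> : dshift 0 p c.+1 = dcomp (dshift 0 c c.+1) (dshift 0 p c).
  by rewrite dshift_comp // ?add0n ?leq_addr.
have comm : dcomp (dshift 0 c c.+1) (dshift p q c) =
    dcomp (dshift p q.+1 c.+1) (dshift 0 q q.+1).
  by rewrite !dshift_comp ?addn0 ?add0n ?addnS.
apply: (sq_local_compose _ comm IH); first exact: glue_comm.
(* The square enlarging [[q]] to [[q + 1]] inside [[p + q + 1]] is what remains when the gluing of
   an edge to [[q]] is cancelled from its gluing to [[p + q]]. *)
apply: (sq_local_cancel _ comm (glue_local_edge q)).
  by apply: glue_comm; rewrite addn1.
rewrite !dshift_comp ?addnS ?addn0 ?addn1 //; exact: glue_local_edge.
Qed.

(** ** Extending an active map by the identity on both sides *)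

Section Extend.
Variables (m n : nat) (g : dhom m n).

Definition act_nat (i : nat) : nat := g (inord (minn i m)).

Lemma act_nat_mono i j : i <= j -> act_nat i <= act_nat j.
Proof.
by move=> ij; apply: dmono; rewrite !inordK ?ltnS ?geq_minr // leq_min geq_minr
  andbT geq_min ij.
Qed.

(** The identity up to [a], then [g] shifted by [a], then the translation taking [a + m] to [a + n].
    Written as a sum of truncated pieces, it is monotone term by term. *)
Definition ext_nat a (i : nat) : nat := minn i a + act_nat (i - a) + (i - (a + m)).

Lemma dext_mono a M N (i j : 'I_M.+1) : i <= j ->
  (inord (minn (ext_nat a i) N) : 'I_N.+1) <= (inord (minn (ext_nat a j) N) : 'I_N.+1).
Proof.
move=> ij; rewrite !inordK ?ltnS ?geq_minr // leq_min geq_minr andbT geq_min.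
apply/orP; left; rewrite /ext_nat leq_add ?leq_sub2r // leq_add ?act_nat_mono //.
  by rewrite leq_min geq_minr geq_min ij.
exact: leq_sub2r.
Qed.

Definition dext a M N : dhom M N := DHom (@dext_mono a M N).

Lemma dextE a M N (i : 'I_M.+1) : ext_nat a i <= N -> dext a M N i = ext_nat a i :> nat.
Proof. by move=> h; rewrite /= inordK ?ltnS ?geq_minr //; apply/minn_idPl. Qed.

Hypothesis ag : active g.

Lemma act_natE (i : 'I_m.+1) : act_nat i = g i.
Proof. by rewrite /act_nat (minn_idPl _) -1?ltnS // inord_val. Qed.

Lemma act_nat0 : act_nat 0 = 0.
Proof. by case: ag => g0 _; have := act_natE ord0; rewrite g0. Qed.

Lemma act_nat_ge i : m <= i -> act_nat i = n.
Proof.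
case: ag => _ gm mi; have := act_natE ord_max; rewrite gm /= => <-.
by rewrite /act_nat (minn_idPr mi) minnn.
Qed.

Lemma act_nat_le i : act_nat i <= n.
Proof. by rewrite -ltnS ltn_ord. Qed.

Lemma ext_nat_l a i : i <= a -> ext_nat a i = i.
Proof.
move=> ia; rewrite /ext_nat (minn_idPl ia).
have -> : i - a = 0 by lia.
by rewrite act_nat0; lia.
Qed.

Lemma ext_nat_mid a i : i <= m -> ext_nat a (a + i) = a + act_nat i.
Proof.
move=> im; rewrite /ext_nat (minn_idPr (leq_addr _ _)).
have -> : a + i - a = i by lia.
lia.
Qed.

Lemma ext_nat_r a i : ext_nat a (a + m + i) = a + n + i.
Proof.
rewrite /ext_nat act_nat_ge; last by lia.
lia.
Qed.

Lemma ext_nat_bound a b i : i <= a + m + b -> ext_nat a i <= a + n + b.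
Proof. by move=> h; rewrite /ext_nat; have := act_nat_le (i - a); lia. Qed.

Lemma ext_nat_bound0 a i : i <= a + m -> ext_nat a i <= a + n.
Proof. by have := @ext_nat_bound a 0 i; rewrite !addn0. Qed.

Lemma extension_left_comm a : dcomp (dshift a n (a + n)) g =
  dcomp (dext a (a + m) (a + n)) (dshift a m (a + m)).
Proof.
apply: dhom_eq => i; have im : i <= m by rewrite -ltnS.
rewrite !dcompE dextE dshiftE ?dshiftE ?ext_nat_mid ?act_natE //.
by rewrite leq_add2l -ltnS.
Qed.

Lemma extension_left_local a :
  sq_local X g (dshift a m (a + m)) (dshift a n (a + n)) (dext a (a + m) (a + n)).
Proof.
apply: (@sq_local_cancel _ _ _ _ _ _ (dshift 0 0 m) (dshift a 0 a) _
  (dshift 0 a (a + m))).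
- by rewrite !dshift_comp ?add0n ?addn0 ?leq_addr.
- exact: extension_left_comm.
- by apply: sq_local_swap; [exact: glue_comm|exact: glue_localP].
- have -> : dcomp g (dshift 0 0 m) = dshift 0 0 n.
    apply: dhom_eq => i; rewrite dcompE [RHS]dshiftE // (ord1 i).
    case: ag => g0 _; rewrite (_ : dshift 0 0 m ord0 = ord0) ?g0 //.
    by apply: ord_inj; rewrite dshiftE.
  have -> : dcomp (dext a (a + m) (a + n)) (dshift 0 a (a + m)) = dshift 0 a (a + n).
    apply: dhom_eq => i; have ia : i <= a by rewrite -ltnS.
    rewrite dcompE dextE !dshiftE ?add0n ?leq_addr // ext_nat_l //.
    exact: leq_trans (leq_addr _ _).
  by apply: sq_local_swap; [exact: glue_comm|exact: glue_localP].
Qed.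

Lemma extension_local a b :
  sq_local X g (dshift a m (a + m + b)) (dshift a n (a + n + b))
    (dext a (a + m + b) (a + n + b)).
Proof.
have -> : dshift a m (a + m + b) =
    dcomp (dshift 0 (a + m) (a + m + b)) (dshift a m (a + m)).
  by rewrite dshift_comp // add0n leq_addr.
have -> : dshift a n (a + n + b) =
    dcomp (dshift 0 (a + n) (a + n + b)) (dshift a n (a + n)).
  by rewrite dshift_comp // add0n leq_addr.
have comm : dcomp (dshift 0 (a + n) (a + n + b)) (dext a (a + m) (a + n)) =
    dcomp (dext a (a + m + b) (a + n + b)) (dshift 0 (a + m) (a + m + b)).
  apply: dhom_eq => i; have im : i <= a + m by rewrite -ltnS.
  have im' : i <= a + m + b by exact: leq_trans im (leq_addr _ _).
  rewrite !dcompE dshiftE ?add0n ?leq_addr // !dextE ?dshiftE ?add0n ?leq_addr //.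
    exact: ext_nat_bound.
  exact: ext_nat_bound0.
(* The extension on the left is pasted with the attachment of [[b]] at the last vertex, and the
   second square comes from cancellation once more. *)
apply: (sq_local_compose _ comm (extension_left_local a)).
  exact: extension_left_comm.
apply: (sq_local_cancel _ comm (glue_localP (a + m) b)); first exact: glue_comm.
have -> : dcomp (dext a (a + m) (a + n)) (dshift (a + m) 0 (a + m)) =
    dshift (a + n) 0 (a + n).
  apply: dhom_eq => i.
  by rewrite dcompE dextE !dshiftE ?addn0 // (ord1 i) -?[a + m in ext_nat]addn0
    ext_nat_r ?addn0.
have -> : dcomp (dext a (a + m + b) (a + n + b)) (dshift (a + m) b (a + m + b)) =
    dshift (a + n) b (a + n + b).
  apply: dhom_eq => i.
  by rewrite dcompE dextE !dshiftE // ext_nat_r // leq_add2l -ltnS.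
exact: glue_localP.
Qed.

(** * Comparison of the extended active map with a given pushout *)

Section Pushout.
Variables (a b n' : nat) (f' : dhom n n') (g' : dhom (a + m + b) n').
Local Notation f := (dshift a m (a + m + b)).
Local Notation F' := (dshift a n (a + n + b)).
Local Notation G' := (dext a (a + m + b) (a + n + b)).
Hypothesis comm : dcomp f' g = dcomp g' f.

Definition glue_map (i : nat) : 'I_n'.+1 :=
  if i < a then g' (inord i) else
  if i <= a + n then f' (inord (i - a)) else g' (inord (i + m - n)).

Lemma glue_map_junction (i : 'I_m.+1) : f' (g i) = g' (inord (a + i)).
Proof.
transitivity (g' (f i)); first exact: (congr1 (fun h : dhom m n' => h i) comm).
congr (g' _); apply: ord_inj; have im : i <= m by rewrite -ltnS.
rewrite inordK; last by rewrite ltnS; lia.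
by apply: dshiftE; lia.
Qed.

Lemma glue_map_mono (i j : nat) : i <= j -> j <= a + n + b ->
  glue_map i <= glue_map j.
Proof.
case: ag => g0 gm ij jN.
have gmono k l : k <= l -> l <= a + m + b -> g' (inord k) <= g' (inord l).
  by move=> kl lM; apply: dmono; rewrite !inordK // ltnS // (leq_trans kl).
have fmono k l : k <= l -> l <= n -> f' (inord k) <= f' (inord l).
  by move=> kl ln; apply: dmono; rewrite !inordK // ltnS // (leq_trans kl).
(* Because [g] preserves both endpoints, the branches of [glue_map] agree at [a] and [a + n];
   monotonicity across branches passes through these two values. *)
have f0 : f' (inord 0) = g' (inord a).
  have := glue_map_junction ord0; rewrite g0 addn0 => <-.
  by congr (f' _); apply: ord_inj; rewrite inordK.
have fn : f' (inord n) = g' (inord (a + m)).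
  have := glue_map_junction ord_max; rewrite gm => <-.
  by congr (f' _); apply: ord_inj; rewrite inordK.
rewrite /glue_map; case: (ltnP i a) => ia.
  case: (ltnP j a) => ja; first by apply: gmono; lia.
  case: (leqP j (a + n)) => jn; last by apply: gmono; lia.
  apply: (@leq_trans (f' (inord 0))); last by apply: fmono; lia.
  by rewrite f0; apply: gmono; lia.
have -> : (j < a) = false by lia.
case: (leqP i (a + n)) => hi; case: (leqP j (a + n)) => hj.
- by apply: fmono; lia.
- apply: (@leq_trans (f' (inord n))); first by apply: fmono; lia.
  by rewrite fn; apply: gmono; lia.
- by exfalso; lia.
- by apply: gmono; lia.
Qed.

Definition pushout_desc : dhom (a + n + b) n' :=
  @DHom (a + n + b) n' (fun i => glue_map i)
    (fun i j ij => glue_map_mono ij (ltn_ord j : j <= a + n + b)).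

Lemma pushout_desc_l : dcomp pushout_desc F' = f'.
Proof.
apply: dhom_ext => i; have i_n : i <= n by rewrite -ltnS.
rewrite dcompE /= /glue_map dshiftE ?leq_addr //.
have -> : (a + i < a) = false by lia.
have -> : a + i <= a + n by lia.
by congr (f' _); apply: ord_inj; rewrite addKn inordK.
Qed.

Lemma pushout_desc_r : dcomp pushout_desc G' = g'.
Proof.
apply: dhom_ext => i; have iM : i <= a + m + b by rewrite -ltnS.
rewrite dcompE /= /glue_map dextE; last exact: ext_nat_bound.
have [ia|ai] := ltnP i a.
  rewrite ext_nat_l ?(ltnW ia) // ia; congr (g' _); apply: ord_inj.
  by rewrite inordK.
have [im|mi] := leqP i (a + m).
  have ei : (i : nat) = a + (i - a) by lia.
  have -> : ext_nat a i = a + act_nat (i - a) by rewrite {1}ei ext_nat_mid //; lia.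
  have -> : (a + act_nat (i - a) < a) = false by lia.
  rewrite leq_add2l act_nat_le addKn.
  have hk : i - a < m.+1 by lia.
  have := glue_map_junction (Ordinal hk); rewrite /= -ei => h.
  transitivity (g' (inord i)); last by congr (g' _); apply: ord_inj; rewrite inordK.
  rewrite -h; congr (f' _); apply: ord_inj; rewrite inordK ?ltnS ?act_nat_le //.
  exact: (act_natE (Ordinal hk)).
have ei : (i : nat) = a + m + (i - (a + m)) by lia.
have -> : ext_nat a i = a + n + (i - (a + m)) by rewrite {1}ei ext_nat_r.
have -> : (a + n + (i - (a + m)) < a) = false by lia.
have -> : (a + n + (i - (a + m)) <= a + n) = false by lia.
congr (g' _); apply: ord_inj; rewrite inordK; lia.
Qed.

Lemma pushout_jointly_surjective (i : 'I_(a + n + b).+1) :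
  (exists j, i = F' j) \/ exists j, i = G' j.
Proof.
have iN : i <= a + n + b by rewrite -ltnS.
have [ia|ai] := ltnP i a.
  right; exists (inord i); apply: ord_inj.
  rewrite dextE inordK ?ext_nat_l //; lia.
have [im|mi] := leqP i (a + n).
  left; exists (inord (i - a)); apply: ord_inj.
  by rewrite dshiftE ?leq_addr // inordK; lia.
right; exists (inord (a + m + (i - (a + n)))); apply: ord_inj.
rewrite dextE inordK ?ext_nat_r; lia.
Qed.
End Pushout.

(** The given universal property yields [psi], and the explicit descent map is [phi]. One composite
    is the identity by uniqueness, the other because the two maps into [[a + n + b]] are jointly
    surjective. *)
Lemma pushout_local a b n' (f' : dhom n n') (g' : dhom (a + m + b) n') :
  is_pushout g (dshift a m (a + m + b)) f' g' ->
  sq_local X g (dshift a m (a + m + b)) f' g'.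
Proof.
case=> comm univ; have hl := extension_local a b.
have commE : dcomp (dshift a n (a + n + b)) g =
    dcomp (dext a (a + m + b) (a + n + b)) (dshift a m (a + m + b)).
  apply: dhom_eq => i; have im : i <= m by rewrite -ltnS.
  rewrite !dcompE dextE !dshiftE ?leq_addr ?ext_nat_mid ?act_natE //.
  by rewrite -addnA leq_add2l (leq_trans _ (leq_addr _ _)) // -ltnS.
have [psi [[psif psig] _]] := univ _ _ _ commE.
pose phi := pushout_desc comm.
have phif : dcomp phi (dshift a n (a + n + b)) = f' by exact: pushout_desc_l.
have phig : dcomp phi (dext a (a + m + b) (a + n + b)) = g' by exact: pushout_desc_r.
have phipsi : dcomp phi psi = did n'.
  have [w [_ uniq]] := univ _ _ _ comm.
  rewrite -(uniq (did n')) ?dcomp1f //; apply/esym/uniq.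
  by rewrite -!dcompA psif psig.
have psiphi : dcomp psi phi = did (a + n + b).
  apply: dhom_ext => i.
  case: (pushout_jointly_surjective i) => [[j ->]|[j ->]].
    by rewrite -[RHS]/(dshift a n (a + n + b) j) -{2}psif -phif.
  by rewrite -[RHS]/(dext a (a + m + b) (a + n + b) j) -{2}psig -phig.
apply: sq_is_local => // K; case: (hl K) => h1 h2 _; rewrite -phif -phig.
  exact: sq_exist_transfer psiphi h1.
exact: sq_unique_transfer phipsi commE h2.
Qed.
End Extend.
End LocalSquares.

Lemma inert_shift m m' (f : dhom m m') : inert f ->
  exists a b, m' = a + m + b /\ forall i, f i = a + i :> nat.
Proof.
move=> hf; have fE (i : nat) (h : i < m.+1) : f (Ordinal h) = f ord0 + i :> nat.
  elim: i h => [|i IH] h; first by rewrite addn0; congr (nat_of_ord (f _)); apply: ord_inj.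
  have h' : i < m.+1 by exact: ltnW.
  by rewrite addnS -(IH h'); apply: hf.
have fm := fE m (ltnSn m); have := ltn_ord (f (Ordinal (ltnSn m))).
rewrite fm ltnS => le; exists (f ord0), (m' - (f ord0 + m)).
by rewrite subnKC //; split=> // -[i h].
Qed.

Theorem proposition3p7 (X : simplicial_space) :
  is_segal_space X -> is_decomposition_space X.
Proof.
move=> segal m n m' n' g f f' g' po ag /inert_shift[a [b [e fE]]].
case: _ / (esym e) f g' po fE => f g' po fE.
have ef : f = dshift a m (a + m + b).
  by apply: dhom_eq => i; rewrite dshiftE ?leq_addr // fE.
case: _ / (esym ef) po => po.
by apply: sq_sends_to_pullback => K; case: (pushout_local segal ag po K).
Qed.
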